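(* Let $B_w$ be a chaotic weighted shift operator on $H(\mathbb D)$ with weight $w=(w_n)_{n\geq 1}$. Let $X$ be a centred subgaussian complex random variable of full support, and let $(X_n)_{n\geq 0}$ be a sequence of i.i.d. copies of $X$. Then $$g(z):=\sum_{n=0}^\infty\frac{X_n}{\prod_{k=1}^n w_k}z^n$$ defines almost surely an analytic function on $\mathbb D$ that is frequently hypercyclic for $B_w$. Moreover, there exist a (deterministic) set $E\subset[0,1)$ of finite logarithmic measure and a (deterministic) constant $C>0$ such that, almost surely, there exists $r_0\in(0,1)$ such that $$\max_{|z|=r}|g(z)|\leq C\sqrt{\log\Big(\frac1{1-r}\log\frac{\mu_f(r)}{1-r}\Big)}\;S_f(r)$$ for every $r$ with $r_0\leq r<1$ and $r\notin E$, where $f\in H(\mathbb D)$ is given by $f(z)=\sum_{n=0}^\infty\frac1{\prod_{k=1}^n w_k}z^n$.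
   Context: $\mathbb D=\{z\in\mathbb C:|z|<1\}$, and $\mathcal X=H(\mathbb D)$ is the space of analytic functions on $\mathbb D$ with the topology of uniform convergence on compact sets. A weight is a sequence $w=(w_n)_{n\ge1}$ of non-zero complex numbers; the weighted shift $B_w$ maps $h(z)=\sum_{n=0}^\infty b_nz^n$ to $(B_wh)(z)=\sum_{n=0}^\infty w_{n+1}b_{n+1}z^n$, and it is assumed to be an operator (continuous linear map) from $\mathcal X$ to $\mathcal X$. An operator $T$ on $\mathcal X$ is hypercyclic if some $h\in\mathcal X$ has dense orbit $\{T^nh:n\ge0\}$. It is chaotic if it is hypercyclic and has a dense set of periodic points (functions $h$ with $T^nh=h$ for some $n\ge1$). (It is well known that $B_w$ is chaotic on $H(\mathbb D)$ if and only if $\sum_{n=0}^\infty \frac{1}{\prod_{k=1}^n w_k}z^n\in H(\mathbb D)$.) A function $h\in\mathcal X$ is frequently hypercyclic for $T$ if for every non-empty open $U\subset\mathcal X$ the set $A=\{n\ge0:T^nh\in U\}$ has positive lower density, i.e. $\liminf_{N\to\infty}\frac1{N+1}\operatorname{card}\{n\in A:0\le n\le N\}>0$. Random variables are defined on a probability space $(\Omega,\mathcal A,\mathbb P)$. A complex random variable $X$ is subgaussian if there are $K,\tau>0$ with $\mathbb P(|X|>t)\le Ke^{-t^2/\tau^2}$ for all $t\ge0$; centred if $\mathbb E(X)=0$; of full support if $\mathbb P(X\in U)>0$ for every non-empty open $U\subset\mathbb C$. For $f(z)=\sum_{n=0}^\infty a_nz^n$ and $0\le r<1$: $\mu_f(r)=\max_{n\ge0}|a_n|r^n$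 (read as $\sup$) and $S_f(r)=\big(\sum_{n=0}^\infty|a_n|^2r^{2n}\big)^{1/2}$. A measurable set $E\subset[0,1)$ is of finite logarithmic measure if $\int_{E}\frac1{1-r}\,dr<\infty$. The number $r_0$ may depend on $\omega\in\Omega$. *)

(* Defs.v *)
From HB Require Import structures.
From mathcomp Require Import all_boot all_order all_algebra.
From mathcomp Require Import all_classical all_reals all_analysis.
From mathcomp Require Export complex.

Set Implicit Arguments.
Unset Strict Implicit.
Unset Printing Implicit Defensive.

Import Order.TTheory GRing.Theory Num.Theory.
Import numFieldNormedType.Exports.

Local Open Scope classical_set_scope.
Local Open Scope ring_scope.

(* The library puts the topology of a concrete numFieldType on its regular
   module; transport it to R[i] itself. *)
HB.instance Definition _ (R : realType) := NormedModule.copy R[i] R[i]^o.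
HB.instance Definition _ (R : realType) := PseudoPointedMetric.copy R[i] R[i]^o.

(* `|z| lives in R[i]; cabs z is the same modulus as an element of R. *)
Notation cabs := ComplexField.Normc.normc.

Section AnalyticFunctions.
Variable R : realType.

Definition disc : set R[i] := [set z | cabs z < 1].

(* Sum of a convergent power series near each point of the disc; the
   type [set_type disc] carries the subspace topology. *)
Definition analytic (h : set_type disc -> R[i]) : Prop :=
  forall z0 : set_type disc, exists (a : nat -> R[i]) (rho : R),
    0 < rho /\ forall z : set_type disc, cabs (val z - val z0) < rho ->
      series (fun n => a n * (val z - val z0) ^+ n) @ \oo --> h z.

Definition is_analytic : {pred set_type disc -> R[i]} :=
  fun h => `[< analytic h >].

Lemma is_analytic_submod : submod_closed is_analytic.
Proof.
split.
  apply/asboolP => z0; exists (fun=> 0), 1; split => // z _.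
  rewrite (_ : series _ = cst 0); first exact: cvg_cst.
  by apply/funext => n; rewrite /series /= big1// => i _; rewrite mul0r.
move=> c h k /asboolP hh /asboolP hk; apply/asboolP => z0.
have [a [r [r0 ha]]] := hh z0; have [b [s [s0 hb]]] := hk z0.
exists (fun n => c * a n + b n), (Order.min r s); split.
  by rewrite lt_min r0 s0.
move=> z; rewrite lt_min => /andP[/ha az /hb bz].
rewrite (_ : series _ = fun n =>
    c * series (fun n => a n * (val z - val z0) ^+ n) n +
    series (fun n => b n * (val z - val z0) ^+ n) n); last first.
  apply/funext => n; rewrite /series /= mulr_sumr -big_split /=.
  by apply: eq_bigr => i _; rewrite mulrDl mulrA.
exact: (cvgD (cvgM (cvg_cst c) az) bz).
Qed.

HB.instance Definition _ :=
  GRing.isSubmodClosed.Build R[i] (set_type disc -> R[i]) is_analytic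
    is_analytic_submod.

Record HD := MkHD {
  HD_fun :> set_type disc -> R[i] ;
  HD_analytic : HD_fun \in is_analytic }.

HB.instance Definition _ := [isSub for HD_fun].
HB.instance Definition _ := [Choice of HD by <:].
HB.instance Definition _ := [SubChoice_isSubLmodule of HD by <:].

Definition HD_compact_conv (h : HD) : {family compact, set_type disc -> R[i]} :=
  HD_fun h.

HB.instance Definition _ := Uniform.copy HD (initial_topology HD_compact_conv).

Definition power_series_of (h : HD) (b : nat -> R[i]) : Prop :=
  forall z : set_type disc,
    series (fun n => b n * val z ^+ n) @ \oo --> h z.

Definition weighted_shift (w : nat -> R[i]) (T : HD -> HD) : Prop :=
  forall h b, power_series_of h b ->
    power_series_of (T h) (fun n => w n.+1 * b n.+1).

Definition max_modulus (h : HD) (r : R) : R :=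
  sup [set cabs (h z) | z in [set z : set_type disc | cabs (val z) = r]].

(* mu_f and S_f in terms of the Taylor coefficients a of f. *)
Definition max_term (a : nat -> R[i]) (r : R) : R :=
  sup [set cabs (a n) * r ^+ n | n in [set: nat]].

Definition l2_mean (a : nat -> R[i]) (r : R) : R :=
  Num.sqrt (limn (series (fun n => cabs (a n) ^+ 2 * r ^+ (2 * n)))).

Definition finite_log_measure (E : set R) : Prop :=
  [/\ measurable E, E `<=` `[0, 1[%classic &
      (\int[lebesgue_measure]_(r in E) ((1 - r)^-1)%:E < +oo)%E].

End AnalyticFunctions.

Section LinearDynamics.

Definition hypercyclic (V : topologicalType) (T : V -> V) : Prop :=
  exists h : V, dense [set iter n T h | n in [set: nat]].

Definition chaotic (V : topologicalType) (T : V -> V) : Prop :=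
  hypercyclic T /\
  dense [set h : V | exists2 n : nat, (1 <= n)%N & iter n T h = h].

Definition lower_density (R : realType) (A : set nat) : \bar R :=
  limn_einf (fun N : nat =>
    (#|[pred n : 'I_N.+1 | (n : nat) \in A]|%:R / N.+1%:R)%:E).

Definition frequently_hypercyclic (R : realType) (V : topologicalType)
    (T : V -> V) (h : V) : Prop :=
  forall U : set V, open U -> U !=set0 ->
    (0 < lower_density R [set n | U (iter n T h)])%E.

End LinearDynamics.

(* The complex numbers with their Borel sigma-algebra. *)
Notation borelC R := (g_sigma_algebraType (@open R[i])).

Section RandomVariables.
Context (R : realType) d (Omega : measurableType d) (P : probability Omega R).

Definition subgaussian (X : {RV P >-> borelC R}) : Prop :=
  exists K tau : R, [/\ 0 < K, 0 < tau & forall t : R, 0 <= t ->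
    (P [set o | (t < cabs (X o))%R] <= (K * expR (- (t ^+ 2 / tau ^+ 2)))%:E)%E].

(* E(X) = E(Re X) + i E(Im X).  In \bar R, a sum in which +oo and -oo are
   cancelled equals -oo, so a null expectation entails integrability. *)
Definition centred (X : {RV P >-> borelC R}) : Prop :=
  ('E_P[fun o => complex.Re (X o)] = 0)%E /\
  ('E_P[fun o => complex.Im (X o)] = 0)%E.

Definition full_support (X : {RV P >-> borelC R}) : Prop :=
  forall U : set R[i], open U -> U !=set0 -> (0 < P (X @^-1` U))%E.

Definition mutually_independent d' (S : measurableType d')
    (X_ : nat -> {RV P >-> S}) : Prop :=
  forall (s : seq nat) (A : nat -> set S), uniq s ->
    (forall n, measurable (A n)) ->
    P (\bigcap_(n in [set` s]) (X_ n @^-1` A n)) =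
    (\prod_(n <- s) P (X_ n @^-1` A n))%E.

Definition iid_copies d' (S : measurableType d')
    (X : {RV P >-> S}) (X_ : nat -> {RV P >-> S}) : Prop :=
  mutually_independent X_ /\
  forall n (A : set S), measurable A ->
    distribution P (X_ n) A = distribution P X A.

End RandomVariables.

(* Main.v *)
Require Import Defs.
From HB Require Import structures.
From mathcomp Require Import finmap.
From mathcomp Require Import all_boot all_order all_algebra.
From mathcomp Require Import all_classical all_reals all_analysis measurable_realfun.
From mathcomp Require Import lra ring zify.

(** Chaos makes the coefficients a_n = 1 / (w_1 ... w_n) of f absolutely
    summable at every radius r < 1: if h = sum b_n z^n is a periodic point with
    h(0) <> 0, then the ratios b_n / a_n form a periodic sequence.

    Frequent hypercyclicity: B_w^n g has the coefficients X_(n+k) a_k, so the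
    values X_n, X_(n+1), ... have to meet given targets for a set of indices n
    of positive lower density.  Chebyshev's inequality bounds from below the
    number of n < 4^j at which the first 2^j targets are met, and by
    Borel-Cantelli the later targets are then met automatically.

    Growth: put u(r) = ln (mu_f(r) / (1 - r)).  Subgaussian deviations on a grid
    of mesh 16^-j bound the partial sums of order 2^j by sqrt j times S_f.  Off
    the exceptional set, u at most doubles between r and r + (1 - r) / u(r), so
    that the terms of index beyond a multiple of (u(r) / (1 - r))^2 have a
    bounded sum; hence j is of the order of ln (u(r) / (1 - r)).

    That a function in H(D) is the sum of its Taylor series is obtained without
    integrals: the maximum principle gives Schwarz's lemma, and averaging over
    roots of unity then gives Cauchy's estimates. *)

Set Implicit Arguments.
Unset Strict Implicit.
Unset Printing Implicit Defensive.

Import Order.TTheory GRing.Theory Num.Theory.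
Import numFieldNormedType.Exports.

Local Open Scope classical_set_scope.
Local Open Scope ring_scope.

(** The scales 2^j and 4^j are tied together twice. Windows of length 2^j starting at n and m are
    independent once |n - m| >= 2^j, so the count over n < 4^j has relative variance of order 2^j /
    4^j, which is summable. And n < 4^j, k >= 2^j give n + k <= (k + 1)^2, so that the almost sure
    bound |X_m| <= sqrt m yields |X_(n+k)| <= k + 1, the size of the later targets.

    In the growth estimate, the deviation inequality concerns one point, whereas all circles must be
    controlled at once. With N = 2^j, the mesh N^-4 makes the passage from a grid point to an
    arbitrary point cost only O(1/N) times S_f; the factor sqrt j is the price of the roughly
    16^(2j) grid points. The exceptional set is built from the radii at which u reaches the powers
    of 2. It involves f alone and is therefore deterministic, whereas r_0 depends on the indices
    from which the almost sure bounds hold.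

    The shift is specified through power series on the whole disc, but H(D) is defined by local
    expansions; hence Taylor's theorem has to precede the dynamics. *)

Section ComplexModulus.
Variable R : realType.
Implicit Types z w : R[i].

Lemma cabsE z : `|z| = (cabs z)%:C%C. Proof. by rewrite normc_def; case: z. Qed.

Lemma cabsM z w : cabs (z * w) = cabs z * cabs w.
Proof. exact: ComplexField.Normc.normcM. Qed.

Lemma cabsD z w : cabs (z + w) <= cabs z + cabs w.
Proof. exact: le_normcD. Qed.

Lemma cabsN z : cabs (- z) = cabs z. Proof. exact: normcN. Qed.

Lemma cabsBC z w : cabs (z - w) = cabs (w - z).
Proof. by rewrite -cabsN opprB. Qed.

Lemma cabsB z w : cabs (z - w) <= cabs z + cabs w.
Proof. by rewrite -(cabsN w) cabsD. Qed.

Lemma cabs0 : cabs (0 : R[i]) = 0. Proof. exact: ComplexField.Normc.normc0. Qed.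

Lemma cabs1 : cabs (1 : R[i]) = 1. Proof. exact: ComplexField.Normc.normc1. Qed.

Lemma cabsV z : cabs z^-1 = (cabs z)^-1.
Proof. exact: ComplexField.Normc.normcV. Qed.

Lemma cabsX z n : cabs (z ^+ n) = cabs z ^+ n.
Proof. by elim: n => [|n IH]; rewrite ?expr0 ?cabs1// !exprS cabsM IH. Qed.

Lemma cabs_ge0 z : 0 <= cabs z. Proof. by case: z => a b /=; exact: sqrtr_ge0. Qed.

Lemma cabs_eq0 z : (cabs z == 0) = (z == 0).
Proof.
by apply/eqP/eqP => [/ComplexField.Normc.eq0_normc//|->]; exact: cabs0.
Qed.

Lemma cabs_gt0 z : (0 < cabs z) = (z != 0).
Proof. by rewrite lt_neqAle cabs_ge0 andbT eq_sym cabs_eq0. Qed.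

Lemma cabs_real (x : R) : cabs x%:C%C = `|x|.
Proof. by rewrite /= expr0n addr0 sqrtr_sqr. Qed.

Lemma cabs_le_triangle z w : cabs z <= cabs w + cabs (z - w).
Proof. by rewrite -{1}(subrK w z) addrC cabsD. Qed.

Lemma cabs_dist z w : `|cabs z - cabs w| <= cabs (z - w).
Proof.
rewrite ler_norml; apply/andP; split.
  by rewrite lerBrDr addrC lerBlDr cabsBC cabs_le_triangle.
by rewrite lerBlDl cabs_le_triangle.
Qed.

Lemma cabs_sum n (F : nat -> R[i]) :
  cabs (\sum_(i < n) F i) <= \sum_(i < n) cabs (F i).
Proof.
elim: n => [|n IH]; first by rewrite !big_ord0 cabs0.
by rewrite !big_ord_recr/=; apply: le_trans (cabsD _ _) _; rewrite lerD2r.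
Qed.

Lemma cabs_ge_Re z : `|complex.Re z| <= cabs z.
Proof. by rewrite -lecR -cabsE normc_ge_Re. Qed.

Lemma cabs_ge_Im z : `|complex.Im z| <= cabs z.
Proof.
case: z => a b /=; rewrite -sqrtr_sqr ler_wsqrtr// lerDr; exact: sqr_ge0.
Qed.

Lemma cabs_le_ReIm z : cabs z <= `|complex.Re z| + `|complex.Im z|.
Proof.
case: z => a b /=; have s0 : 0 <= `|a| + `|b| by rewrite addr_ge0.
rewrite -(ger0_norm s0) -[leRHS]sqrtr_sqr ler_wsqrtr// sqrrD !real_normK ?num_real//.
by rewrite -addrA [_ *+ 2 + _]addrC addrA lerDl mulrn_wge0// mulr_ge0.
Qed.

Lemma Re_sum n (F : nat -> R[i]) :
  complex.Re (\sum_(i < n) F i) = \sum_(i < n) complex.Re (F i).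
Proof.
elim: n => [|n IH]; first by rewrite !big_ord0.
by rewrite !big_ord_recr -IH /=; case: (\sum_(i < n) _) (F n) => ? ? [].
Qed.

Lemma Im_sum n (F : nat -> R[i]) :
  complex.Im (\sum_(i < n) F i) = \sum_(i < n) complex.Im (F i).
Proof.
elim: n => [|n IH]; first by rewrite !big_ord0.
by rewrite !big_ord_recr -IH /=; case: (\sum_(i < n) _) (F n) => ? ? [].
Qed.

Lemma cball_cabs z w (e : R) : ball z e%:C%C w = (cabs (z - w) < e) :> Prop.
Proof. by rewrite -ball_normE /ball_/= cabsE ltcR. Qed.

Lemma nbhs_cabs z (A : set R[i]) :
  nbhs z A <-> exists2 e : R, 0 < e & forall w, cabs (z - w) < e -> A w.
Proof.
split.
  move=> /nbhs_ballP[e e0 eA].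
  (* In [R[i]] the order [0 < e] forces e to be real, so radii can be taken in [R]. *)
  have eR : e = (complex.Re e)%:C%C.
    by case: e e0 eA => x y; rewrite /= ltcE /= => /andP[/eqP-> _] _.
  exists (complex.Re e); first by rewrite -ltcR -eR.
  by move=> w zw; apply: eA; rewrite eR cball_cabs.
move=> [e e0 eA]; apply/nbhs_ballP; exists e%:C%C; first by rewrite /= ltcR.
by move=> w; rewrite cball_cabs; exact: eA.
Qed.

Lemma continuous_cabs : continuous (fun z : R[i] => cabs z : R).
Proof.
move=> z A /nbhs_ballP[e e0 eA]; apply/nbhs_cabs; exists e => // w zw.
by apply: eA; apply: le_lt_trans zw; exact: cabs_dist.
Qed.

End ComplexModulus.

(** * Convergent complex series, geometric comparison, power series *)

Section ComplexSeries.
Variable R : realType.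
Implicit Types (a : nat -> R[i]) (l : R[i]).

(** Convergence with radii in [R] and sums over ordinals: balls of [R[i]] have radii in [R[i]],
    which would burden every estimate. [csumP] is the bridge to the topological statement. *)
Definition csum a l := forall e : R, 0 < e ->
  exists N, forall n, (N <= n)%N -> cabs (\sum_(i < n) a i - l) < e.

Lemma csumP a l : series a @ \oo --> l <-> csum a l.
Proof.
split=> [cv e e0|cs].
  have /cv[N _ NA] : nbhs l [set w | cabs (l - w) < e].
    by apply/nbhs_cabs; exists e.
  exists N => n Nn; have := NA n Nn.
  by rewrite /= /series/= big_mkord cabsBC.
move=> A /nbhs_cabs[e e0 eA]; have [N NA] := cs _ e0.
exists N => // n Nn; apply: eA.
by rewrite /series /= big_mkord cabsBC; exact: NA.
Qed.

Lemma csum_ext a b l : a =1 b -> csum a l -> csum b l.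
Proof. by move=> /funext ->. Qed.

Lemma csum_dist_le a l c M k :
  (forall n, (k <= n)%N -> cabs (\sum_(i < n) a i - c) <= M) ->
  csum a l -> cabs (l - c) <= M.
Proof.
move=> aM cs; apply/ler_addgt0Pr => e e0; have [N NA] := cs _ e0.
have h1 := NA (maxn N k) (leq_maxl _ _); have h2 := aM (maxn N k) (leq_maxr _ _).
rewrite -(subrK (\sum_(i < maxn N k) a i) l) -addrA addrC.
by apply: le_trans (cabsD _ _) _; rewrite lerD// cabsBC ltW.
Qed.

Lemma csum_unique a l l' : csum a l -> csum a l' -> l = l'.
Proof.
move=> h1 h2; apply/eqP; rewrite -subr_eq0 -cabs_eq0 eq_le cabs_ge0 andbT.
apply/ler_addgt0Pr => e e0; rewrite add0r.
have [N NA] := h2 _ e0.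
by apply: (csum_dist_le (k := N) _ h1) => n Nn; rewrite ltW// NA.
Qed.

Lemma csumD a b l m : csum a l -> csum b m ->
  csum (fun n => a n + b n) (l + m).
Proof.
move=> ha hb e e0; have e20 : 0 < e / 2 by rewrite divr_gt0.
have [N NA] := ha _ e20; have [M MB] := hb _ e20.
exists (maxn N M) => n; rewrite geq_max => /andP[/NA h1 /MB h2].
rewrite big_split opprD addrACA (splitr e).
by apply: le_lt_trans (cabsD _ _) _; exact: ltrD.
Qed.

Lemma csumZ a l c : csum a l -> csum (fun n => c * a n) (c * l).
Proof.
move=> ha e e0.
have c0 : 0 < cabs c + 1 by rewrite ltr_pwDr// cabs_ge0.
have [N NA] := ha (e / (cabs c + 1)) (divr_gt0 e0 c0).
exists N => n /NA; rewrite ltr_pdivlMr// => h.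
rewrite -mulr_sumr -mulrBr cabsM; apply: le_lt_trans h.
by rewrite mulrC ler_wpM2l ?cabs_ge0// lerDl.
Qed.

Lemma csumN a l : csum a l -> csum (fun n => - a n) (- l).
Proof.
move=> /(csumZ (-1)); rewrite mulN1r; apply: csum_ext => n; exact: mulN1r.
Qed.

Lemma sum_ord_split (V : zmodType) (F : nat -> V) k n : (k <= n)%N ->
  \sum_(i < n) F i = \sum_(i < k) F i + \sum_(k <= i < n) F i.
Proof. by move=> kn; rewrite -!(big_mkord xpredT F) -big_cat_nat. Qed.

Lemma csum_eventually0 a k :
  (forall n, (k <= n)%N -> a n = 0) -> csum a (\sum_(i < k) a i).
Proof.
move=> a0 e e0; exists k => n kn.
rewrite (sum_ord_split _ kn).
rewrite addrAC subrr add0r big_nat_cond big1 ?cabs0//.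
by move=> i /andP[/andP[/a0 ->]].
Qed.

Lemma csum_term_bounded a l : csum a l -> exists M, forall n, cabs (a n) <= M.
Proof.
move=> /(_ _ ltr01)[N NA].
(* Beyond N a term is the difference of two partial sums within 1 of the limit, hence at most 2; the
   finite sum takes care of the other terms. *)
exists (2 + \sum_(i < N.+1) cabs (a i)) => n.
have s0 m : 0 <= \sum_(i < m) cabs (a i) by apply: sumr_ge0 => i _; exact: cabs_ge0.
have [nN|Nn] := leqP n N; last first.
  have := NA _ (ltnW Nn); have := NA _ (leq_trans (ltnW Nn) (leqnSn n)).
  rewrite big_ord_recr /=; set x := \sum_(i < n) _ => h1 h2.
  have -> : a n = (x + a n - l) - (x - l) by ring.
  apply: le_trans (cabsB _ _) _; apply: le_trans (ltW (ltrD h1 h2)) _.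
  by rewrite lerDl; exact: s0.
rewrite (bigD1 (Ordinal (nN : (n < N.+1)%N)))//= addrA [2 + _]addrC -addrA lerDl.
by rewrite addr_ge0// sumr_ge0// => i _; exact: cabs_ge0.
Qed.

(** Completeness of [R] is applied to the real and imaginary parts, both dominated by the
    modulus. *)
Lemma abs_csum a (M : R) : (forall n, \sum_(i < n) cabs (a i) <= M) ->
  exists l, csum a l.
Proof.
move=> aM.
have cvg_of (u : nat -> R) : (forall n, `|u n| <= cabs (a n)) ->
    exists x : R, series u @ \oo --> x.
  move=> ua; have : cvgn (series u).
    apply: normed_cvg; apply: nondecreasing_is_cvgn.
      by apply: (@nondecreasing_series _ (fun n => `|u n|) xpredT) => i _ _.
    exists M => _ [n _ <-]; rewrite /= /series/= big_mkord.
    by apply: le_trans (aM n); apply: ler_sum => i _; exact: ua.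
  by move=> /cvg_ex.
have [x ux] := cvg_of (fun n => complex.Re (a n)) (fun n => cabs_ge_Re (a n)).
have [y uy] := cvg_of (fun n => complex.Im (a n)) (fun n => cabs_ge_Im (a n)).
exists (x +i* y)%C => e e0.
have e20 : 0 < e / 2 by rewrite divr_gt0.
move/cvgrPdist_lt/(_ _ e20) : ux => [N _ NA].
move/cvgrPdist_lt/(_ _ e20) : uy => [N' _ NA'].
exists (maxn N N') => n; rewrite geq_max => /andP[/NA/= h1 /NA'/= h2].
rewrite (splitr e); apply: le_lt_trans (cabs_le_ReIm _) _.
have ReS := Re_sum n a.
have ImS := Im_sum n a.
move: h1 h2; rewrite /series /= !big_mkord -ReS -ImS.
case: (\sum_(i < n) a i) => p q /= h1 h2.
by apply: ltrD; rewrite distrC.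
Qed.

Lemma abs_csum_le a l (M : R) : csum a l ->
  (forall n, \sum_(i < n) cabs (a i) <= M) -> cabs l <= M.
Proof.
move=> cs aM; rewrite -(subr0 l); apply: (csum_dist_le (k := 0%N) _ cs) => n _.
by rewrite subr0; exact: le_trans (cabs_sum _ _) (aM n).
Qed.

Lemma abs_csum_tail a l k (M : R) : csum a l ->
  (forall n, \sum_(k <= i < n) cabs (a i) <= M) ->
  cabs (l - \sum_(i < k) a i) <= M.
Proof.
move=> cs aM; apply: (csum_dist_le (k := k) _ cs) => n kn.
rewrite (sum_ord_split _ kn) addrC addKr.
apply: le_trans (aM n); elim/big_ind2 : _ => //; first by rewrite cabs0.
by move=> x1 x2 y1 y2 h1 h2; apply: le_trans (cabsD _ _) _; exact: lerD.
Qed.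

End ComplexSeries.
Section GeometricSums.
Variable R : realType.

Lemma geom_sum_le (q : R) n : 0 <= q -> q < 1 ->
  \sum_(i < n) q ^+ i <= (1 - q)^-1.
Proof.
move=> q0 q1; have d0 : 0 < 1 - q by rewrite subr_gt0.
rewrite -[leRHS]mul1r ler_pdivlMr// mulrC.
have -> : (1 - q) * (\sum_(i < n) q ^+ i) = 1 - q ^+ n.
  by rewrite -opprB mulNr -subrX1 opprB.
by rewrite gerBl exprn_ge0.
Qed.

Lemma geom_tail_le (q : R) k n : 0 <= q -> q < 1 ->
  \sum_(k <= i < n) q ^+ i <= q ^+ k / (1 - q).
Proof.
move=> q0 q1; rewrite -{1}(add0n k) big_addn big_mkord.
under eq_bigr do rewrite addnC exprD.
by rewrite -mulr_sumr ler_wpM2l ?exprn_ge0// geom_sum_le.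
Qed.

(** Comparison with the geometric series of ratio t / s: a bound at radius s becomes a summable tail
    at every smaller radius t. *)
Lemma dominated_tail_le (x : nat -> R) (B s t : R) k n : 0 <= B ->
  0 <= t -> t < s -> (forall i, x i * s ^+ i <= B) ->
  \sum_(k <= i < n) x i * t ^+ i <= B * ((t / s) ^+ k / (1 - t / s)).
Proof.
move=> B0 t0 ts xB; have s0 : 0 < s := le_lt_trans t0 ts.
have q0 : 0 <= t / s by rewrite divr_ge0// ltW.
have q1 : t / s < 1 by rewrite ltr_pdivrMr// mul1r.
apply: le_trans (ler_wpM2l B0 (geom_tail_le k n q0 q1)).
rewrite mulr_sumr; apply: ler_sum => i _.
rewrite expr_div_n mulrA ler_pdivlMr ?exprn_gt0// mulrAC.
by rewrite ler_wpM2r ?exprn_ge0.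
Qed.

Lemma le_geom_eps (B q e : R) : 0 <= B -> 0 <= q -> q < 1 -> 0 < e ->
  exists N, forall n, (N <= n)%N -> B * q ^+ n < e.
Proof.
move=> B0 q0 q1 e0; have qn : `|q| < 1 by rewrite ger0_norm.
have B1 : 0 < B + 1 by rewrite ltr_pwDr.
have /cvgrPdist_lt/(_ _ (divr_gt0 e0 B1))[N _ NA] := cvg_expr qn.
exists N => n /NA /=; rewrite sub0r normrN ger0_norm ?exprn_ge0//.
rewrite ltr_pdivlMr// => h; apply: le_lt_trans h.
by rewrite mulrC ler_wpM2l ?exprn_ge0// lerDl.
Qed.

End GeometricSums.

Section PowerSeries.
Variable R : realType.
Implicit Types (a b : nat -> R[i]) (z : R[i]) (F G H : R[i] -> R[i]).

(** F is total on [R[i]], but its values at distance rho or more from z0 are irrelevant; this keeps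
    subset types out of the local theory. *)
Definition ps_at F z0 a (rho : R) := forall z, cabs (z - z0) < rho ->
  csum (fun n => a n * (z - z0) ^+ n) (F z).

Lemma ps_at_sub F z0 a (rho s : R) : s <= rho -> ps_at F z0 a rho -> ps_at F z0 a s.
Proof. by move=> sr h z zs; apply: h; exact: lt_le_trans zs sr. Qed.

Lemma ps_bounded F z0 a (rho s : R) : 0 <= s -> s < rho -> ps_at F z0 a rho ->
  exists2 B, 0 <= B & forall n, cabs (a n) * s ^+ n <= B.
Proof.
move=> s0 sr h; have [|M MA] := csum_term_bounded (h (z0 + s%:C%C) _).
  by rewrite addrAC subrr add0r cabs_real ger0_norm.
have aM n : cabs (a n) * s ^+ n <= M.
  by have := MA n; rewrite addrAC subrr add0r cabsM cabsX cabs_real ger0_norm.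
by exists M => //; apply: le_trans (aM 0%N); rewrite expr0 mulr1 cabs_ge0.
Qed.

Lemma dominated_csum a (B s : R) z : 0 <= B -> cabs z < s ->
  (forall n, cabs (a n) * s ^+ n <= B) -> exists l, csum (fun n => a n * z ^+ n) l.
Proof.
move=> B0 zs aB; apply: (@abs_csum _ _ (B * ((cabs z / s) ^+ 0 / (1 - cabs z / s)))).
move=> n; have := dominated_tail_le 0 n B0 (cabs_ge0 z) zs aB.
by rewrite big_mkord; under eq_bigr do rewrite -cabsX -cabsM.
Qed.

Lemma ps_remainder F z0 a (rho : R) k : 0 < rho -> ps_at F z0 a rho ->
  exists K s, [/\ 0 <= K, 0 < s & forall z, cabs (z - z0) < s ->
    cabs (F z - \sum_(i < k) a i * (z - z0) ^+ i) <= K * cabs (z - z0) ^+ k].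
Proof.
move=> r0 h; have r2 : 0 < rho / 2 by rewrite divr_gt0.
have [|B B0 aB] := ps_bounded (ltW r2) _ h; first lra.
(* The terms are bounded at radius rho / 2; for |w| < rho / 4 the ratio is at most 1/2 and the
   geometric factor at most 2. *)
exists (B * (2 * (rho / 2) ^- k)), (rho / 4); split.
- by rewrite mulr_ge0// mulr_ge0// invr_ge0 exprn_ge0// ltW.
- by rewrite divr_gt0.
move=> z zs; set w := z - z0 in zs *.
have wr : cabs w < rho by lra.
apply: abs_csum_tail (h z wr) _ => n.
have wr2 : cabs w < rho / 2 by lra.
have := dominated_tail_le k n B0 (cabs_ge0 w) wr2 aB.
under eq_bigr do rewrite -cabsX -cabsM.
move=> /le_trans; apply.
rewrite expr_div_n -!mulrA ler_wpM2l// [leRHS]mulrA [leRHS]mulrC [2 * _]mulrC.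
rewrite ler_wpM2l ?exprn_ge0 ?cabs_ge0// ler_wpM2l//.
  by rewrite invr_ge0 exprn_ge0// ltW.
have h12 : cabs w / (rho / 2) <= 1 / 2.
  by rewrite ler_pdivrMr//; lra.
rewrite -[leRHS]invrK lef_pV2 ?posrE//; lra.
Qed.

(** Stands for letting t tend to 0: if x > 0, some t <= x / (2 (|K| + 1)) violates the
    inequality. *)
Lemma small_le0 (x K s : R) : 0 < s ->
  (forall t, 0 < t -> t < s -> x <= K * t) -> x <= 0.
Proof.
move=> s0 h; rewrite leNgt; apply/negP => x0.
have K1 : 0 < `|K| + 1 by rewrite ltr_pwDr.
pose t := Num.min (s / 2) (x / (2 * (`|K| + 1))).
have t0 : 0 < t by rewrite lt_min !divr_gt0// mulr_gt0.
have ts : t < s by rewrite gt_min ltr_pdivrMr//; apply/orP; left; lra.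
have tx : t * (2 * (`|K| + 1)) <= x.
  by rewrite -ler_pdivlMr ?mulr_gt0// ge_min lexx orbT.
have := h t t0 ts; have : K * t <= `|K| * t by rewrite ler_wpM2r ?ler_norm// ltW.
by rewrite mulrDr mulr1 in tx; nra.
Qed.

(** Strong induction on n. Along real t, the equal coefficients below n cancel and both remainders
    are O(t^(n+1)), so |a n - b n| t^n = O(t^(n+1)). *)
Lemma ps_unique F z0 a b (rho rho' : R) : 0 < rho -> 0 < rho' ->
  ps_at F z0 a rho -> ps_at F z0 b rho' -> a =1 b.
Proof.
move=> r0 r0' ha hb n; have [m] := ubnP n; elim: m n => // m IH n /ltnSE nm.
have [K [s [K0 s0 hK]]] := ps_remainder n.+1 r0 ha.
have [K' [s' [K0' s0' hK']]] := ps_remainder n.+1 r0' hb.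
apply/eqP; rewrite -subr_eq0 -cabs_eq0 eq_le cabs_ge0 andbT.
apply: (@small_le0 _ (K + K') (Num.min s s')); first by rewrite lt_min s0.
move=> t t0; rewrite lt_min => /andP[ts ts'].
have E : z0 + t%:C%C - z0 = t%:C%C :> R[i] by rewrite addrAC subrr add0r.
have ct : cabs (t%:C%C : R[i]) = t by rewrite cabs_real ger0_norm// ltW.
have := hK (z0 + t%:C%C); have := hK' (z0 + t%:C%C); rewrite E ct.
move=> /(_ ts') h1 /(_ ts) h2; move: h1 h2.
rewrite !big_ord_recr /=.
have -> : \sum_(i < n) b i * t%:C%C ^+ i = \sum_(i < n) a i * t%:C%C ^+ i.
  by apply: eq_bigr => i _; rewrite IH// (leq_trans _ nm).
set X := \sum_(i < n) _ => h1 h2.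
have tn : 0 < t ^+ n by rewrite exprn_gt0.
rewrite -(ler_pM2r tn) -{1}ct -cabsX -cabsM.
have -> : (a n - b n) * t%:C%C ^+ n =
   (F (z0 + t%:C%C) - (X + b n * t%:C%C ^+ n)) -
   (F (z0 + t%:C%C) - (X + a n * t%:C%C ^+ n)) by ring.
apply: le_trans (cabsB _ _) _; apply: le_trans (lerD h1 h2) _.
by rewrite exprS; lra.
Qed.

Lemma ps_continuous F z0 a (rho : R) : 0 < rho -> ps_at F z0 a rho ->
  forall e : R, 0 < e -> exists2 s : R, 0 < s &
    forall z, cabs (z - z0) < s -> cabs (F z - F z0) < e.
Proof.
move=> r0 h e e0; have [K [s [K0 s0 hK]]] := ps_remainder 1 r0 h.
have K1 : 0 < K + 1 by rewrite ltr_pwDr.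
exists (Num.min s (e / (K + 1))); first by rewrite lt_min s0 divr_gt0.
have F0 : F z0 = a 0%N.
  apply: csum_unique (h z0 _) _; first by rewrite subrr cabs0.
  have -> : a 0%N = \sum_(i < 1) a i * (z0 - z0) ^+ i by rewrite big_ord1 expr0 mulr1.
  by apply: csum_eventually0 => -[//|n] _; rewrite subrr expr0n mulr0.
move=> z; rewrite lt_min ltr_pdivlMr// => /andP[/hK + ze].
rewrite big_ord1 expr0 mulr1 expr1 F0 => /le_lt_trans; apply.
by have := cabs_ge0 (z - z0); nra.
Qed.

Lemma psD F G z0 a b (rho : R) : ps_at F z0 a rho -> ps_at G z0 b rho ->
  ps_at (fun z => F z + G z) z0 (fun n => a n + b n) rho.
Proof.
move=> ha hb z zr; apply: csum_ext (csumD (ha z zr) (hb z zr)) => n.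
by rewrite mulrDl.
Qed.

Lemma psZ F z0 a (rho : R) c : ps_at F z0 a rho ->
  ps_at (fun z => c * F z) z0 (fun n => c * a n) rho.
Proof.
move=> ha z zr; apply: csum_ext (csumZ c (ha z zr)) => n.
by rewrite mulrA.
Qed.

Lemma ps_rot F z0 a (rho : R) (u : R[i]) : cabs u = 1 ->
  ps_at F (u * z0) a rho ->
  ps_at (fun z => F (u * z)) z0 (fun n => a n * u ^+ n) rho.
Proof.
move=> u1 ha z zr; have := ha (u * z).
rewrite -mulrBr cabsM u1 mul1r => /(_ zr); apply: csum_ext => n.
by rewrite exprMn mulrA.
Qed.

End PowerSeries.

(** * Local analyticity: recentring a power series, division by z *)

Section LocallyAnalytic.
Variable R : realType.
Implicit Types (a b : nat -> R[i]) (z : R[i]) (F G H : R[i] -> R[i]).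

Definition locan F z0 := exists a (rho : R), 0 < rho /\ ps_at F z0 a rho.

Lemma csum_sum (x : nat -> nat -> R[i]) (l : nat -> R[i]) K :
  (forall k, csum (x k) (l k)) ->
  csum (fun n => \sum_(k < K) x k n) (\sum_(k < K) l k).
Proof.
move=> h; elim: K => [|K IH].
  rewrite big_ord0; under [X in csum X]eq_fun do rewrite big_ord0.
  have := @csum_eventually0 R (fun=> 0) 0; rewrite big_ord0; exact.
rewrite big_ord_recr /=; apply: csum_ext (csumD IH (h K)) => n.
by rewrite big_ord_recr.
Qed.

Lemma csum_shift a l : csum a l ->
  csum (fun n => if n is m.+1 then a m else 0) l.
Proof.
move=> h e e0; have [N NA] := h e e0; exists N.+1 => -[//|n] Nn.
by rewrite big_ord_recl add0r; exact: NA.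
Qed.

Lemma csum_unshift a l : a 0%N = 0 -> csum a l -> csum (fun n => a n.+1) l.
Proof.
move=> a0 h e e0; have [N NA] := h e e0; exists N => n Nn.
have := NA n.+1 (leq_trans Nn (leqnSn n)).
by rewrite big_ord_recl a0 add0r.
Qed.

Lemma binomial_term_le (x t : R) k n : 0 <= x -> 0 <= t ->
  x ^+ (n - k) * t ^+ k *+ 'C(n, k) <= (x + t) ^+ n.
Proof.
move=> x0 t0; rewrite exprDn.
have [kn|nk] := leqP k n; last first.
  rewrite bin_small// mulr0n sumr_ge0// => i _.
  by rewrite mulrn_wge0// mulr_ge0// exprn_ge0.
rewrite (bigD1 (Ordinal (kn : (k < n.+1)%N)))//= lerDl sumr_ge0// => i _.
by rewrite mulrn_wge0// mulr_ge0// exprn_ge0.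
Qed.

Lemma cabsMn z n : cabs (z *+ n) = cabs z *+ n. Proof. exact: normcMn. Qed.

(** Rearrangement of the double sum of d k n = a_n C(n,k) z0^(n-k). The difference between F(z) and
    the first K terms of the recentred series is written as one series over n: its terms vanish for
    n < K, where the binomial expansion is complete, and are at most |a_n| (|z0| + |w|)^n otherwise,
    so only a dominated tail remains. *)
Lemma ps_recenter F a (r : R) z0 : ps_at F 0 a r -> cabs z0 < r ->
  exists b, ps_at F z0 b (r - cabs z0).
Proof.
move=> hF z0r.
pose d k n := a n * (z0 ^+ (n - k) *+ 'C(n, k)).
have d_le (t : R) k n : 0 <= t ->
    cabs (d k n) * t ^+ k <= cabs (a n) * (cabs z0 + t) ^+ n.
  move=> t0; rewrite /d cabsM cabsMn cabsX -mulrA ler_wpM2l ?cabs_ge0//.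
  by rewrite mulrnAl; apply: binomial_term_le; rewrite ?cabs_ge0.
have abs_d (t : R) : 0 <= t -> cabs z0 + t < r -> exists B s : R,
    [/\ 0 <= B, cabs z0 + t < s & forall n, cabs (a n) * s ^+ n <= B].
  move=> t0 tr; have s0 : 0 <= (cabs z0 + t + r) / 2.
    by have := cabs_ge0 z0; lra.
  have [|B B0 hB] := ps_bounded s0 _ hF; first lra.
  by exists B, ((cabs z0 + t + r) / 2); split => //; lra.
have /choice[b hb] k : exists l, csum (d k) l.
  pose t := (r - cabs z0) / 2.
  have t0 : 0 < t by rewrite divr_gt0// subr_gt0.
  have tr : cabs z0 + t < r by rewrite /t; lra.
  have [B [s [B0 zs aB]]] := abs_d t (ltW t0) tr.
  have zt0 : 0 <= cabs z0 + t by rewrite addr_ge0 ?cabs_ge0// ltW.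
  apply: (@abs_csum _ _ (B * (((cabs z0 + t) / s) ^+ 0 / (1 - (cabs z0 + t) / s)) / t ^+ k)).
  move=> n; rewrite ler_pdivlMr ?exprn_gt0// mulr_suml.
  apply: le_trans (dominated_tail_le 0 n B0 zt0 zs aB).
  by rewrite big_mkord; apply: ler_sum => i _; apply: d_le; exact: ltW.
exists b => z zr; set w := z - z0 in zr *.
have zE : z = z0 + w by rewrite /w addrC subrK.
have wr : cabs z0 + cabs w < r by lra.
have [B [s [B0 zs aB]]] := abs_d _ (cabs_ge0 w) wr.
have zw0 : 0 <= cabs z0 + cabs w by rewrite addr_ge0 ?cabs_ge0.
set q := (cabs z0 + cabs w) / s.
have s0 : 0 < s by apply: le_lt_trans zs.
have q0 : 0 <= q by rewrite divr_ge0// ltW.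
have q1 : q < 1 by rewrite ltr_pdivrMr// mul1r.
have expand n : a n * z ^+ n = \sum_(k < n.+1) d k n * w ^+ k.
  rewrite zE exprDn mulr_sumr; apply: eq_bigr => k _.
  by rewrite /d -mulrA mulrnAl.
have Fz : csum (fun n => a n * z ^+ n) (F z).
  have := hF z; rewrite subr0; apply; rewrite zE.
  by apply: le_lt_trans (cabsD _ _) _.
move=> e e0.
have [|N NA] := @le_geom_eps R (B / (1 - q)) q e _ q0 q1 e0.
  by rewrite divr_ge0// subr_ge0 ltW.
exists N => K NK; rewrite cabsBC; apply: le_lt_trans (NA K NK).
have hK := csum_sum K (fun k => csumZ (w ^+ k) (hb k)).
have := csumD Fz (csumN hK).
under [X in _ - X]eq_bigr do rewrite mulrC.
set u := (fun n => _) => hu.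
have u0 n : (n < K)%N -> u n = 0.
  move=> nK; rewrite /u expand (sum_ord_split (fun k => w ^+ k * d k n) nK).
  rewrite (_ : \sum_(n.+1 <= k < K) w ^+ k * d k n = 0) ?addr0; last first.
    rewrite big_nat_cond big1// => k /andP[/andP[nk _] _].
    by rewrite /d bin_small// mulr0n !mulr0.
  apply/eqP; rewrite subr_eq0; apply/eqP; apply: eq_bigr => k _; exact: mulrC.
have ub n : (K <= n)%N -> cabs (u n) <= cabs (a n) * (cabs z0 + cabs w) ^+ n.
  move=> Kn; rewrite /u expand (sum_ord_split (fun k => d k n * w ^+ k) (leq_trans Kn (leqnSn n))).
  rewrite addrAC; under [X in _ - X]eq_bigr do rewrite mulrC.
  rewrite subrr add0r.
  have -> : cabs (a n) * (cabs z0 + cabs w) ^+ n =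
            \sum_(0 <= k < n.+1) cabs (d k n * w ^+ k).
    rewrite big_mkord exprDn mulr_sumr; apply: eq_bigr => k _.
    by rewrite /d !cabsM cabsMn !cabsX -mulrA mulrnAl.
  rewrite (@big_cat_nat _ _ _ K 0 n.+1)//=; last exact: leq_trans Kn (leqnSn n).
  rewrite ler_wpDl//; first by apply: sumr_ge0 => k _; exact: cabs_ge0.
  elim/big_ind2 : _ => //; first by rewrite cabs0.
  by move=> x1 x2 y1 y2 h1 h2; apply: le_trans (cabsD _ _) _; exact: lerD.
rewrite -mulrA [_^-1 * _]mulrC.
have usum0 : \sum_(n < K) u n = 0 by apply: big1 => n _; exact: u0.
have := abs_csum_tail (k := K) hu; rewrite usum0 subr0; apply=> n.
apply: le_trans (dominated_tail_le K n B0 zw0 zs aB).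
rewrite big_nat_cond [leRHS]big_nat_cond; apply: ler_sum => k.
by rewrite andbT => /andP[Kk _]; exact: ub.
Qed.

(** With z = z0 + w, the coefficients of F(z) / z must solve z0 e_n + e_(n-1) = a_n, whence the
    recursion for [e]. *)
Lemma ps_div F z0 a (rho : R) : 0 < rho -> z0 != 0 -> ps_at F z0 a rho ->
  locan (fun z => F z / z) z0.
Proof.
move=> r0 z00 hF; have cz0 : 0 < cabs z0 by rewrite cabs_gt0.
pose s := Num.min (rho / 2) (cabs z0 / 2).
have s0 : 0 < s by rewrite lt_min !divr_gt0.
have sr : s < rho by rewrite gt_min ltr_pdivrMr//; apply/orP; left; lra.
have sz : s < cabs z0 by rewrite gt_min; apply/orP; right; lra.
have [B B0 aB] := ps_bounded (ltW s0) sr hF.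
pose fix e n := if n is m.+1 then (a m.+1 - e m) / z0 else a 0%N / z0.
(* This C makes the recursion preserve |e_n| s^n <= C, since B + s C = C |z0|; it relies on s <
   |z0|, the distance to the pole 0. *)
pose C := B / (cabs z0 - s).
have C0 : 0 <= C by rewrite divr_ge0// subr_ge0 ltW.
have CE : C * (cabs z0 - s) = B by rewrite mulfVK// gt_eqF// subr_gt0.
have eC n : cabs (e n) * s ^+ n <= C.
  elim: n => [|n IH] /=; rewrite cabsM cabsV.
    rewrite expr0 mulr1 ler_pdivrMr//.
    by have := aB 0%N; rewrite expr0 mulr1; nra.
  rewrite mulrAC ler_pdivrMr//.
  have h1 := aB n.+1.
  have h2 : cabs (a n.+1 - e n) * s ^+ n.+1 <=
            cabs (a n.+1) * s ^+ n.+1 + cabs (e n) * s ^+ n.+1.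
    by rewrite -mulrDl ler_wpM2r ?cabsB// exprn_ge0// ltW.
  apply: le_trans h2 _; rewrite {2}exprS [cabs (e n) * _]mulrCA.
  by nra.
exists e, s; split => // z zs; set w := z - z0 in zs *.
have [L hL] := dominated_csum C0 zs eC.
have zE : z = z0 + w by rewrite /w addrC subrK.
have zn0 : z != 0.
  apply: contraTneq zs => z0'; rewrite /w z0' sub0r cabsN -leNgt; exact: ltW.
suff -> : F z / z = L by [].
apply: (mulIf zn0); rewrite mulfVK//.
have hz := hF z (lt_trans zs sr).
apply: csum_unique hz _.
have := csumD (csumZ z0 hL) (csumZ w (csum_shift hL)).
have -> : z0 * L + w * L = L * z by rewrite zE; ring.
apply: csum_ext => -[|n] /=.
  by rewrite !expr0 !mulr1 mulr0 addr0 mulrC mulfVK.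
rewrite -/w exprS mulrA [z0 * _]mulrC mulfVK//; ring.
Qed.

Lemma locan_eq F G z0 (s : R) : 0 < s ->
  (forall z, cabs (z - z0) < s -> F z = G z) -> locan F z0 -> locan G z0.
Proof.
move=> s0 FG [a [rho [r0 ha]]]; exists a, (Num.min rho s).
split; first by rewrite lt_min r0.
by move=> z; rewrite lt_min => /andP[/ha + /FG <-].
Qed.

Lemma ps_div0 G g (rho : R) : g 0%N = 0 -> ps_at G 0 g rho ->
  ps_at (fun z => if z == 0 then g 1%N else G z / z) 0 (fun n => g n.+1) rho.
Proof.
move=> g0 hG z zr; rewrite subr0; case: eqVneq => [->|zn0].
  have := @csum_eventually0 R (fun n => g n.+1 * 0 ^+ n) 1.
  rewrite big_ord1 expr0 mulr1; apply => -[//|n] _.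
  by rewrite expr0n mulr0.
have := hG z zr; rewrite subr0 => /(@csum_unshift (fun n => g n * z ^+ n)).
rewrite g0 mul0r => /(_ erefl) /(csumZ z^-1); rewrite mulrC.
by apply: csum_ext => n; rewrite exprS mulrCA mulKf.
Qed.

End LocallyAnalytic.

(** * Maximum principle, Schwarz's lemma, Cauchy's estimates, Taylor's theorem *)

Section MaximumPrinciple.
Variable R : realType.
Implicit Types (a b : nat -> R[i]) (z : R[i]) (F G H : R[i] -> R[i]).

Lemma continuous_mkcomplex : continuous (fun p : R * R => (p.1 +i* p.2)%C).
Proof.
move=> [x y] A /nbhs_cabs[e e0 eA].
have e20 : 0 < e / 2 by rewrite divr_gt0.
exists (ball x (e / 2), ball y (e / 2)); first by split; exact: nbhsx_ballx.
move=> [x' y'] /= [xx' yy']; apply: eA.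
rewrite (splitr e); apply: le_lt_trans (cabs_le_ReIm _) _.
by apply: ltrD; [exact: xx'|exact: yy'].
Qed.

Lemma closed_cdisc (S : R) : closed [set z : R[i] | cabs z <= S].
Proof.
apply: (@closed_comp _ _ (fun z : R[i] => cabs z) [set x | x <= S]).
  by move=> z _; exact: continuous_cabs.
exact: closed_le.
Qed.

Lemma compact_cdisc (S : R) : compact [set z : R[i] | cabs z <= S].
Proof.
apply: (@subclosed_compact _ _
   ((fun p : R * R => (p.1 +i* p.2)%C) @` (`[- S, S]%classic `*` `[- S, S]%classic))).
- exact: closed_cdisc.
- apply: continuous_compact.
    by apply: continuous_subspaceT; exact: continuous_mkcomplex.
  by apply: compact_setX; exact: segment_compact.
- move=> z /= zS; exists (complex.Re z, complex.Im z); last by case: z {zS}.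
  have h1 := le_trans (cabs_ge_Re z) zS; have h2 := le_trans (cabs_ge_Im z) zS.
  by split; rewrite /= in_itv /= -ler_norml.
Qed.

Lemma locan_continuous F z0 : locan F z0 -> {for z0, continuous (fun z => cabs (F z))}.
Proof.
move=> [a [rho [r0 hF]]] A /nbhs_ballP[e e0 eA].
have [s s0 sF] := ps_continuous r0 hF e0.
apply/nbhs_cabs; exists s => // z zs; apply: eA => /=.
by rewrite /ball/= distrC; apply: le_lt_trans (cabs_dist _ _) _; apply: sF; rewrite cabsBC.
Qed.

Lemma locan_cdisc_max F (S : R) : 0 <= S ->
  (forall z, cabs z <= S -> locan F z) ->
  exists2 z1, cabs z1 <= S & forall z, cabs z <= S -> cabs (F z) <= cabs (F z1).
Proof.
move=> S0 hF.
have [||z1 z1S hz1] := @compact_EVT_max _ R (fun z : R[i] => cabs (F z)) _ _ (@compact_cdisc S).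
- by exists 0; have : cabs (0 : R[i]) <= S by rewrite cabs0.
- rewrite continuous_subspace_in => z; rewrite inE => zS.
  by apply: continuous_subspaceT_for => //; apply/locan_continuous/hF.
by exists z1 => [|z zS]; [rewrite inE in z1S|apply: hz1; rewrite inE].
Qed.

(** Argand's argument: unless F is constant near z1, its first nonconstant term a_(k+1) w^(k+1) can
    be given the direction of F(z1), and for small w it outweighs the remainder. *)
Lemma locan_const_or_increase F z1 : locan F z1 -> F z1 != 0 ->
  (exists2 s : R, 0 < s & forall z, cabs (z - z1) < s -> F z = F z1) \/
  (forall e : R, 0 < e -> exists2 z, cabs (z - z1) < e & cabs (F z1) < cabs (F z)).
Proof.
move=> [a [rho [r0 hF]]] F0.
have Fz1 : F z1 = a 0%N.
  have := hF z1; rewrite subrr cabs0 => /(_ r0) /csum_unique; apply.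
  have := @csum_eventually0 R (fun n => a n * 0 ^+ n) 1.
  rewrite big_ord1 expr0 mulr1; apply => -[//|n] _.
  by rewrite expr0n mulr0.
have [ex|nex] := pselect (exists k, a k.+1 != 0); last first.
  left; exists rho => // z zr; apply: csum_unique (hF z zr) _; rewrite Fz1.
  have := @csum_eventually0 R (fun n => a n * (z - z1) ^+ n) 1.
  rewrite big_ord1 expr0 mulr1; apply => -[//|n] _.
  have [->|an] := eqVneq (a n.+1) 0; first by rewrite mul0r.
  by exfalso; apply: nex; exists n.
right => e e0; case: (ex_minnP ex) => k ak kmin.
apply: contrapT => /forall2NP hno.
have {}hno z : cabs (z - z1) < e -> cabs (F z) <= cabs (F z1).
  by move=> ze; have [//|/negP] := hno z; rewrite -leNgt.
have [K [s [K0 s0 hK]]] := ps_remainder k.+2 r0 hF.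
(* Chosen so that along w = t zeta the two leading terms add up to (1 + t^(k+1)) F(z1), against a
   remainder O(t^(k+2)). *)
pose zeta := k.+1.-root (F z1 / a k.+1).
have zetaE : a k.+1 * zeta ^+ k.+1 = F z1.
  by rewrite /zeta rootCK// mulrC divfK.
have z1p : 0 < cabs zeta + 1 by rewrite ltr_pwDr// cabs_ge0.
suff : cabs (F z1) <= 0 by rewrite leNgt cabs_gt0 F0.
apply: (@small_le0 R _ (K * cabs zeta ^+ k.+2) (Num.min e s / (cabs zeta + 1))).
  by rewrite divr_gt0// lt_min e0.
move=> t t0; rewrite ltr_pdivlMr// lt_min => /andP[te ts].
pose w := t%:C%C * zeta.
have cw : cabs w = t * cabs zeta by rewrite cabsM cabs_real ger0_norm// ltW.
have E : z1 + w - z1 = w by rewrite addrAC subrr add0r.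
have wt : cabs w <= t * (cabs zeta + 1) by rewrite cw ler_wpM2l ?lerDl// ltW.
have h1 := hno (z1 + w); have h2 := hK (z1 + w); rewrite E in h1 h2.
have {}h1 := h1 (le_lt_trans wt te); have {h2} := h2 (le_lt_trans wt ts).
rewrite cw.
have tk : 0 < t ^+ k.+1 by rewrite exprn_gt0.
rewrite big_ord_recr big_ord_recl /= expr0 mulr1 big1 ?addr0; last first.
  move=> i _; have [->|ai] := eqVneq (a (lift ord0 i)) 0; first by rewrite mul0r.
  by have := kmin _ ai; rewrite leqNgt ltn_ord.
have -> : a 0%N + a k.+1 * w ^+ k.+1 = (1 + t ^+ k.+1)%:C%C * F z1.
  rewrite -Fz1 /w exprMn mulrCA zetaE rmorphD rmorphXn /=; ring.
rewrite exprMn => h2.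
have h3 : (1 + t ^+ k.+1) * cabs (F z1) <=
          cabs (F z1) + K * (t ^+ k.+2 * cabs zeta ^+ k.+2).
  have -> : (1 + t ^+ k.+1) * cabs (F z1) = cabs ((1 + t ^+ k.+1)%:C%C * F z1).
    by rewrite cabsM cabs_real ger0_norm// addr_ge0// ltW.
  apply: le_trans (cabs_le_triangle _ (F (z1 + w))) _.
  by rewrite lerD// cabsBC.
rewrite -(ler_pM2l tk); move: h3; rewrite [t ^+ k.+2]exprS mulrDl mul1r lerD2l.
by move/le_trans; apply; rewrite le_eqVlt; apply/orP; left; apply/eqP; ring.
Qed.

(** Suppose the maximum V on the disc exceeds M. Among the points where V is attained, take z2 of
    greatest modulus; it is interior because |F| <= M on the circle. Near z2 the modulus cannot
    exceed V, so F is constant there, and a point slightly further out also attains V, a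
    contradiction. *)
Lemma max_principle F (S M : R) : 0 < S ->
  (forall z, cabs z <= S -> locan F z) ->
  (forall z, cabs z = S -> cabs (F z) <= M) ->
  forall z, cabs z <= S -> cabs (F z) <= M.
Proof.
move=> S0 hF FM z zS.
have [z1 z1S z1max] := locan_cdisc_max (ltW S0) hF.
apply: le_trans (z1max z zS) _; rewrite leNgt; apply/negP => MV.
pose A := [set z | cabs z <= S /\ cabs (F z1) <= cabs (F z)].
have cA : compact A.
  apply: (@subclosed_compact _ _ [set z : R[i] | cabs z <= S]); [|exact: compact_cdisc|by move=> ? []].
  move=> y yA; have yS : cabs y <= S.
    suff : [set z : R[i] | cabs z <= S] y by [].
    by apply: closed_cdisc => B /yA[x [[xS _] Bx]]; exists x.
  split=> //; rewrite leNgt; apply/negP => yV.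
  have /nbhs_cabs : nbhs y [set x | cabs (F x) < cabs (F z1)].
    exact: (locan_continuous (hF y yS) (open_nbhs_nbhs (conj (@open_lt _ _) yV))).
  move=> [e e0 eA]; have [|x [[_ xV] xe]] := yA [set x | cabs (y - x) < e].
    by apply/nbhs_cabs; exists e.
  by have /= := eA x xe; rewrite ltNge xV.
have [||z2 z2A z2max] := @compact_EVT_max _ R (fun z : R[i] => cabs z) A _ cA.
- by exists z1; split.
- by apply: continuous_subspaceT; exact: continuous_cabs.
rewrite inE in z2A; case: z2A => z2S z2V.
have z2lt : cabs z2 < S.
  rewrite lt_neqAle z2S andbT; apply/negP => /eqP /FM; rewrite leNgt.
  by rewrite (lt_le_trans MV z2V).
have F2 : F z2 != 0.
  rewrite -cabs_gt0; apply: lt_le_trans z2V; apply: le_lt_trans MV.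
  apply: le_trans (FM S%:C%C _); rewrite ?cabs_ge0//.
  by rewrite cabs_real ger0_norm// ltW.
have inA x : cabs x <= S -> cabs (F z1) <= cabs (F x) -> cabs x <= cabs z2.
  by move=> xS xV; apply: z2max; rewrite inE.
have S2 : 0 < S - cabs z2 by rewrite subr_gt0.
have [[s s0 hc]|inc] := locan_const_or_increase (hF z2 z2S) F2; last first.
  have [x x2] := inc _ S2; apply/negP; rewrite -leNgt.
  apply: le_trans z2V; apply: z1max.
  by have := cabs_le_triangle x z2; lra.
(* Moving z2 outward by t stays both where F is constant and in the closed disc of radius S. *)
pose t := Num.min (s / 2) (S - cabs z2).
have t0 : 0 < t by rewrite lt_min S2 divr_gt0.
have ts : t < s by rewrite gt_min; apply/orP; left; lra.
have tS : t <= S - cabs z2 by rewrite ge_min lexx orbT.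
have [u u1 z2E] : exists2 u, cabs u = 1 & z2 = (cabs z2)%:C%C * u.
  have [z20|z20] := eqVneq z2 0; first by exists 1; rewrite ?cabs1// z20 cabs0 mul0r.
  exists (z2 / (cabs z2)%:C%C).
    rewrite cabsM cabsV cabs_real ger0_norm ?cabs_ge0// divff//.
    by rewrite cabs_eq0.
  by rewrite mulrC divfK// -cabs_eq0 cabs_real normr_eq0 cabs_eq0.
pose x := (cabs z2 + t)%:C%C * u.
have cx : cabs x = cabs z2 + t.
  by rewrite cabsM u1 mulr1 cabs_real ger0_norm// addr_ge0 ?cabs_ge0// ltW.
have xz2 : x - z2 = t%:C%C * u by rewrite z2E /x rmorphD /=; ring.
have := inA x; rewrite cx (hc x); last first.
  by rewrite xz2 cabsM u1 mulr1 cabs_real ger0_norm// ltW.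
move=> /(_ _ z2V); rewrite -lerBrDl => /(_ tS).
by rewrite gerDl leNgt t0.
Qed.

(** Induction on m: F(z) / z, with value a_1 at 0, is again locally analytic, is bounded by M / S on
    the circle and loses one order of vanishing. The case m = 0 is the maximum principle. *)
Lemma schwarz F a (rho S M : R) m : 0 < S -> 0 < rho ->
  (forall z, cabs z <= S -> locan F z) -> ps_at F 0 a rho ->
  (forall n, (n < m)%N -> a n = 0) ->
  (forall z, cabs z = S -> cabs (F z) <= M) ->
  forall z, cabs z <= S -> cabs (F z) * S ^+ m <= M * cabs z ^+ m.
Proof.
move=> S0 r0; elim: m F a M => [|m IH] F a M hF ha a0 FM z zS.
  by rewrite !expr0 !mulr1; exact: max_principle hF FM z zS.
pose G z := if z == 0 then a 1%N else F z / z.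
have FG y : F y = G y * y.
  rewrite /G; case: eqVneq => [->|y0]; last by rewrite divfK.
  rewrite mulr0; have := ha 0; rewrite subr0 cabs0 => /(_ r0)/csum_unique; apply.
  have := @csum_eventually0 R (fun n => a n * 0 ^+ n) 0.
  rewrite big_ord0; apply => -[|n] _; first by rewrite a0// mul0r.
  by rewrite expr0n mulr0.
have hG y : cabs y <= S -> locan G y.
  move=> yS; have [->|y0] := eqVneq y 0.
    by exists (fun n => a n.+1), rho; split => //; apply: ps_div0 => //; exact: a0.
  have [b [s [s0 hb]]] := hF y yS.
  apply: (@locan_eq _ (fun z => F z / z) _ _ (cabs y)); rewrite ?cabs_gt0//.
    move=> x xy; rewrite /G; case: eqVneq => [x0|//].
    by move: xy; rewrite x0 sub0r cabsN ltxx.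
  exact: ps_div hb.
have GM y : cabs y = S -> cabs (G y) <= M / S.
  by move=> yS; rewrite ler_pdivlMr// -[X in _ * X]yS -cabsM -FG FM.
have a0S n : (n < m)%N -> a n.+1 = 0 by move=> nm; apply: a0; rewrite ltnS.
have h := IH G (fun n => a n.+1) (M / S) hG (ps_div0 (a0 0%N isT) ha) a0S GM z zS.
rewrite FG cabsM !exprS; have := cabs_ge0 z => z0.
have : cabs (G z) * S ^+ m * S * cabs z <= M * cabs z ^+ m * cabs z.
  rewrite ler_wpM2r//; move: h; rewrite mulrAC ler_pdivlMr//.
lra.
Qed.

(** Divide the Schwarz bound at a small real t by t^m and let t tend to 0: F(t) is a_m t^m up to
    O(t^(m+1)). *)
Lemma schwarz_coef F a (rho S M : R) m : 0 < S -> 0 < rho ->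
  (forall z, cabs z <= S -> locan F z) -> ps_at F 0 a rho ->
  (forall n, (n < m)%N -> a n = 0) ->
  (forall z, cabs z = S -> cabs (F z) <= M) -> cabs (a m) * S ^+ m <= M.
Proof.
move=> S0 r0 hF ha a0 FM; have hS := schwarz S0 r0 hF ha a0 FM.
have [K [s [K0 s0 hK]]] := ps_remainder m.+1 r0 ha.
rewrite -subr_le0; apply: (@small_le0 R _ (K * S ^+ m) (Num.min s S)).
  by rewrite lt_min s0.
move=> t t0; rewrite lt_min => /andP[ts tS].
have ct : cabs (t%:C%C : R[i]) = t by rewrite cabs_real ger0_norm// ltW.
have := hK t%:C%C; have := hS t%:C%C; rewrite subr0 ct => /(_ (ltW tS)) h1 /(_ ts).
rewrite big_ord_recr big1 /= ?add0r; last by move=> i _; rewrite a0// mul0r.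
move=> h2; have tm : 0 < t ^+ m by rewrite exprn_gt0.
have h3 : cabs (a m) * t ^+ m <= cabs (F t%:C%C) + K * t ^+ m.+1.
  have -> : cabs (a m) * t ^+ m = cabs (a m * t%:C%C ^+ m) by rewrite cabsM cabsX ct.
  by apply: le_trans (cabs_le_triangle _ (F t%:C%C)) _; rewrite lerD2l cabsBC.
have Sm : 0 < S ^+ m by rewrite exprn_gt0.
rewrite -(ler_pM2r tm); rewrite exprS in h3.
have : cabs (a m) * t ^+ m * S ^+ m <= (cabs (F t%:C%C) + K * (t * t ^+ m)) * S ^+ m.
  by rewrite ler_wpM2r// ltW.
lra.
Qed.

(* Averaging F over rotations by 2^i-th roots of unity kills the coefficients
   of index n <> m mod 2^i without increasing the maximum on circles. *)
Lemma root_average F a (S M : R) m i :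
  (forall z, cabs z <= S -> locan F z) ->
  (exists2 rho, 0 < rho & ps_at F 0 a rho) ->
  (forall z, cabs z = S -> cabs (F z) <= M) ->
  exists G b, [/\ (forall z, cabs z <= S -> locan G z),
    (exists2 rho, 0 < rho & ps_at G 0 b rho),
    (forall z, cabs z = S -> cabs (G z) <= M), b m = a m &
    forall n, b n != 0 -> (n = m %[mod 2 ^ i])%N].
Proof.
move=> hF ha FM; elim: i => [|i [G [b [hG [rho r0 hb] GM bm b0]]]].
  by exists F, a; split => // n _; rewrite !modn1.
(* The remaining indices are n = m + l 2^i, for which u^(n-m) = (-1)^l; the mean of G(z) and u^-m
   G(u z) keeps those with l even. *)
pose u : R[i] := (2 ^ i).-root (-1).
have u2i : u ^+ (2 ^ i) = -1 by rewrite rootCK// expn_gt0.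
have u1 : cabs u = 1.
  apply/eqP; rewrite -(@pexpr_eq1 _ _ (2 ^ i)) ?expn_gt0 ?cabs_ge0//.
  by rewrite -cabsX u2i cabsN cabs1.
have u0 : u != 0 by rewrite -cabs_eq0 u1 oner_eq0.
have um1 : cabs (u ^- m) = 1 by rewrite cabsV cabsX u1 expr1n invr1.
have h2 : cabs (2^-1 : R[i]) = 2^-1.
  have -> : (2^-1 : R[i]) = (2^-1 : R)%:C%C by rewrite fmorphV rmorph_nat.
  by rewrite cabs_real ger0_norm.
exists (fun z => 2^-1 * (G z + u ^- m * G (u * z))),
  (fun n => 2^-1 * (b n + u ^- m * (b n * u ^+ n))); split.
- move=> z zS; have [c [s [s0 hc]]] := hG z zS.
  have uzS : cabs (u * z) <= S by rewrite cabsM u1 mul1r.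
  have [c' [s' [s'0 hc']]] := hG _ uzS.
  exists (fun n => 2^-1 * (c n + u ^- m * (c' n * u ^+ n))), (Num.min s s').
  split; first by rewrite lt_min s0.
  apply: psZ; apply: psD; first by apply: ps_at_sub hc; rewrite ge_min lexx.
  apply: (@psZ _ (fun z => G (u * z))); apply: ps_rot => //.
  by apply: ps_at_sub hc'; rewrite ge_min lexx orbT.
- exists rho => //; apply: psZ; apply: psD => //.
  apply: (@psZ _ (fun z => G (u * z))); apply: ps_rot => //.
  by rewrite mulr0.
- move=> z zS; rewrite cabsM h2 mulrC ler_pdivrMr//.
  apply: le_trans (cabsD _ _) _; rewrite cabsM um1 mul1r mulr_natr mulr2n.
  by rewrite lerD// GM// cabsM u1 mul1r.
- have -> : b m + u ^- m * (b m * u ^+ m) = b m * 2.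
    by rewrite mulrCA mulVf ?expf_neq0// mulr1 mulr_natr mulr2n.
  by rewrite mulrC mulfK// pnatr_eq0.
move=> n; rewrite -[X in X + _]mulr1 mulrCA -mulrDr mulf_eq0 mulf_eq0 !negb_or.
move=> /and3P[_ /b0 nm nz].
(* n = m mod 2^i, and u^n <> - u^m rules out n = m + 2^i mod 2^(i+1). *)
have key k : u ^+ k = (-1) ^+ (k %/ 2 ^ i) * u ^+ (k %% 2 ^ i).
  by rewrite {1}(divn_eq k (2 ^ i)) exprD mulnC exprM u2i.
move: nz; rewrite (key n) (key m) nm; set e := u ^+ _ => nz.
have e0 : e != 0 by rewrite expf_neq0.
have par : odd (n %/ 2 ^ i) = odd (m %/ 2 ^ i).
  apply: contraNeq nz; rewrite -[(-1) ^+ (n %/ _)]signr_odd -[(-1) ^+ (m %/ _)]signr_odd.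
  case: (odd _) (odd _) => [] [] //= _; rewrite ?expr0 ?expr1 ?mul1r ?mulN1r ?invrN.
    by rewrite ?mulrN ?mulNr mulVf// subrr.
  by rewrite ?mulrN ?mulNr mulVf// subrr.
rewrite expnS; apply/eqP.
rewrite (divn_eq n (2 ^ i)) (divn_eq m (2 ^ i)) nm eqn_modDr.
by rewrite -!muln_modl eqn_pmul2r ?expn_gt0// !modn2 par.
Qed.

(** Averaging modulo 2^m removes every coefficient of index n < m, because m < 2^m; the average then
    vanishes to order m at 0 and Schwarz's lemma bounds its coefficient a_m. *)
Lemma cauchy_estimate F a (S M : R) m : 0 < S ->
  (forall z, cabs z <= S -> locan F z) ->
  (exists2 rho, 0 < rho & ps_at F 0 a rho) ->
  (forall z, cabs z = S -> cabs (F z) <= M) -> cabs (a m) * S ^+ m <= M.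
Proof.
move=> S0 hF ha FM.
have [G [b [hG [rho r0 hb] GM <- b0]]] := root_average m m hF ha FM.
apply: (schwarz_coef S0 r0 hG hb) => // n nm.
have [//|/b0] := eqVneq (b n) 0.
have m2 : (m < 2 ^ m)%N by exact: ltn_expl.
rewrite (modn_small m2) (modn_small (ltn_trans nm m2)) => nm'.
by move: nm; rewrite nm' ltnn.
Qed.

(** Cauchy's estimates on every radius S < 1 make the Taylor series at 0 converge in the disc, to G
    say. Then D = F - G has zero Taylor coefficients at 0, so Schwarz's lemma holds for every m and
    bounds |D(z)| by a constant times (|z| / S)^m, which tends to 0. *)
Lemma taylor_disc F : (forall z, cabs z < 1 -> locan F z) ->
  exists a, ps_at F 0 a 1.
Proof.
move=> hF; have [|a [rho [r0 ha]]] := hF 0; first by rewrite cabs0.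
have hFS (S : R) : S < 1 -> forall z, cabs z <= S -> locan F z.
  by move=> S1 z zS; apply: hF; exact: le_lt_trans zS S1.
have bnd (S : R) : 0 < S -> S < 1 ->
    exists2 B, 0 <= B & forall n, cabs (a n) * S ^+ n <= B.
  move=> S0 S1; have [z1 _ z1max] := locan_cdisc_max (ltW S0) (hFS S S1).
  exists (cabs (F z1)); first exact: cabs_ge0.
  move=> n; apply: (cauchy_estimate _ S0 (hFS S S1)); first by exists rho.
  by move=> z zS; apply: z1max; rewrite zS.
have /choice[G hG] z : exists l, cabs z < 1 -> csum (fun n => a n * z ^+ n) l.
  have [z1|z1] := ltP (cabs z) 1; last by exists 0.
  pose S := (cabs z + 1) / 2; have z0 := cabs_ge0 z.
  have [||B B0 hB] := bnd S; [rewrite /S; lra|rewrite /S; lra|].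
  have zS : cabs z < S by rewrite /S; lra.
  by have [l hl] := dominated_csum B0 zS hB; exists l.
have hG0 : ps_at G 0 a 1 by move=> z; rewrite subr0; exact: hG.
exists a => z; rewrite subr0 => z1.
suff -> : F z = G z by exact: hG.
apply/eqP; rewrite -subr_eq0 -cabs_eq0 eq_le cabs_ge0 andbT.
pose S := (cabs z + 1) / 2; have z0 := cabs_ge0 z.
have S0 : 0 < S by rewrite /S; lra.
have S1 : S < 1 by rewrite /S; lra.
have zS : cabs z < S by rewrite /S; lra.
pose D z := F z + -1 * G z.
have hD y : cabs y <= S -> locan D y.
  move=> yS; have y1 := le_lt_trans yS S1.
  have [c [s [s0 hc]]] := hF y y1; have [b hb] := ps_recenter hG0 y1.
  exists (fun n => c n + -1 * b n), (Num.min s (1 - cabs y)).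
  split; first by rewrite lt_min s0 subr_gt0.
  apply: psD; last apply: psZ; [apply: ps_at_sub hc|apply: ps_at_sub hb].
    by rewrite ge_min lexx.
  by rewrite ge_min lexx orbT.
have [w _ wmax] := locan_cdisc_max (ltW S0) hD.
have hD0 : ps_at D 0 (fun=> 0) (Num.min rho 1).
  have -> : (fun=> 0) = (fun n => a n + -1 * a n) by apply/funext => n; ring.
  apply: psD; last apply: psZ; [apply: ps_at_sub ha|apply: ps_at_sub hG0].
    by rewrite ge_min lexx.
  by rewrite ge_min lexx orbT.
have DW y : cabs y = S -> cabs (D y) <= cabs (D w) by move=> yS; rewrite wmax ?yS.
have hs m := schwarz S0 (_ : 0 < Num.min rho 1) hD hD0 (fun _ _ => erefl) DW (m := m) (ltW zS).
have q0 : 0 <= cabs z / S by rewrite divr_ge0// ltW.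
have q1 : cabs z / S < 1 by rewrite ltr_pdivrMr// mul1r.
apply/ler_addgt0Pr => e e0; rewrite add0r.
have [N NA] := le_geom_eps (cabs_ge0 (D w)) q0 q1 e0.
apply: ltW; apply: le_lt_trans (NA N (leqnn N)).
rewrite expr_div_n mulrA ler_pdivlMr ?exprn_gt0//.
have -> : F z - G z = D z by rewrite /D mulN1r.
by apply: hs; rewrite lt_min r0 ltr01.
Qed.

End MaximumPrinciple.

(** * The space H(D): coefficients and topology *)

Section DiscFunctions.
Variable R : realType.
Implicit Types (h g : HD R) (b c : nat -> R[i]).

(** Says that the radius of convergence is at least 1, in a form that avoids root tests and passes
    easily to products. *)
Definition coef_bounded c := forall r : R, 0 <= r -> r < 1 ->
  exists2 B : R, 0 <= B & forall n, cabs (c n) * r ^+ n <= B.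

Definition disc_pt (z : R[i]) (z1 : cabs z < 1) : set_type (@disc R) :=
  exist _ z (mem_set (z1 : disc z)).

Lemma disc_lt1 (z : set_type (@disc R)) : cabs (val z) < 1.
Proof. by case: z => z /= /set_mem. Qed.

(** The value 0 outside the disc is a dummy; the extension carries functions on the subtype to the
    local theory of total functions. *)
Definition disc_ext (h : set_type (@disc R) -> R[i]) (z : R[i]) : R[i] :=
  if pselect (cabs z < 1) is left z1 then h (disc_pt z1) else 0.

Lemma disc_extE h z (z1 : cabs z < 1) : disc_ext h z = h (disc_pt z1).
Proof.
by rewrite /disc_ext; case: pselect => // z1'; congr (HD_fun h _); apply: val_inj.
Qed.

Lemma disc_ext_val h z : disc_ext h (val z) = h z.
Proof. by rewrite (disc_extE h (disc_lt1 z)); congr (HD_fun h _); apply: val_inj. Qed.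

Lemma power_series_ofP h b :
  power_series_of h b <-> forall z, csum (fun n => b n * val z ^+ n) (h z).
Proof. by split=> H z; apply/csumP; exact: H. Qed.

Lemma power_series_of_ps_at h b : power_series_of h b -> ps_at (disc_ext h) 0 b 1.
Proof.
move=> /power_series_ofP hb z; rewrite subr0 => z1.
by rewrite (disc_extE h z1); exact: (hb (disc_pt z1)).
Qed.

Lemma power_series_of_unique h b c :
  power_series_of h b -> power_series_of h c -> b =1 c.
Proof.
move=> /power_series_of_ps_at hb /power_series_of_ps_at hc.
exact: ps_unique ltr01 ltr01 hb hc.
Qed.

Lemma power_series_of_bounded h b : power_series_of h b -> coef_bounded b.
Proof.
move=> /power_series_of_ps_at hb r r0 r1; exact: ps_bounded r0 r1 hb.
Qed.

Lemma HD_taylor h : exists b, power_series_of h b.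
Proof.
have [z z1|a ha] := @taylor_disc R (disc_ext h).
  have /asboolP anh := HD_analytic h; have [a [rho [r0 ha]]] := anh (disc_pt z1).
  exists a, (Num.min rho (1 - cabs z)); split; first by rewrite lt_min r0 subr_gt0.
  move=> y; rewrite lt_min => /andP[yr yz].
  have y1 : cabs y < 1 by have := cabs_le_triangle y z; lra.
  by rewrite (disc_extE h y1); apply/csumP; exact: (ha (disc_pt y1)).
exists a; apply/power_series_ofP => z.
have := ha (val z); rewrite subr0 disc_ext_val; apply; exact: disc_lt1.
Qed.

Lemma HD_of_coefs c : coef_bounded c -> exists g, power_series_of g c.
Proof.
move=> cB.
have /choice[G hG] z : exists l, cabs z < 1 -> csum (fun n => c n * z ^+ n) l.
  have [z1|z1] := ltP (cabs z) 1; last by exists 0.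
  have z0 := cabs_ge0 z.
  have [||B B0 hB] := cB ((cabs z + 1) / 2); try lra.
  have zS : cabs z < (cabs z + 1) / 2 by lra.
  by have [l hl] := dominated_csum B0 zS hB; exists l.
have hG0 : ps_at G 0 c 1 by move=> z; rewrite subr0; exact: hG.
have an : (fun z : set_type (@disc R) => G (val z)) \in @is_analytic R.
  apply/asboolP => z0; have z1 := disc_lt1 z0.
  have [b hb] := ps_recenter hG0 z1.
  exists b, (1 - cabs (val z0)); split; first by rewrite subr_gt0.
  by move=> z zz0; apply/csumP; exact: hb.
by exists (MkHD an); apply/power_series_ofP => z; apply: hG; exact: disc_lt1.
Qed.

Lemma power_series_of_le g c (z : set_type (@disc R)) (M : R) :
  power_series_of g c -> (forall n, \sum_(i < n) cabs (c i) * cabs (val z) ^+ i <= M) ->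
  cabs (g z) <= M.
Proof.
move=> /power_series_ofP/(_ z) hg hM; apply: (abs_csum_le hg) => n.
by under eq_bigr do rewrite cabsM cabsX.
Qed.

Lemma power_series_ofB h g b c : power_series_of h b -> power_series_of g c ->
  power_series_of (h - g) (fun n => b n - c n).
Proof.
move=> /power_series_ofP hb /power_series_ofP gc; apply/power_series_ofP => z.
apply: csum_ext (csumD (hb z) (csumN (gc z))) => n /=.
by rewrite mulrBl.
Qed.

(** The sets [B (K, E)] generate a filter, since compact sets are stable under union and entourages
    under intersection. It converges to f uniformly on each compact set, hence in the topology, so
    it contains every neighbourhood of f. *)
Lemma compact_nbhs_basis (f : {family compact, set_type (@disc R) -> R[i]}) A :
  nbhs f A -> exists K (E : set (R[i] * R[i])), [/\ compact K, entourage E &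
    [set g : set_type (@disc R) -> R[i] | forall y, K y -> E (f y, g y)] `<=` A].
Proof.
pose D := [set p : set (set_type (@disc R)) * set (R[i] * R[i]) |
             compact p.1 /\ entourage p.2].
pose B (p : set (set_type (@disc R)) * set (R[i] * R[i])) :=
  [set g : set_type (@disc R) -> R[i] | forall y, p.1 y -> p.2 (f y, g y)].
have FF : Filter (filter_from D B).
  apply: filter_from_filter.
    by exists (set0, setT); split => /=; [exact: compact0|exact: entourageT].
  move=> [K E] [K' E'] [/= cK eE] [/= cK' eE'].
  exists (K `|` K', E `&` E'); first by split => /=; [exact: compactU|exact: filterI].
  by move=> g gh; split=> y yK; [have [] := gh y (or_introl yK)|have [] := gh y (or_intror yK)].
have : {family compact, filter_from D B --> f}.
  apply/fam_cvgP => K cK Q /uniform_nbhs[E [eE EQ]].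
  by exists (K, E).
move=> /(_ A) + nA => /(_ nA) [[K E] [cK eE] KEA].
by exists K, E.
Qed.

Lemma compact_disc_radius (K : set (set_type (@disc R))) : compact K ->
  exists r : R, [/\ 0 <= r, r < 1 & forall y, K y -> cabs (val y) <= r].
Proof.
move=> cK; have [->|/set0P K0] := eqVneq K set0; first by exists 0; split.
have [|y yK ymax] := @compact_EVT_max _ R (fun y : set_type (@disc R) => cabs (val y)) K K0 cK.
  apply: continuous_subspaceT => y; apply: (@continuous_comp (set_type (@disc R)) R[i] R val (fun z : R[i] => cabs z) y).
    exact: initial_continuous.
  exact: continuous_cabs.
exists (cabs (val y)); split; rewrite ?cabs_ge0 ?disc_lt1//.
by move=> x Kx; apply: ymax; rewrite inE.
Qed.

Lemma HD_open_basis (U : set (HD R)) h : open U -> U h -> exists r e : R,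
  [/\ 0 <= r, r < 1, 0 < e & forall g,
    (forall z, cabs (val z) <= r -> cabs (h z - g z) < e) -> U g].
Proof.
move=> [B oB <-] Bh.
have [K [E [cK eE KEB]]] := compact_nbhs_basis (open_nbhs_nbhs (conj oB Bh)).
have [r [r0 r1 Kr]] := compact_disc_radius cK.
move: eE; rewrite -entourage_ballE => -[e /= e0 eE].
have eR : e = (complex.Re e)%:C%C.
  by case: e e0 eE => x y; rewrite ltcE /= => /andP[/eqP-> _] _.
exists r, (complex.Re e); split => //; first by rewrite -ltcR -eR.
move=> g hg; apply: KEB => y Ky; apply: eE; rewrite /= eR cball_cabs.
exact: hg (Kr y Ky).
Qed.

(** Lets the density of periodic points provide one with h(0) <> 0. A single point is compact, so
    evaluation there is controlled. *)
Lemma open_eval_neq0 (z : set_type (@disc R)) : open [set h : HD R | h z != 0].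
Proof.
exists [set g : set_type (@disc R) -> R[i] | g z != 0] => //.
rewrite openE => g /= gz.
have gz0 : 0 < (cabs (g z))%:C%C :> R[i] by rewrite ltcR cabs_gt0.
have := @fam_nbhs _ _ compact [set z] [set xy | ball xy.1 (cabs (g z))%:C%C xy.2]
  g (entourage_ball _ (PosNum gz0)) (@compact_set1 _ z).
apply: filterS => k /(_ z erefl) /=; rewrite cball_cabs; apply: contraPneq => ->.
by rewrite subr0 ltxx.
Qed.

End DiscFunctions.

(** * Chaos bounds the coefficients of f *)

Section ShiftCoefficients.
Variables (R : realType) (w : nat -> R[i]).
Hypothesis w_neq0 : forall n, (1 <= n)%N -> w n != 0.

Definition shift_coef (n : nat) : R[i] := (\prod_(1 <= k < n.+1) w k)^-1.

Lemma shift_coef0 : shift_coef 0 = 1.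
Proof. by rewrite /shift_coef big_geq// invr1. Qed.

Lemma shift_coef_neq0 n : shift_coef n != 0.
Proof.
rewrite invr_neq0// prodf_seq_neq0; apply/allP => k; rewrite mem_index_iota.
by move=> /andP[k1 _]; exact: w_neq0.
Qed.

Lemma shift_coefS n : w n.+1 * shift_coef n.+1 = shift_coef n.
Proof.
rewrite /shift_coef [in LHS]big_nat_recr//= invfM mulrCA mulfV ?mulr1//.
exact: w_neq0.
Qed.

Variable T : HD R -> HD R.
Hypothesis T_shift : weighted_shift w T.

Lemma iter_shift h (x : nat -> R[i]) j :
  power_series_of h (fun n => x n * shift_coef n) ->
  power_series_of (iter j T h) (fun n => x (n + j)%N * shift_coef n).
Proof.
move=> hx; elim: j => [|j IH] /=; first by under eq_fun do rewrite addn0.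
have := T_shift IH; under eq_fun do rewrite mulrCA shift_coefS addSnnS.
exact.
Qed.

(** T^j h has coefficients x_(n+j) a_n. For each n some j <= N makes n + j a multiple of N, where x
    takes the value x_0 <> 0; so |x_0| |a_n| r^n is bounded by the coefficient bounds of finitely
    many iterates. *)
Lemma chaotic_coef_bounded : chaotic T -> coef_bounded shift_coef.
Proof.
move=> [_ periodic_dense].
pose z0 := @disc_pt R 0 (eq_ind_r (fun x => x < 1) ltr01 (@cabs0 R)).
have [|h [/= h0 [N N1 hN]]] := periodic_dense _ _ (open_eval_neq0 z0).
  have [r r0 r1|g /power_series_ofP/(_ z0) hg] :=
      @HD_of_coefs R (fun n => (n == 0%N)%:R).
    exists 1 => // -[|n]; first by rewrite expr0 mulr1 eqxx cabs1.
    by rewrite [_ == _]/= cabs0 mul0r.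
  exists g => /=; rewrite (_ : g z0 = 1) ?oner_neq0//; apply: csum_unique hg _.
  have := @csum_eventually0 R (fun n => (n == 0%N)%:R * 0 ^+ n) 1.
  by rewrite big_ord1 expr0 mulr1; apply => -[//|n] _; rewrite mul0r.
have [b hb] := HD_taylor h.
pose x n := b n / shift_coef n.
have hx : power_series_of h (fun n => x n * shift_coef n).
  rewrite (_ : (fun n => _) = b)//; apply/funext => n.
  by rewrite /x divfK// shift_coef_neq0.
have xN n : x (n + N)%N = x n.
  have := iter_shift (j := N) hx; rewrite hN => /power_series_of_unique/(_ hx n).
  by apply: mulIf; exact: shift_coef_neq0.
have xNm m : x (m * N)%N = x 0%N.
  by elim: m => [|m IH]; rewrite ?mul0n// mulSn addnC xN.
have x0 : 0 < cabs (x 0%N).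
  rewrite cabs_gt0; apply: contra_neq h0 => x0.
  move/power_series_ofP/(_ z0) : hx => /csum_unique; apply.
  have := @csum_eventually0 R (fun n => x n * shift_coef n * 0 ^+ n) 1.
  by rewrite big_ord1 x0 !mul0r; apply => -[//|n] _; rewrite expr0n mulr0.
move=> r r0 r1.
have /choice[B hB] j : exists B : R, 0 <= B /\
    forall n, cabs (x (n + j)%N * shift_coef n) * r ^+ n <= B.
  by have [B B0 hB] := power_series_of_bounded (iter_shift (j := j) hx) r0 r1; exists B.
exists ((\sum_(j < N.+1) B j) / cabs (x 0%N)).
  by rewrite divr_ge0// ?sumr_ge0// => [j _|]; [have [] := hB j|exact: ltW].
move=> n; rewrite ler_pdivlMr//.
(* The shift N - n mod N lies between 1 and N and takes n to the next multiple of N strictly above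
   it. *)
have jN : (N - n %% N < N.+1)%N by rewrite ltnS leq_subr.
have nj : (n + (N - n %% N) = (n %/ N).+1 * N)%N.
  rewrite {1}(divn_eq n N) mulSn -addnA subnKC 1?addnC//.
  by rewrite ltnW// ltn_mod.
have [_ /(_ n)] := hB (N - n %% N)%N; rewrite nj xNm cabsM.
move=> h1.
rewrite mulrC mulrA; apply: le_trans h1 _.
rewrite (bigD1 (Ordinal jN))//= lerDl sumr_ge0// => j _.
by have [] := hB j.
Qed.

End ShiftCoefficients.

(** * Borel-Cantelli and Chebyshev for events independent at a distance *)

Section ProbabilityTools.
Context (R : realType) d (Omega : measurableType d) (P : probability Omega R).
Implicit Types (A D : set Omega) (F : nat -> set Omega) (f : Omega -> R).

Lemma geometric_nneseries_le (u : nat -> \bar R) (C q : R) :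
  0 <= C -> 0 <= q -> q < 1 -> (forall j, 0 <= u j)%E ->
  (forall j, u j <= (C * q ^+ j)%:E)%E ->
  (\sum_(0 <= j <oo) u j <= (C / (1 - q))%:E)%E.
Proof.
move=> C0 q0 q1 u0 uC; apply: lime_le; first exact: is_cvg_nneseries.
apply: nearW => n; apply: (@le_trans _ _ (\sum_(0 <= i < n) (C * q ^+ i)%:E)%E).
  by apply: lee_sum => i _.
rewrite sumEFin lee_fin -mulr_sumr ler_wpM2l// big_mkord; exact: geom_sum_le.
Qed.

Lemma borel_cantelli_geometric F (C q : R) : (forall j, measurable (F j)) ->
  0 <= C -> 0 <= q -> q < 1 -> (forall j, P (F j) <= (C * q ^+ j)%:E)%E ->
  {ae P, forall o, exists J, forall j, (J <= j)%N -> ~ F j o}.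
Proof.
move=> mF C0 q0 q1 FC; exists (lim_sup_set F); split.
- by apply: bigcap_measurable => // n _; apply: bigcup_measurable => j _.
- apply: lim_sup_set_cvg0 => //; apply: le_lt_trans (ltry (C / (1 - q))).
  by apply: geometric_nneseries_le.
move=> o /= no n _; apply: contrapT => nF; apply: no; exists n => j nj Fj.
by apply: nF; exists j.
Qed.

Lemma ge0_markov f (c : R) D : measurable D -> measurable_fun setT f ->
  (forall o, 0 <= f o) -> 0 <= c -> (forall o, D o -> c <= f o) ->
  (c%:E * P D <= \int[P]_o (f o)%:E)%E.
Proof.
move=> mD mf f0 c0 cf; rewrite -[X in P X]setIT -integral_indic//.
rewrite -ge0_integralZl_EFin//; last first.
  by apply/measurable_EFinP; exact: measurable_indic.
apply: ge0_le_integral => //.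
- by move=> o _; rewrite -EFinM lee_fin mulr_ge0.
- under eq_fun do rewrite -EFinM; apply/measurable_EFinP.
  by apply: measurable_funM => //; exact: measurable_indic.
- by apply/measurable_EFinP.
- move=> o _; rewrite -EFinM lee_fin indicE; case: (boolP (o \in D)) => [|_].
    by rewrite inE mulr1 => /cf.
  by rewrite mulr0.
Qed.

Definition hits F n (o : Omega) : R := \sum_(i < n) \1_(F i) o.

Lemma hits_ge0 F n o : 0 <= hits F n o.
Proof. by apply: sumr_ge0. Qed.

Lemma measurable_hits F n : (forall i, measurable (F i)) ->
  measurable_fun setT (hits F n).
Proof. by move=> mF; apply: measurable_sum => i; exact: measurable_indic. Qed.

Lemma integral_hits F n : (forall i, measurable (F i)) ->
  (\int[P]_o (hits F n o)%:E = \sum_(i < n) P (F i))%E.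
Proof.
move=> mF; under eq_integral do rewrite /hits -sumEFin.
rewrite ge0_integral_sum//.
- by apply: eq_bigr => i _; rewrite integral_indic// setIT.
- by move=> i; apply/measurable_EFinP; exact: measurable_indic.
Qed.

Lemma integral_hits_sqr F n : (forall i, measurable (F i)) ->
  (\int[P]_o (hits F n o ^+ 2)%:E = \sum_(i < n) \sum_(j < n) P (F i `&` F j))%E.
Proof.
move=> mF; transitivity (\int[P]_o (\sum_(i < n) (\sum_(j < n) \1_(F i `&` F j) o)%:E)%E)%E.
  apply: eq_integral => o _; rewrite sumEFin expr2 /hits mulr_suml; congr EFin.
  apply: eq_bigr => i _; rewrite mulr_sumr; apply: eq_bigr => j _.
  by rewrite indicI.
have mFF i j : measurable (F i `&` F j) by apply: measurableI.
rewrite ge0_integral_sum//.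
- apply: eq_bigr => i _; under eq_integral do rewrite -sumEFin.
  rewrite ge0_integral_sum//.
  + by apply: eq_bigr => j _; rewrite integral_indic// setIT.
  + by move=> j; apply/measurable_EFinP; exact: measurable_indic.
- move=> i; apply/measurable_EFinP; apply: measurable_sum => j.
  exact: measurable_indic.
- by move=> i o _; rewrite lee_fin sumr_ge0.
Qed.

Local Open Scope nat_scope.
(** For fixed i the admissible j lie among 2k consecutive integers from i + 1 - k on. These are the
    pairs of events not known to be independent. *)
Lemma card_near_diagonal n k :
  \sum_(i < n) \sum_(j < n) ((j < i + k) && (i < j + k)) <= n * k.*2.
Proof.
rewrite -[X in (_ <= X * _)]card_ord -sum_nat_const; apply: leq_sum => i _.
rewrite -(big_mkord xpredT (fun j => nat_of_bool ((j < i + k) && (i < j + k)))).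
have -> : \sum_(0 <= j < n) nat_of_bool ((j < i + k) && (i < j + k)) =
          \sum_(0 <= j < n | (j < i + k) && (i < j + k)) 1.
  by rewrite [RHS]big_mkcond; apply: eq_bigr => j _; case: (_ && _).
rewrite sum1_count -size_filter.
apply: (@leq_trans (size (iota (i.+1 - k) k.*2))); last by rewrite size_iota.
apply: uniq_leq_size; first by rewrite filter_uniq// iota_uniq.
move=> j; rewrite mem_filter => /andP[/andP[h1 h2] _].
by rewrite mem_iota; lia.
Qed.
Local Close Scope nat_scope.

(* Chebyshev: E(S - n p)^2 <= 2 n k, expanded as E(S - n p)^2 + 2 n p E S =
   E S^2 + (n p)^2 so that only nonnegative functions are integrated. *)
Lemma hits_lower_tail F n k (p : R) : (forall i, measurable (F i)) -> 0 < p ->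
  (forall i, P (F i) = p%:E) ->
  (forall i j, (i + k <= j)%N -> P (F i `&` F j) = (p ^+ 2)%:E) ->
  (0 < n)%N ->
  (P [set o | (hits F n o < n%:R * p / 2)%R] <= (8 * k%:R / (n%:R * p ^+ 2))%:E)%E.
Proof.
move=> mF p0 PF PFF n0; set a := n%:R * p.
have n0R : 0 < n%:R :> R by rewrite ltr0n.
have a0 : 0 < a by rewrite mulr_gt0.
have mS := measurable_hits n mF.
have mS2 : measurable_fun setT (fun o => hits F n o ^+ 2) by apply: measurable_funX.
have mSa : measurable_fun setT (fun o => (hits F n o - a) ^+ 2).
  by apply: measurable_funX; apply: measurable_funB.
have ES : (\int[P]_o (hits F n o)%:E = a%:E)%E.
  rewrite integral_hits//; under eq_bigr do rewrite PF.
  by rewrite sumEFin sumr_const card_ord /a mulr_natl.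
have ES2 : (\int[P]_o (hits F n o ^+ 2)%:E <= (a ^+ 2 + 2 * n%:R * k%:R)%:E)%E.
  rewrite integral_hits_sqr//.
  (* Pairs at distance at least k contribute p^2 exactly; for the others the probability is bounded
     by 1. *)
  apply: (@le_trans _ _ (\sum_(i < n) \sum_(j < n)
      (p ^+ 2 + ((j < i + k)%N && (i < j + k)%N)%:R)%:E)%E).
    apply: lee_sum => i _; apply: lee_sum => j _.
    have [ji|ij] /= := ltnP j (i + k); last by rewrite PFF// addr0.
    have [_|ji'] /= := ltnP i (j + k); last by rewrite setIC PFF// addr0.
    apply: (@le_trans _ _ 1%E); first by apply: probability_le1; exact: measurableI.
    by rewrite lee_fin lerDr sqr_ge0.
  under eq_bigr do rewrite sumEFin; rewrite sumEFin lee_fin.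
  under eq_bigr do rewrite big_split /= sumr_const card_ord.
  rewrite big_split /= sumr_const card_ord lerD//.
    by rewrite -mulrnA -[_ *+ _]mulr_natl natrM /a exprMn.
  under eq_bigr do rewrite -natr_sum.
  rewrite -natr_sum -!natrM ler_nat -mulnA mulnCA mul2n; exact: card_near_diagonal.
have EV : (\int[P]_o ((hits F n o - a) ^+ 2)%:E <= (2 * n%:R * k%:R)%:E)%E.
  have : (\int[P]_o ((hits F n o - a) ^+ 2)%:E + (2 * a)%:E * a%:E =
          \int[P]_o (hits F n o ^+ 2)%:E + (a ^+ 2)%:E)%E.
    rewrite -ES -ge0_integralZl_EFin//; last 3 first.
    - by move=> o _; rewrite lee_fin hits_ge0.
    - exact/measurable_EFinP.
    - by rewrite mulr_ge0// ltW.
    have -> : (a ^+ 2)%:E = (\int[P]_o (cst (a ^+ 2)%:E o))%E.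
      rewrite integral_cst// -[LHS]mule1; congr (_ * _)%E; exact/esym/probability_setT.
    rewrite -!ge0_integralD//.
    - by apply: eq_integral => o _; rewrite -!EFinM -!EFinD; congr EFin; ring.
    - by move=> o _; rewrite lee_fin sqr_ge0.
    - exact/measurable_EFinP.
    - by move=> o _; rewrite lee_fin sqr_ge0.
    - by move=> o _; rewrite lee_fin sqr_ge0.
    - exact/measurable_EFinP.
    - by move=> o _; rewrite -EFinM lee_fin !mulr_ge0 ?hits_ge0// ltW.
    - by under eq_fun do rewrite -EFinM; apply/measurable_EFinP; apply: measurable_funM.
  move=> E; rewrite -(@leeD2rE _ ((2 * a)%:E * a%:E)%E)// E.
  rewrite -EFinM -EFinD; apply: le_trans (leeD2r _ ES2) _.
  by rewrite -EFinD lee_fin; lra.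
pose D := [set o | hits F n o < a / 2].
have mD : measurable D.
  have -> : D = setT `&` hits F n @^-1` `]-oo, (a / 2)[%classic.
    by rewrite setTI; apply/seteqP; split => o /=; rewrite in_itv.
  exact: mS.
have a2 : 0 <= (a / 2) ^+ 2 by rewrite sqr_ge0.
have := ge0_markov mD mSa (fun o => sqr_ge0 _) a2.
have [x Px] : exists x, P D = x%:E.
  by exists (fine (P D)); rewrite fineK// fin_num_measure.
have Da o : D o -> (a / 2) ^+ 2 <= (hits F n o - a) ^+ 2.
  by rewrite /D /= => Do; nra.
move=> /(_ Da); rewrite -/D Px -EFinM => /le_trans/(_ EV).
rewrite !lee_fin => h; rewrite ler_pdivlMr ?mulr_gt0 ?exprn_gt0//.
by rewrite -(ler_pM2l n0R); move: h; rewrite /a; lra.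
Qed.

End ProbabilityTools.

(** * Lower density along powers of 4, infinite products *)

Section LowerDensity.
Variable R : realType.

Lemma limn_einf_ge (u : nat -> \bar R) (c : \bar R) N0 :
  (forall N, (N0 <= N)%N -> c <= u N)%E -> (c <= limn_einf u)%E.
Proof.
move=> cu; rewrite limn_einf_lim; apply: lime_ge; first exact: is_cvg_einfs.
exists N0 => // N N0N; apply: le_ereal_inf_tmp => _ [k /= Nk <-].
by apply: cu; exact: leq_trans N0N Nk.
Qed.

(** Every large N + 1 satisfies 4^j <= N + 1 < 4^(j+1) for some j >= J; counting only up to 4^j
    loses at most the factor 4. *)
Lemma lower_density_gt0 (A : set nat) (eta : R) J : 0 < eta ->
  (forall j, (J <= j)%N -> eta * (4 ^ j)%:R <= \sum_(n < 4 ^ j) ((n : nat) \in A)%:R) ->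
  (0 < lower_density R A)%E.
Proof.
move=> eta0 hA; apply: (@lt_le_trans _ _ (eta / 4)%:E).
  by rewrite lte_fin divr_gt0.
apply: (@limn_einf_ge _ _ (4 ^ J)) => N JN.
rewrite lee_fin ler_pdivlMr ?ltr0n//.
have -> : #|[pred n : 'I_N.+1 | (n : nat) \in A]|%:R =
    \sum_(n < N.+1) ((n : nat) \in A)%:R :> R.
  by rewrite -sum1_card natr_sum big_mkcond; apply: eq_bigr => i _; rewrite inE; case: (_ \in A).
pose j := trunc_log 4 N.+1.
have jN : (4 ^ j <= N.+1)%N by exact: trunc_logP.
have Nj : (N.+1 < 4 ^ j.+1)%N by exact: trunc_log_ltn.
have Jj : (J <= j)%N by apply: trunc_log_max => //; exact: leq_trans JN _.
apply: (@le_trans _ _ (eta * (4 ^ j)%:R)).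
  rewrite -mulrA ler_pM2l// mulrC ler_pdivrMr// -natrM ler_nat mulnC -expnS; exact: ltnW.
apply: le_trans (hA _ Jj) _.
rewrite [leRHS](sum_ord_split (fun n => ((n : nat) \in A)%:R) jN) lerDl.
by apply: sumr_ge0.
Qed.

(** Weierstrass's product inequality. *)
Lemma prod_ge_1sub_sum (p : nat -> R) m n : (forall k, 0 <= p k <= 1) ->
  1 - \sum_(m <= k < n) (1 - p k) <= \prod_(m <= k < n) p k.
Proof.
move=> p01; have [mn|nm] := leqP m n; last first.
  by rewrite !big_geq ?subr0// ltnW.
rewrite -(subnKC mn); elim: (n - m)%N => [|i IH].
  by rewrite addn0 !big_geq// subr0.
rewrite addnS !big_nat_recr ?leq_addr//=.
have /andP[h0 h1] := p01 (m + i)%N.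
have P0 : 0 <= \prod_(m <= k < m + i) p k by apply: prodr_ge0 => k _; case/andP: (p01 k).
have P1 : \prod_(m <= k < m + i) p k <= 1.
  by apply: prodr_ile1 => k _; exact: p01.
nra.
Qed.

(** Beyond m the defects 1 - p k sum to at most 1/2, so Weierstrass's inequality leaves at least
    half of the product of the first m factors. *)
Lemma prod_bounded_below (p : nat -> R) (C q : R) s : (forall k, 0 < p k <= 1) ->
  0 <= C -> 0 <= q -> q < 1 ->
  (forall k, (s <= k)%N -> 1 - p k <= C * q ^+ k) ->
  exists2 pi0 : R, 0 < pi0 & forall K, pi0 <= \prod_(k < K) p k.
Proof.
move=> p01 C0 q0 q1 hp.
have p01' k : 0 <= p k <= 1 by have /andP[/ltW -> ->] := p01 k.
have C1 : 0 <= C / (1 - q) by rewrite divr_ge0// subr_ge0 ltW.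
have h2 : 0 < 2^-1 :> R by rewrite invr_gt0.
have [N hN] := le_geom_eps C1 q0 q1 h2.
set m := maxn N s.
have pm : 0 < \prod_(k < m) p k by apply: prodr_gt0 => k _; case/andP: (p01 k).
exists ((\prod_(k < m) p k) / 2); first exact: divr_gt0.
(* All factors are at most 1, so lengthening the product to m + K only lowers it and K < m is no
   separate case. *)
move=> K; apply: (@le_trans _ _ (\prod_(k < m + K) p k)).
  rewrite -!(big_mkord xpredT p) (@big_cat_nat _ _ _ m 0 (m + K))//= ?leq_addr//.
  rewrite ler_wpM2l ?big_mkord ?(ltW pm)//.
  apply: le_trans (prod_ge_1sub_sum _ _ p01').
  rewrite lerBrDr -lerBrDl; have -> : 1 - 2^-1 = 2^-1 :> R by lra.
  apply: (@le_trans _ _ (\sum_(m <= k < m + K) C * q ^+ k)).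
    rewrite big_nat_cond [leRHS]big_nat_cond; apply: ler_sum => k.
    move=> /andP[/andP[mk _] _]; apply: hp; exact: leq_trans (leq_maxr _ _) mk.
  rewrite -mulr_sumr; apply: le_trans (ler_wpM2l C0 (geom_tail_le _ _ q0 q1)) _.
  by rewrite mulrA mulrAC; apply/ltW/hN/leq_maxl.
rewrite addnC -!(big_mkord xpredT p) (@big_cat_nat _ _ _ K 0 (K + m))//= ?leq_addr//.
rewrite ler_piMr//; first by apply: prodr_ge0 => k _; case/andP: (p01' k).
by apply: prodr_ile1 => k _.
Qed.

End LowerDensity.

(** * Windows of an i.i.d. sequence meeting prescribed sets *)

Section Blocks.
Context (R : realType) d (Omega : measurableType d) (P : probability Omega R).
Variables (X : {RV P >-> borelC R}) (X_ : nat -> {RV P >-> borelC R}).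
Hypothesis X_iid : iid_copies X X_.
Implicit Types (B : nat -> set (borelC R)).

Lemma measurable_openC (U : set R[i]) : open U -> measurable (U : set (borelC R)).
Proof. by move=> oU; apply: sub_sigma_algebra. Qed.

Lemma iid_prob n (A : set (borelC R)) : measurable A ->
  P (X_ n @^-1` A) = P (X @^-1` A).
Proof. by move=> mA; case: X_iid => _ /(_ n A mA). Qed.

Definition block B K n := [set o | forall k, (k < K)%N -> B k (X_ (n + k)%N o)].

Lemma measurable_block B K n : (forall k, measurable (B k)) ->
  measurable (block B K n).
Proof.
move=> mB; have -> : block B K n =
    \bigcap_(k in [set k | (k < K)%N]) (X_ (n + k)%N @^-1` B k) by [].
by apply: bigcap_measurableType => k _; exact: measurable_funPTI.
Qed.

Lemma block_bigcap B K n : block B K n =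
  \bigcap_(m in [set` iota n K]) (X_ m @^-1` B (m - n)%N).
Proof.
apply/seteqP; split => o /= h.
  move=> m /=; rewrite mem_iota => /andP[nm mK].
  by have := h (m - n)%N; rewrite subnKC//; apply; rewrite ltn_subLR.
move=> k kK; have := h (n + k)%N; rewrite /= addKn; apply.
by rewrite mem_iota leq_addr ltn_add2l.
Qed.

Lemma prob_block B K n : (forall k, measurable (B k)) ->
  P (block B K n) = (\prod_(k < K) P (X @^-1` B k))%E.
Proof.
move=> mB; rewrite block_bigcap; case: (X_iid) => ind _.
rewrite (ind _ (fun m => B (m - n)%N))//; last exact: iota_uniq.
rewrite -{1}(addn0 n) iotaDl big_map -{1}(subn0 K) big_mkord.
by apply: eq_bigr => k _; rewrite addKn iid_prob.
Qed.

Lemma prob_blockI B K n m : (forall k, measurable (B k)) -> (n + K <= m)%N ->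
  P (block B K n `&` block B K m) = (P (block B K n) * P (block B K m))%E.
Proof.
move=> mB nm; have [ind _] := X_iid.
(* One sequence of sets describes both windows, which are disjoint; independence then applies to the
   concatenated list of indices. *)
pose A i := if (i < n + K)%N then B (i - n)%N else B (i - m)%N.
have An i : i \in iota n K -> A i = B (i - n)%N.
  by rewrite mem_iota /A => /andP[_ ->].
have Am i : i \in iota m K -> A i = B (i - m)%N.
  by rewrite mem_iota => /andP[mi _]; rewrite /A ltnNge (leq_trans nm mi).
have mA i : measurable (A i) by rewrite /A; case: ifP.
have uq : uniq (iota n K ++ iota m K).
  rewrite cat_uniq !iota_uniq /= andbT; apply/hasPn => i.
  rewrite !mem_iota => /andP[mi _]; rewrite negb_and -leqNgt.
  by rewrite (leq_trans nm mi) orbT.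
have -> : block B K n `&` block B K m =
    \bigcap_(i in [set` iota n K ++ iota m K]) (X_ i @^-1` A i).
  rewrite !block_bigcap; apply/seteqP; split => o.
    move=> [h1 h2] i /=; rewrite mem_cat => /orP[iin|iim].
      by rewrite An//; exact: h1.
    by rewrite Am//; exact: h2.
  move=> h; split => i /= ii.
    by rewrite -An//; apply: h; rewrite /= mem_cat ii.
  by rewrite -Am//; apply: h; rewrite /= mem_cat ii orbT.
rewrite ind// big_cat /= !block_bigcap.
rewrite (ind _ (fun i => B (i - n)%N)) ?iota_uniq//.
rewrite (ind _ (fun i => B (i - m)%N)) ?iota_uniq//.
by congr (_ * _)%E; apply: eq_big_seq => i ii; [rewrite An|rewrite Am].
Qed.

(** The probability of a successful window stays above some pi0 > 0 whatever its length. Hence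
    Chebyshev bounds the probability of fewer than half the expected successes by 8 * 2^j / (4^j
    pi0^2), a geometric sequence of ratio 1/2. *)
Lemma block_frequency_ae B (C q : R) s : (forall k, measurable (B k)) ->
  (forall k, (0 < P (X @^-1` B k))%E) -> 0 <= C -> 0 <= q -> q < 1 ->
  (forall k, (s <= k)%N -> (P (X @^-1` ~` B k) <= (C * q ^+ k)%:E)%E) ->
  {ae P, forall o, exists eta : R, 0 < eta /\ exists J, forall j, (J <= j)%N ->
     eta * (4 ^ j)%:R <= hits R (block B (2 ^ j)) (4 ^ j) o}.
Proof.
move=> mB PB0 C0 q0 q1 PBC.
have mXB k : measurable (X @^-1` B k) by exact: measurable_funPTI.
pose p k := fine (P (X @^-1` B k)).
have pE k : P (X @^-1` B k) = (p k)%:E by rewrite fineK// fin_num_measure.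
have p01 k : 0 < p k <= 1.
  by rewrite -lte_fin -[X in _ && X]lee_fin -pE PB0 probability_le1.
have [pi0 pi00 hpi] : exists2 pi0 : R, 0 < pi0 & forall K, pi0 <= \prod_(k < K) p k.
  apply: (prod_bounded_below (s := s) p01 C0 q0 q1) => k sk.
  by rewrite -lee_fin EFinB -pE -probability_setC// preimage_setC; exact: PBC.
have Pblock K n : P (block B K n) = (\prod_(k < K) p k)%:E.
  by rewrite prob_block// -prodEFin; apply: eq_bigr => k _; exact: pE.
have mblock K n := measurable_block K n mB.
pose Pi j := \prod_(k < 2 ^ j) p k.
have Pi0 j : 0 < Pi j by apply: lt_le_trans (hpi _).
pose F j := [set o | hits R (block B (2 ^ j)) (4 ^ j) o < (4 ^ j)%:R * Pi j / 2].
have mF j : measurable (F j).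
  have -> : F j = setT `&` hits R (block B (2 ^ j)) (4 ^ j) @^-1`
      `]-oo, ((4 ^ j)%:R * Pi j / 2)[%classic.
    by rewrite setTI; apply/seteqP; split => o /=; rewrite in_itv.
  exact: (measurable_hits _ (mblock (2 ^ j)%N)).
have PF j : (P (F j) <= ((8 / pi0 ^+ 2) * (1 / 2) ^+ j)%:E)%E.
  have := @hits_lower_tail R d Omega P (block B (2 ^ j)) (4 ^ j) (2 ^ j) (Pi j)
    (mblock _) (Pi0 j) (Pblock _) _ _.
  move=> /(_ _ _)/le_trans; apply.
  - move=> i i' ii'; rewrite prob_blockI// !Pblock -EFinM expr2//.
  - by rewrite expn_gt0.
  have m0 : 0 < (2 ^ j)%:R :> R by rewrite ltr0n expn_gt0.
  rewrite lee_fin (_ : 4 = 2 * 2)%N// expnMn natrM div1r exprVn -natrX.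
  set m := (2 ^ j)%:R in m0 *.
  rewrite ler_pdivrMr ?mulr_gt0 ?exprn_gt0//.
  have -> : 8 / pi0 ^+ 2 / m * (m * m * Pi j ^+ 2) = 8 * m * (Pi j ^+ 2 / pi0 ^+ 2).
    by field; rewrite !gt_eqF.
  rewrite ler_peMr// ?mulr_ge0// ler_pdivlMr ?exprn_gt0// mul1r.
  by apply: lerXn2r; rewrite ?nnegrE ?(ltW pi00) ?(ltW (Pi0 j))//; exact: hpi.
apply: filterS (borel_cantelli_geometric mF _ _ _ PF); last 3 first.
- by rewrite divr_ge0// exprn_ge0// ltW.
- by [].
- lra.
move=> o [J hJ]; exists (pi0 / 2); split; first exact: divr_gt0.
exists J => j /hJ /negP; rewrite /F /= -leNgt; apply: le_trans.
have m0 : 0 < (4 ^ j)%:R :> R by rewrite ltr0n expn_gt0.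
rewrite mulrAC ler_pM2r ?invr_gt0// [leLHS]mulrC ler_pM2l//; exact: hpi.
Qed.

End Blocks.

(** * Frequent hypercyclicity of the random series *)

Section FrequentHypercyclicity.
Variable R : realType.

(** Each of the n terms of the sum of q^i over i < n is at least q^n. *)
Lemma natmul_geom_le (q : R) n : 0 <= q -> q < 1 -> n%:R * q ^+ n <= (1 - q)^-1.
Proof.
move=> q0 q1; apply: le_trans (geom_sum_le n q0 q1).
rewrite -[X in X%:R * _]card_ord mulr_natl -sumr_const; apply: ler_sum => i _.
by apply: ler_wiXn2l => //; [exact: ltW|exact: ltnW].
Qed.

(** A linearly growing factor is absorbed by (r / s)^n, where s is midway between r and 1. *)
Lemma coef_bounded_mul (x a : nat -> R[i]) (L : R) : coef_bounded a -> 0 <= L ->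
  (forall n, cabs (x n) <= L + n%:R) -> coef_bounded (fun n => x n * a n).
Proof.
move=> ha L0 hx r r0 r1.
have s0 : 0 < (r + 1) / 2 by lra.
have s1 : (r + 1) / 2 < 1 by lra.
have [B B0 hB] := ha _ (ltW s0) s1.
set s := (r + 1) / 2 in s0 s1 hB.
have q0 : 0 <= r / s by rewrite divr_ge0// ltW.
have q1 : r / s < 1 by rewrite ltr_pdivrMr// mul1r /s; lra.
have q2 : 0 <= (1 - r / s)^-1 by rewrite invr_ge0 subr_ge0 ltW.
exists ((L + (1 - r / s)^-1) * B); first by rewrite mulr_ge0// addr_ge0.
move=> n; rewrite cabsM.
have -> : r ^+ n = (r / s) ^+ n * s ^+ n by rewrite -exprMn divfK// gt_eqF.
rewrite mulrACA; apply: ler_pM; last exact: hB.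
- by rewrite mulr_ge0 ?cabs_ge0 ?exprn_ge0.
- by rewrite mulr_ge0 ?cabs_ge0 ?exprn_ge0// ltW.
apply: (@le_trans _ _ ((L + n%:R) * (r / s) ^+ n)).
  by rewrite ler_wpM2r ?exprn_ge0.
rewrite mulrDl lerD//; last exact: natmul_geom_le.
by rewrite ler_piMr// exprn_ile1// ltW.
Qed.

Lemma coef_bounded_abs_sum (c : nat -> R[i]) (r : R) : coef_bounded c -> 0 <= r -> r < 1 ->
  exists2 M, 0 <= M & forall n, \sum_(i < n) cabs (c i) * r ^+ i <= M.
Proof.
move=> hc r0 r1; have s0 : 0 <= (r + 1) / 2 by lra.
have s1 : (r + 1) / 2 < 1 by lra.
have rs : r < (r + 1) / 2 by lra.
have [B B0 hB] := hc _ s0 s1.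
have h n := dominated_tail_le 0 n B0 r0 rs hB.
exists (B * ((r / ((r + 1) / 2)) ^+ 0 / (1 - r / ((r + 1) / 2)))).
  by apply: le_trans (h 0%N); rewrite big_geq.
by move=> n; have := h n; rewrite big_mkord.
Qed.

Lemma coef_bounded_tail (c : nat -> R[i]) (r e : R) : coef_bounded c -> 0 <= r -> r < 1 ->
  0 < e -> exists k, forall n, \sum_(k <= i < n) cabs (c i) * r ^+ i < e.
Proof.
move=> hc r0 r1 e0; have s0 : 0 < (r + 1) / 2 by lra.
have s1 : (r + 1) / 2 < 1 by lra.
have rs : r < (r + 1) / 2 by lra.
have [B B0 hB] := hc _ (ltW s0) s1.
have q0 : 0 <= r / ((r + 1) / 2) by rewrite divr_ge0// ltW.
have q1 : r / ((r + 1) / 2) < 1 by rewrite ltr_pdivrMr// mul1r.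
have Bq : 0 <= B / (1 - r / ((r + 1) / 2)) by rewrite divr_ge0// subr_ge0 ltW.
have [k hk] := le_geom_eps Bq q0 q1 e0.
exists k => n; apply: le_lt_trans (hk k (leqnn k)).
apply: le_trans (dominated_tail_le k n B0 r0 rs hB) _.
by rewrite -mulrA [X in _ * X <= _]mulrC.
Qed.

Lemma coef_boundedD_norm (b c : nat -> R[i]) : coef_bounded b -> coef_bounded c ->
  coef_bounded (fun n => (cabs (b n) + cabs (c n))%:C%C).
Proof.
move=> hb hc r r0 r1; have [B B0 hB] := hb r r0 r1; have [C C0 hC] := hc r r0 r1.
exists (B + C); first exact: addr_ge0.
by move=> n; rewrite cabs_real ger0_norm ?addr_ge0 ?cabs_ge0// mulrDl lerD.
Qed.

(* Rational centres make the family of targets countable. *)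
Definition target (p : seq (rat * rat) * nat) (k : nat) : set R[i] :=
  if (k < size p.1)%N then
    [set z | cabs (z - (ratr (nth (0, 0) p.1 k).1 +i* ratr (nth (0, 0) p.1 k).2)%C)
             < p.2.+1%:R^-1]
  else [set z | cabs z < k.+1%:R].

Lemma open_cball (z : R[i]) (r : R) : open [set w | cabs (w - z) < r].
Proof.
rewrite openE => w /= wr; apply/nbhs_cabs; exists (r - cabs (w - z)).
  by rewrite subr_gt0.
move=> v wv; suff : cabs (v - z) < r by [].
have -> : v - z = (v - w) + (w - z) by ring.
by apply: le_lt_trans (cabsD _ _) _; rewrite cabsBC; lra.
Qed.

Lemma open_cabs_gt (r : R) : open [set w : R[i] | r < cabs w].
Proof.
rewrite openE => w /= wr; apply/nbhs_cabs; exists (cabs w - r).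
  by rewrite subr_gt0.
move=> v wv; suff : r < cabs v by [].
by have := cabs_le_triangle w v; lra.
Qed.

Lemma open_target p k : open (target p k).
Proof.
rewrite /target; case: ifP => _; first exact: open_cball.
by have := @open_cball 0 k.+1%:R; under eq_fun do rewrite subr0.
Qed.

Lemma target_neq0 p k : target p k !=set0.
Proof.
rewrite /target; case: ifP => _; last by exists 0; have := ltr0n R k.+1; rewrite -{1}(@cabs0 R).
set z := (_ +i* _)%C; exists z; have : cabs (z - z) < p.2.+1%:R^-1 by rewrite subrr cabs0.
by [].
Qed.

Lemma rational_approx (x : R) (e : R) : 0 < e -> exists y : rat, `|x - ratr y| < e.
Proof.
move=> e0; have xe : x - e < x + e by lra.
have [y] := rat_in_itvoo xe.
rewrite in_itv /= => /andP[h1 h2]; exists y; rewrite ltr_norml; lra.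
Qed.

Lemma target_approx (x : nat -> R[i]) s l : exists p : seq (rat * rat) * nat,
  [/\ size p.1 = s, p.2 = l & forall k, (k < s)%N -> forall z, target p k z ->
     cabs (z - x k) <= 2 / l.+1%:R].
Proof.
have l0 : 0 < l.+1%:R^-1 / 2 :> R by rewrite divr_gt0 ?invr_gt0.
have /choice[f hf] k : exists y : rat * rat,
    cabs ((ratr y.1 +i* ratr y.2)%C - x k) <= l.+1%:R^-1.
  have [y1 h1] := rational_approx (complex.Re (x k)) l0.
  have [y2 h2] := rational_approx (complex.Im (x k)) l0.
  exists (y1, y2); apply: le_trans (cabs_le_ReIm _) _.
  move: h1 h2; case: (x k) => u v /= h1 h2.
  by rewrite (splitr l.+1%:R^-1) lerD// distrC ltW.
exists (mkseq f s, l); split => //=; first by rewrite size_mkseq.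
move=> k ks z; rewrite /target /= size_mkseq ks nth_mkseq// => hz.
have -> : z - x k = (z - (ratr (f k).1 +i* ratr (f k).2)%C) +
    ((ratr (f k).1 +i* ratr (f k).2)%C - x k) by ring.
apply: le_trans (cabsD _ _) _; apply: le_trans (lerD (ltW hz) (hf k)) _.
by rewrite mulr_natl mulr2n.
Qed.

Context d (Omega : measurableType d) (P : probability Omega R).
Variables (X : {RV P >-> borelC R}) (X_ : nat -> {RV P >-> borelC R}).
Hypothesis X_iid : iid_copies X X_.
Variables (K tau : R) (K_gt0 : 0 < K) (tau_gt0 : 0 < tau).
Hypothesis X_tail : forall t : R, 0 <= t ->
  (P [set o | (t < cabs (X o))%R] <= (K * expR (- (t ^+ 2 / tau ^+ 2)))%:E)%E.

(** Ratio of the geometric sequence K q^n that dominates the Gaussian tail at height sqrt n. *)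
Let q := expR (- (tau ^- 2)).

Lemma iid_tail n (t : R) : 0 <= t ->
  (P [set o | (t < cabs (X_ n o))%R] <= (K * expR (- (t ^+ 2 / tau ^+ 2)))%:E)%E.
Proof.
move=> t0; have mt : measurable ([set z | t < cabs z] : set (borelC R)).
  by apply: measurable_openC; exact: open_cabs_gt.
by have := iid_prob X_iid n mt; rewrite /preimage /= => ->; exact: X_tail.
Qed.

Let q_ge0 : 0 <= q. Proof. exact: expR_ge0. Qed.

Let q_lt1 : q < 1.
Proof. by rewrite /q -expR0 ltr_expR oppr_lt0 invr_gt0 exprn_gt0. Qed.

Let gauss_geom (t : R) n : n%:R <= t ^+ 2 -> K * expR (- (t ^+ 2 / tau ^+ 2)) <= K * q ^+ n.
Proof.
move=> nt; rewrite ler_pM2l// /q -expRM_natl ler_expR mulrN lerN2.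
by rewrite ler_wpM2r// invr_ge0 sqr_ge0.
Qed.

(** At height sqrt m the tail is K q^m, so Borel-Cantelli applies. The bound serves for the
    convergence of g, for the late targets and for the remainder in the growth estimate. *)
Lemma iid_sqrt_growth_ae : {ae P, forall o, exists m0, forall m, (m0 <= m)%N ->
  cabs (X_ m o) <= Num.sqrt m%:R}.
Proof.
pose F m := [set o | (Num.sqrt m%:R < cabs (X_ m o))%R].
have mF m : measurable (F m).
  apply: (@measurable_funPTI _ _ _ _ (X_ m) [set z | Num.sqrt m%:R < cabs z]).
  by apply: measurable_openC; exact: open_cabs_gt.
have PF m : (P (F m) <= (K * q ^+ m)%:E)%E.
  apply: le_trans (iid_tail m (sqrtr_ge0 _)) _.
  by rewrite lee_fin; apply: gauss_geom; rewrite sqr_sqrtr.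
apply: filterS (borel_cantelli_geometric mF (ltW K_gt0) q_ge0 q_lt1 PF).
move=> o [J hJ]; exists J => m /hJ; rewrite /F /= => /negP; by rewrite -leNgt.
Qed.

Lemma random_coef_bounded_ae (a : nat -> R[i]) : coef_bounded a ->
  {ae P, forall o, coef_bounded (fun n => (X_ n o : R[i]) * a n)}.
Proof.
move=> ha; apply: filterS iid_sqrt_growth_ae => o [m0 hm0].
have s0 : 0 <= \sum_(i < m0) cabs (X_ i o) + 1.
  by rewrite addr_ge0// sumr_ge0// => i _; exact: cabs_ge0.
apply: (coef_bounded_mul ha s0) => n; have [mn|nm] := leqP m0 n.
  apply: le_trans (hm0 n mn) _; apply: (@le_trans _ _ (1 + n%:R)).
    rewrite -[leRHS]ger0_norm ?addr_ge0// -sqrtr_sqr ler_wsqrtr//.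
    by have n0 : 0 <= n%:R :> R := ler0n _ _; nra.
  rewrite lerD2r lerDr sumr_ge0// => i _; exact: cabs_ge0.
rewrite (bigD1 (Ordinal nm))//= -!addrA lerDl !addr_ge0//.
by rewrite sumr_ge0// => i _; exact: cabs_ge0.
Qed.

Hypothesis X_full : full_support X.

Lemma target_frequency_ae : {ae P, forall o, forall p, exists eta : R, 0 < eta /\
  exists J, forall j, (J <= j)%N ->
     eta * (4 ^ j)%:R <= hits R (block X_ (target p) (2 ^ j)) (4 ^ j) o}.
Proof.
have one p : {ae P, forall o, exists eta : R, 0 < eta /\
  exists J, forall j, (J <= j)%N ->
     eta * (4 ^ j)%:R <= hits R (block X_ (target p) (2 ^ j)) (4 ^ j) o}.
  apply: (block_frequency_ae X_iid (C := K) (q := q) (s := size p.1)) => //.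
  - by move=> k; apply: measurable_openC; exact: open_target.
  - by move=> k; apply: X_full; [exact: open_target|exact: target_neq0].
  - exact: ltW.
  move=> k pk; rewrite /target ltnNge pk /=.
  have k0 : 0 <= k%:R :> R by [].
  apply: (@le_trans _ _ (K * expR (- (k%:R ^+ 2 / tau ^+ 2)))%:E); last first.
    rewrite lee_fin; apply: gauss_geom.
    by rewrite -natrX ler_nat; case: (k) => // n; rewrite expnS expn1 leq_pmulr.
  apply: le_trans (X_tail k0); apply: le_measure; rewrite ?inE.
  - apply: measurable_funPTI; apply: measurableC; apply: measurable_openC.
    by have := @open_cball 0 k.+1%:R; under eq_fun do rewrite subr0.
  - apply: (@measurable_funPTI _ _ _ _ X [set z | k%:R < cabs z]).
    by apply: measurable_openC; exact: open_cabs_gt.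
  move=> o /=; move=> /negP; rewrite -leNgt; apply: lt_le_trans.
  by rewrite ltr_nat.
(* The targets form a countable type; enumerating them moves the quantifier over p inside the almost
   sure event. Numbers that code no target get the trivial statement. *)
have all n : {ae P, forall o, if unpickle n is Some p then exists eta : R, 0 < eta /\
  exists J, forall j, (J <= j)%N ->
     eta * (4 ^ j)%:R <= hits R (block X_ (target p) (2 ^ j)) (4 ^ j) o else True}.
  by case: (unpickle n) => [p|]; [exact: one|apply: filterE].
apply: filterS (ae_foralln all) => o ho p.
by have := ho (pickle p); rewrite pickleK.
Qed.

Variables (w : nat -> R[i]) (T : HD R -> HD R).
Hypothesis w_neq0 : forall n, (1 <= n)%N -> w n != 0.
Hypothesis T_shift : weighted_shift w T.
Let a := shift_coef w.
Hypothesis a_bounded : coef_bounded a.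

(** The k-th coefficient of h0 - T^n g is (x_k - X_(n+k)) a_k. If the window at n meets the targets
    p, it is at most 2 |a_k| / (l + 1) for k < s, and at most (k + 1) |a_k| + |b_k| for k >= s; s is
    chosen so that the latter terms sum to less than e / 2 at radius r. *)
Lemma frequently_hypercyclic_ae : {ae P, forall o, exists g : HD R,
  power_series_of g (fun n => (X_ n o : R[i]) * a n) /\ frequently_hypercyclic R T g}.
Proof.
apply: filterS3 (random_coef_bounded_ae a_bounded) iid_sqrt_growth_ae target_frequency_ae.
move=> o co [m0 hm0] freq; have [g hg] := HD_of_coefs co.
exists g; split => // U oU [h0 Uh0].
have [r [e [r0 r1 e0 hU]]] := HD_open_basis oU Uh0.
have [b hb] := HD_taylor h0.
pose x k := b k / a k.
have an0 k : a k != 0 by exact: shift_coef_neq0.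
have bE k : b k = x k * a k by rewrite /x divfK.
have b_bounded := power_series_of_bounded hb.
have ka_bounded : coef_bounded (fun k => k.+1%:R%:C%C * a k).
  apply: (coef_bounded_mul a_bounded (@ler01 R)) => n.
  by rewrite cabs_real ger0_norm// -natr1 addrC.
have d_bounded := coef_boundedD_norm ka_bounded b_bounded.
have e20 : 0 < e / 2 by rewrite divr_gt0.
have [s hs] := coef_bounded_tail d_bounded r0 r1 e20.
have [M M0 hM] := coef_bounded_abs_sum a_bounded r0 r1.
(* Large enough for 2 M / (l + 1) < e / 2, where M bounds the partial sums of |a_k| r^k. *)
pose l := Num.bound (4 * M / e).
have hl : 2 / l.+1%:R * M < e / 2.
  have : 4 * M / e < l.+1%:R.
    have h4 : 0 <= 4 * M / e by rewrite divr_ge0 ?mulr_ge0// ltW.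
    by apply: lt_trans (archi_boundP h4) _; rewrite ltr_nat.
  rewrite ltr_pdivrMr// mulrAC ltr_pdivrMr// => h; lra.
have [p [ps pl hp]] := target_approx x s l.
have [eta [eta0 [J hJ]]] := freq p.
(* As j <= 2^j, this start puts 2^j above both m0 and s, besides giving j >= J. *)
apply: (@lower_density_gt0 _ _ eta (J + m0 + s)) => // j Jj.
have jJ : (J <= j)%N by apply: leq_trans Jj; rewrite -addnA leq_addr.
have j2 : (j <= 2 ^ j)%N by exact/ltnW/ltn_expl.
have jm : (m0 <= 2 ^ j)%N.
  by apply: leq_trans j2; apply: leq_trans Jj; rewrite addnAC leq_addl.
have js : (s <= 2 ^ j)%N by apply: leq_trans j2; apply: leq_trans Jj; rewrite leq_addl.
apply: le_trans (hJ j jJ) _; rewrite /hits; apply: ler_sum => n _.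
rewrite indicE; have [nb|_] := boolP (o \in _); last by [].
rewrite mem_set//; move: nb; rewrite inE => nb.
apply: hU => z zr.
have hgn := iter_shift (j := n) w_neq0 T_shift hg.
have hdiff := power_series_ofB hb hgn.
suff : cabs ((h0 - iter n T g) z) <= 2 / l.+1%:R * M + e / 2 
  by move=> /le_lt_trans; apply; rewrite [ltRHS]splitr ltrD2r.
apply: (power_series_of_le hdiff) => N.
have z0 := cabs_ge0 (val z).
have term k : cabs (b k - (X_ (k + n)%N o : R[i]) * a k) * cabs (val z) ^+ k <=
   2 / l.+1%:R * (cabs (a k) * r ^+ k) +
   (if (k < s)%N then 0 else cabs (cabs (k.+1%:R%:C%C * a k) + cabs (b k))%:C%C * r ^+ k).
  have rk : cabs (val z) ^+ k <= r ^+ k by rewrite lerXn2r.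
  apply: (le_trans (ler_wpM2l (cabs_ge0 _) rk)).
  have rk0 : 0 <= r ^+ k by rewrite exprn_ge0.
  rewrite addnC; have [ks|sk] := ltnP k s.
    rewrite addr0 mulrA ler_wpM2r// bE -mulrBl cabsM ler_wpM2r ?cabs_ge0//.
    rewrite cabsBC; apply: hp => //; apply: nb; exact: leq_trans ks js.
  rewrite -[leLHS]add0r lerD//; first by rewrite !mulr_ge0 ?cabs_ge0 ?invr_ge0.
  rewrite ler_wpM2r// cabs_real ger0_norm ?addr_ge0 ?cabs_ge0//.
  rewrite cabsBC; apply: le_trans (cabsB _ _) _; rewrite lerD2r !cabsM.
  rewrite ler_wpM2r ?cabs_ge0// cabs_real ger0_norm//.
  have [kj|jk] := ltnP k (2 ^ j).
    by have := nb k kj; rewrite /target ps ltnNge sk /= => /ltW.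
  (* Past the window: n < 4^j and 2^j <= k give n + k <= (k + 1)^2, and n + k >= 2^j >= m0. *)
  apply: le_trans (hm0 (n + k)%N _) _.
    by apply: leq_trans jm _; exact: leq_trans jk (leq_addl _ _).
  rewrite -[leRHS]ger0_norm// -sqrtr_sqr ler_wsqrtr// -natrX ler_nat.
  have : (n < 2 ^ j * 2 ^ j)%N by rewrite -expnMn.
  move: jk; clear; move: (2 ^ j)%N => u; nia.
apply: (@le_trans _ _ (\sum_(k < N) (2 / l.+1%:R * (cabs (a k) * r ^+ k) +
   (if (k < s)%N then 0 else cabs (cabs (k.+1%:R%:C%C * a k) + cabs (b k))%:C%C * r ^+ k)))).
  by apply: ler_sum => k _; exact: term.
rewrite big_split /= -mulr_sumr lerD//.
  by apply: ler_wpM2l; [rewrite divr_ge0|exact: hM].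
(* The upper end s + N covers all indices below N whether or not N exceeds s. *)
apply: ltW; apply: le_lt_trans (hs (s + N)%N).
set F := (fun k => cabs (cabs (k.+1%:R%:C%C * a k) + cabs (b k))%:C%C * r ^+ k).
have F0 k : 0 <= F k by rewrite mulr_ge0 ?cabs_ge0 ?exprn_ge0.
have -> : \sum_(s <= k < s + N) F k =
    \sum_(k < s + N) (if (k < s)%N then 0 else F k).
  rewrite (sum_ord_split (fun k => if (k < s)%N then 0 else F k) (leq_addr N s)).
  have -> : \sum_(k < s) (if (k < s)%N then 0 else F k) = 0.
    by apply: big1 => k _; rewrite ltn_ord.
  rewrite add0r.
  rewrite big_nat_cond [RHS]big_nat_cond; apply: eq_bigr => k.
  by move=> /andP[/andP[sk _] _] /=; rewrite ltnNge sk.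
rewrite [leRHS](@sum_ord_split _ (fun k => if (k < s)%N then 0 else F k) N (s + N)) ?leq_addl//.
rewrite lerDl sumr_ge0// => k _; by case: ifP.
Qed.

End FrequentHypercyclicity.

(** * Expectations of products of independent variables *)

Section IndependentExpectations.
Import HBNNSimple.
Context (R : realType) d (Omega : measurableType d) (P : probability Omega R).

(** F integrates against indicators of events of Y as if it were the constant c; linearity extends
    this to simple functions and monotone convergence to f. Hypothesis [hB] is the form of
    independence that the induction in [ge0_integral_prod_indep] supplies. *)
Lemma ge0_integral_indep d' (S : measurableType d') (Y : {mfun Omega >-> S})
    (F : Omega -> R) (c : R) (f : S -> R) :
  measurable_fun setT F -> (forall o, 0 <= F o) -> 0 <= c ->
  (forall B, measurable B ->
     (\int[P]_o (F o * \1_B (Y o))%:E = c%:E * P (Y @^-1` B))%E) ->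
  measurable_fun setT f -> (forall y, 0 <= f y) ->
  (\int[P]_o (F o * f (Y o))%:E = c%:E * \int[P]_o (f (Y o))%:E)%E.
Proof.
move=> mF F0 c0 hB mf f0.
have mY : measurable_fun setT Y by apply: measurable_funPT.
have simple (g : {nnsfun S >-> R}) :
    (\int[P]_o (F o * g (Y o))%:E = c%:E * \int[P]_o (g (Y o))%:E)%E.
  set s := fset_set (g @` setT); set m := #|`s|.
  have s0 (i : 'I_m) : 0 <= s`_i.
    have : s`_i \in s by apply: mem_nth.
    by rewrite in_fset_set// inE => -[y _ <-]; exact: fun_ge0.
  have mA r : measurable (g @^-1` [set r]) by exact: measurable_funPTI.
  have mi r : measurable_fun setT (fun o => \1_(g @^-1` [set r]) (Y o) : R).
    by apply: (measurableT_comp (measurable_indic _)).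
  transitivity (\int[P]_o (\sum_(i < m) (s`_i * (F o * \1_(g @^-1` [set s`_i]) (Y o)))%:E))%E.
    apply: eq_integral => o _; rewrite sumEFin; congr EFin.
    rewrite fimfunEord mulr_sumr; apply: eq_bigr => i _; exact: mulrCA.
  rewrite ge0_integral_sum//; last 2 first.
  - move=> i; apply/measurable_EFinP; apply: measurable_funM => //.
    exact: measurable_funM.
  - by move=> i o _; rewrite lee_fin !mulr_ge0.
  transitivity (c%:E * \sum_(i < m) (s`_i)%:E * P (Y @^-1` (g @^-1` [set s`_i])))%E.
    rewrite ge0_sume_distrr; last by move=> i _; rewrite mule_ge0// lee_fin.
    apply: eq_bigr => i _; under eq_integral do rewrite EFinM.
    rewrite ge0_integralZl_EFin//; last 2 first.
    - by move=> o _; rewrite lee_fin mulr_ge0.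
    - by apply/measurable_EFinP; exact: measurable_funM.
    by rewrite hB// muleCA.
  congr (_ * _)%E.
  transitivity (\int[P]_o (\sum_(i < m) (s`_i * \1_(g @^-1` [set s`_i]) (Y o))%:E))%E.
    rewrite ge0_integral_sum//; last 2 first.
    - by move=> i; apply/measurable_EFinP; apply: measurable_funM.
    - by move=> i o _; rewrite lee_fin mulr_ge0.
    apply: eq_bigr => i _; under eq_integral do rewrite EFinM.
    rewrite ge0_integralZl_EFin//; last first.
    - by apply/measurable_EFinP.
    congr (_ * _)%E; rewrite -[X in P X]setIT -integral_indic//.
    by rewrite -[X in measurable X]setTI; exact: mY.
  by apply: eq_integral => o _; rewrite sumEFin; congr EFin; rewrite fimfunEord.
have mf' : measurable_fun setT (EFin \o f) by apply/measurable_EFinP.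
have f0' y : setT y -> (0 <= (EFin \o f) y)%E by rewrite /= lee_fin.
pose g := nnsfun_approx measurableT mf'.
have gcvg y : (g n y)%:E @[n --> \oo] --> (f y)%:E.
  exact: (cvg_nnsfun_approx measurableT mf' f0').
have gnd y : {homo (fun n => g n y) : n m / (n <= m)%N >-> n <= m}.
  by move=> n m nm; have /lefP := nd_nnsfun_approx measurableT mf' nm; apply.
have mgY n : measurable_fun setT (fun o => g n (Y o)).
  exact: (measurableT_comp (measurable_funPT (g n)) mY).
have lim1 o : (F o * f (Y o))%:E = limn (fun n => (F o * g n (Y o))%:E).
  apply/esym/cvg_lim => //; rewrite EFinM.
  by under eq_fun do rewrite EFinM; apply: cvgeZl.
have lim2 o : (f (Y o))%:E = limn (fun n => (g n (Y o))%:E).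
  by apply/esym/cvg_lim => //; exact: gcvg.
under eq_integral do rewrite lim1.
rewrite monotone_convergence//; last 3 first.
- by move=> n; apply/measurable_EFinP; exact: measurable_funM.
- by move=> n o _; rewrite lee_fin mulr_ge0.
- by move=> o _ n m nm; rewrite lee_fin ler_wpM2l// gnd.
under [in RHS]eq_integral do rewrite lim2.
rewrite monotone_convergence//; last 3 first.
- by move=> n; apply/measurable_EFinP.
- by move=> n o _; rewrite lee_fin.
- by move=> o _ n m nm; rewrite lee_fin gnd.
under eq_fun do rewrite simple.
apply: limeMl => //; apply: ereal_nondecreasing_is_cvgn => n m nm.
apply: ge0_le_integral => //.
- by move=> o _; rewrite lee_fin.
- by apply/measurable_EFinP.
- by apply/measurable_EFinP.
- by move=> o _; rewrite lee_fin gnd.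
Qed.

(** Independence is given for events only. The induction on k, [key], therefore carries an arbitrary
    event on finitely many variables of index >= k, and each step trades the factor f k (X_ k) for
    such an event. *)
Lemma ge0_integral_prod_indep d' (S : measurableType d') (X_ : nat -> {RV P >-> S})
    (f : nat -> S -> R) (e : nat -> R) :
  mutually_independent X_ ->
  (forall n, measurable_fun setT (f n)) -> (forall n y, 0 <= f n y) ->
  (forall n, \int[P]_o (f n (X_ n o))%:E = (e n)%:E)%E ->
  forall m, (\int[P]_o (\prod_(n < m) f n (X_ n o))%:E = (\prod_(n < m) e n)%:E)%E.
Proof.
move=> ind mf f0 fe m.
have e0 n : 0 <= e n by rewrite -lee_fin -fe integral_ge0// => o _; rewrite lee_fin.
pose F k o := \prod_(n < k) f n (X_ n o).
have F0 k o : 0 <= F k o by apply: prodr_ge0.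
have mfX n : measurable_fun setT (fun o => f n (X_ n o)).
  by apply: (measurableT_comp (mf n)); apply: measurable_funPT.
have mF k : measurable_fun setT (F k).
  by apply: measurable_prod => n _.
pose rest (s : seq nat) (A : nat -> set S) := \bigcap_(n in [set` s]) (X_ n @^-1` A n).
have mrest s A : (forall n, measurable (A n)) -> measurable (rest s A).
  by move=> mA; apply: bigcap_measurableType => n _; exact: measurable_funPTI.
have key k : forall s A, uniq s -> (forall n, n \in s -> (k <= n)%N) ->
    (forall n, measurable (A n)) ->
    (\int[P]_o (F k o * \1_(rest s A) o)%:E =
      (\prod_(n < k) e n)%:E * P (rest s A))%E.
  elim: k => [|k IH] s A us sk mA.
    rewrite big_ord0 mul1e; under eq_integral do rewrite /F big_ord0 mul1r.
    by rewrite integral_indic// ?setIT//; exact: mrest.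
  have PE : (P (rest s A) \is a fin_num) by rewrite fin_num_measure//; exact: mrest.
  transitivity (\int[P]_o (F k o * \1_(rest s A) o * f k (X_ k o))%:E)%E.
    by apply: eq_integral => o _; rewrite /F big_ord_recr /= mulrAC.
  rewrite (@ge0_integral_indep _ _ (X_ k) _ (\prod_(n < k) e n * fine (P (rest s A))))//.
  - by rewrite fe big_ord_recr /= !EFinM fineK// muleAC.
  - by apply: measurable_funM => //; apply: measurable_indic; exact: mrest.
  - by move=> o; rewrite mulr_ge0.
  - by rewrite mulr_ge0 ?prodr_ge0// fine_ge0.
  (* The event that X_ k lies in B joins the carried event: k is added to the list, and the
     induction hypothesis for k applies. *)
  move=> B mB; pose A' n := if n == k then B else A n.
  have mA' n : measurable (A' n) by rewrite /A'; case: ifP.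
  have ks : k \notin s by apply/negP => /sk; rewrite ltnn.
  have restE : rest (k :: s) A' = (X_ k @^-1` B) `&` rest s A.
    apply/seteqP; split => o.
      move=> h; split; first by have := h k; rewrite /A' /= eqxx inE eqxx; exact.
      move=> n /= ns; have := h n; rewrite /A' /= inE ns orbT => /(_ isT).
      by case: eqVneq ns => // -> ; rewrite (negbTE ks).
    move=> [h1 h2] n /=; rewrite inE /A'; case: eqVneq => [-> _//|nk /= ns].
    exact: h2.
  have := IH (k :: s) A'; rewrite restE => IH'.
  transitivity (\int[P]_o (F k o * \1_((X_ k @^-1` B) `&` rest s A) o)%:E)%E.
    apply: eq_integral => o _; congr EFin.
    by rewrite indicI /= -mulrA [\1_(rest s A) _ * _]mulrC.
  rewrite IH' /= ?ks//.
  - rewrite EFinM fineK// -muleA; congr (_ * _)%E.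
    have uks : uniq (k :: s) by rewrite /= ks.
    rewrite -restE /rest ind// ind// big_cons /A' eqxx muleC; congr (_ * _)%E.
    apply: eq_big_seq => n ns; case: eqVneq => // nk.
    by move: ns; rewrite nk (negbTE ks).
  - move=> n; rewrite inE => /orP[/eqP->//|/sk]; exact: ltnW.
have := key m [::] (fun=> setT) isT (fun n => ltac:(by [])) (fun=> measurableT).
have -> : rest [::] (fun=> setT) = setT by apply/seteqP; split.
rewrite [P _]probability_setT mule1 => <-.
by apply: eq_integral => o _; rewrite indicE mem_set// mulr1.
Qed.

End IndependentExpectations.

(** * Moment generating function of a centred subgaussian variable *)

Section SubgaussianSums.
Context (R : realType) d (Omega : measurableType d) (P : probability Omega R).

Lemma integral_cst_probability (r : R) : (\int[P]_o r%:E = r%:E)%E.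
Proof.
rewrite integral_cst// -[RHS]mule1; congr (_ * _)%E; exact: probability_setT.
Qed.

(** The linear term has mean zero in the application. For x >= 1/2, x <= 2 x^2; for x < 1/2, exp x
    <= 1 / (1 - x) <= 1 + x + 2 x^2. *)
Lemma expR_le_sqr (x : R) : expR x <= x + expR (2 * x ^+ 2).
Proof.
have [xh|xh] := lerP (1 / 2) x.
  apply: (@le_trans _ _ (expR (2 * x ^+ 2))); last by rewrite lerDr; lra.
  by rewrite ler_expR; nra.
apply: (@le_trans _ _ (x + (1 + 2 * x ^+ 2))); last by rewrite lerD2l expR_ge1Dx.
have x1 : 0 < 1 - x by lra.
have h := expR_ge1Dx (- x).
have : expR x * (1 - x) <= 1.
  by rewrite -[leRHS](expRxMexpNx_1 x) ler_wpM2l ?expR_ge0// addrC.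
move=> h1; rewrite -(ler_pM2r x1); apply: le_trans h1 _.
have x2 := sqr_ge0 x; nra.
Qed.

Lemma expR_tangent (x p : R) : expR p * (1 + (x - p)) <= expR x.
Proof.
rewrite -[in leRHS](subrK p x) expRD mulrC ler_wpM2r ?expR_ge0//.
exact: expR_ge1Dx.
Qed.

Lemma expR_convex0 (x th : R) : 0 <= th -> th <= 1 ->
  expR (th * x) <= 1 - th + th * expR x.
Proof.
move=> th0 th1; have h1 := expR_tangent x (th * x).
have := expR_tangent 0 (th * x); rewrite expR0 => h2.
have e0 := expR_ge0 (th * x).
have th2 : 0 <= 1 - th by rewrite subr_ge0.
have := ler_wpM2l th2 h2; have := ler_wpM2l th0 h1; lra.
Qed.

Lemma continuous_measurableC (h : R[i] -> R) : continuous h ->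
  measurable_fun setT (h : borelC R -> R).
Proof.
move=> ch mD; apply: (measurability _ (RGenOInfty.measurableE R)) => //.
move=> _ [_ [x ->] <-]; rewrite setTI; apply: measurable_openC.
by apply: open_comp => [z _|]; [exact: ch|exact: interval_open].
Qed.

Lemma continuous_ReC : continuous (fun z : R[i] => complex.Re z : R).
Proof.
move=> z A /nbhs_ballP[e e0 eA]; apply/nbhs_cabs; exists e => // w zw.
apply: eA; rewrite /ball /=; apply: le_lt_trans zw.
have -> : complex.Re z - complex.Re w = complex.Re (z - w) by case: z w => ? ? [].
exact: cabs_ge_Re.
Qed.

Lemma continuous_ImC : continuous (fun z : R[i] => complex.Im z : R).
Proof.
move=> z A /nbhs_ballP[e e0 eA]; apply/nbhs_cabs; exists e => // w zw.
apply: eA; rewrite /ball /=; apply: le_lt_trans zw.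
have -> : complex.Im z - complex.Im w = complex.Im (z - w) by case: z w => ? ? [].
exact: cabs_ge_Im.
Qed.

Lemma Re_cmul (c z : R[i]) :
  complex.Re (c * z) = complex.Re c * complex.Re z - complex.Im c * complex.Im z.
Proof. by case: c z => ? ? []. Qed.

Lemma measurable_Re_cmul (c : R[i]) :
  measurable_fun setT ((fun z => complex.Re (c * z)) : borelC R -> R).
Proof.
under eq_fun do rewrite Re_cmul.
apply: measurable_funB; apply: measurable_funM => //; apply: continuous_measurableC.
  exact: continuous_ReC.
exact: continuous_ImC.
Qed.

Variable X : {RV P >-> borelC R}.
Variables (K tau : R) (K_gt0 : 0 < K) (tau_gt0 : 0 < tau).
Hypothesis X_tail : forall t : R, 0 <= t ->
  (P [set o | (t < cabs (X o))%R] <= (K * expR (- (t ^+ 2 / tau ^+ 2)))%:E)%E.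

Lemma measurable_cabs_gt (t : R) : measurable [set o | (t < cabs (X o))%R].
Proof.
apply: (@measurable_funPTI _ _ _ _ X [set z | t < cabs z]).
by apply: measurable_openC; exact: open_cabs_gt.
Qed.

(** Small enough for exp (s0 |X|^2) to be integrable: where |X| <= k + 2, s0 |X|^2 <= (k + 1)^2 / (2
    tau^2), half the exponent of the tail at k + 1. *)
Let s0 := (8 * tau ^+ 2)^-1.

Let s0_gt0 : 0 < s0.
Proof. by rewrite invr_gt0 mulr_gt0// exprn_gt0. Qed.

Let W o : R := expR (s0 * cabs (X o) ^+ 2).

Let mW : measurable_fun setT W.
Proof.
apply: measurableT_comp => //; apply: measurable_funM => //; apply: measurable_funX.
apply: (measurableT_comp (continuous_measurableC (@continuous_cabs R))).
exact: measurable_funPT.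
Qed.

Let W_ge1 o : 1 <= W o.
Proof. by rewrite -expR0 ler_expR mulr_ge0 ?exprn_ge0 ?cabs_ge0// ltW. Qed.

Lemma subgaussian_square_exp : exists2 M0 : R, 1 <= M0 & (\int[P]_o (W o)%:E = M0%:E)%E.
Proof.
(* Layers: where k + 1 < |X| <= k + 2 the single term f k dominates W, and where |X| <= 1 the
   constant [expR s0] does. *)
pose f k o : R := expR (s0 * k.+2%:R ^+ 2) * \1_[set o | k.+1%:R < cabs (X o)] o.
pose q := expR (- (2 * tau ^+ 2)^-1).
have q1 : q < 1 by rewrite /q -expR0 ltr_expR oppr_lt0 invr_gt0 mulr_gt0// exprn_gt0.
have f0 k o : 0 <= f k o by rewrite mulr_ge0// expR_ge0.
have mf k : measurable_fun setT (f k).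
  by apply: measurable_funM => //; apply: measurable_indic; exact: measurable_cabs_gt.
have Wf o : ((W o)%:E <= (expR s0)%:E + \sum_(0 <= k <oo) (f k o)%:E)%E.
  have [x1|x1] := lerP (cabs (X o)) 1.
    apply: (@le_trans _ _ (expR s0)%:E).
      by rewrite lee_fin ler_expR ler_piMr ?(ltW s0_gt0)// exprn_ile1 ?cabs_ge0.
    by apply: leeDl; apply: nneseries_ge0 => k _ _; rewrite lee_fin.
  have [k [k1 k2]] : exists k : nat, k.+1%:R < cabs (X o) /\ cabs (X o) <= k.+2%:R.
    have ex : exists k : nat, cabs (X o) <= k.+2%:R.
      exists (Num.bound (cabs (X o))).
      by apply/ltW/(lt_trans (archi_boundP (cabs_ge0 _))); rewrite ltr_nat.
    case: (ex_minnP ex) => k hk kmin; exists k; split => //.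
    case: k kmin hk => [|k] kmin hk //.
    by rewrite ltNge; apply/negP => /kmin; rewrite ltnn.
  apply: (@le_trans _ _ (\sum_(0 <= i < k.+1) (f i o)%:E)%E); last first.
    apply: (@le_trans _ _ (\sum_(0 <= k <oo) (f k o)%:E)%E).
      by apply: nneseries_lim_ge => i _ _; rewrite lee_fin.
    by apply: leeDr; rewrite lee_fin expR_ge0.
  rewrite sumEFin lee_fin big_nat_recr//=; apply: (@le_trans _ _ (f k o)); last first.
    by rewrite lerDr sumr_ge0.
  rewrite /f indicE mem_set// mulr1 ler_expR ler_wpM2l ?(ltW s0_gt0)//.
  by apply: lerXn2r => //; rewrite nnegrE ?cabs_ge0 ?ler0n.
have fin : (\int[P]_o (W o)%:E < +oo)%E.
  apply: (@le_lt_trans _ _ (\int[P]_o ((expR s0)%:E + \sum_(0 <= k <oo) (f k o)%:E))%E).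
    apply: ge0_le_integral => //.
    - by move=> o _; rewrite lee_fin expR_ge0.
    - exact/measurable_EFinP.
    - apply: emeasurable_funD => //; apply: ge0_emeasurable_sum.
        by move=> k o _ _; rewrite lee_fin.
      by move=> k _; exact/measurable_EFinP.
  rewrite ge0_integralD//; last 2 first.
  - by move=> o _; rewrite nneseries_ge0// => k _ _; rewrite lee_fin.
  - apply: ge0_emeasurable_sum.
      by move=> k o _ _; rewrite lee_fin.
    by move=> k _; exact/measurable_EFinP.
  rewrite integral_nneseries//; last 2 first.
  - by move=> k; exact/measurable_EFinP.
  - by move=> k o _; rewrite lee_fin.
  apply: lte_add_pinfty.
    rewrite integral_cst// -ge0_fin_numE; last by rewrite mule_ge0// lee_fin expR_ge0.
    by rewrite fin_numM// fin_num_measure.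
  apply: le_lt_trans (ltry (K / (1 - q))).
  apply: geometric_nneseries_le; rewrite ?expR_ge0 ?(ltW K_gt0)//.
    by move=> j; apply: integral_ge0 => o _; rewrite lee_fin.
  move=> j; rewrite /f; under eq_integral do rewrite EFinM.
  rewrite ge0_integralZl_EFin ?expR_ge0//; last first.
    by apply/measurable_EFinP; apply: measurable_indic; exact: measurable_cabs_gt.
  rewrite integral_indic//; last exact: measurable_cabs_gt.
  rewrite setIT; have j0 : 0 <= j.+1%:R :> R by [].
  apply: le_trans (lee_wpmul2l _ (X_tail j0)) _; first by rewrite lee_fin expR_ge0.
  rewrite -EFinM lee_fin mulrCA ler_pM2l// -expRD /q -expRM_natl ler_expR.
  rewrite mulrN /s0; have t2 : 0 < tau ^+ 2 by rewrite exprn_gt0.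
  have -> : (8 * tau ^+ 2)^-1 * j.+2%:R ^+ 2 + - (j.+1%:R ^+ 2 / tau ^+ 2) =
    ((j.+2%:R ^+ 2) / 8 - j.+1%:R ^+ 2) / tau ^+ 2 by field; rewrite gt_eqF.
  have -> : - (j%:R / (2 * tau ^+ 2)) = (- j%:R / 2) / tau ^+ 2 by field; rewrite gt_eqF.
  rewrite ler_pM2r ?invr_gt0//.
  have h0 : 0 <= j%:R :> R by [].
  by rewrite -(addn2 j) -(addn1 j) !natrD; nra.
exists (fine (\int[P]_o (W o)%:E)); last first.
  by rewrite fineK// ge0_fin_numE// integral_ge0// => o _; rewrite lee_fin expR_ge0.
rewrite -lee_fin fineK; last first.
  by rewrite ge0_fin_numE// integral_ge0// => o _; rewrite lee_fin expR_ge0.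
rewrite -(integral_cst_probability 1).
by apply: ge0_le_integral => //; [exact/measurable_EFinP|move=> o _; rewrite lee_fin].
Qed.

Hypothesis X_centred : centred X.

(** Put Y = Re (c X). If 2 |c|^2 <= s0, then exp Y <= Y + exp (2 Y^2), where Y has mean zero and 2
    Y^2 <= th s0 |X|^2 with th = 2 |c|^2 / s0 <= 1; convexity bounds the mean by 1 + th (M0 - 1).
    Otherwise Y <= |c|^2 / (4 s0) + s0 |X|^2 costs the factor M0 <= exp (M0 - 1), absorbed because 2
    |c|^2 / s0 > 1. *)
Lemma subgaussian_mgf : exists2 B : R, 0 < B & forall c : R[i],
  (\int[P]_o (expR (complex.Re (c * (X o : R[i]))))%:E <= (expR (B * cabs c ^+ 2))%:E)%E.
Proof.
have [M0 M01 EW] := subgaussian_square_exp.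
have W0 o : 0 <= W o by exact: expR_ge0.
have mX : measurable_fun setT X by exact: measurable_funPT.
have mY c : measurable_fun setT (fun o => complex.Re (c * (X o : R[i]))).
  exact: (measurableT_comp (measurable_Re_cmul c) mX).
have mEY c : measurable_fun setT (fun o => expR (complex.Re (c * (X o : R[i])))).
  exact: (measurableT_comp (@measurable_expR R) (mY c)).
have iW : P.-integrable setT (EFin \o W).
  apply/integrableP; split; first exact/measurable_EFinP.
  under eq_integral do rewrite gee0_abs ?lee_fin//.
  by rewrite /= EW ltry.
have absW o : cabs (X o) <= (1 + s0^-1) * W o.
  have h : 1 + s0 * cabs (X o) ^+ 2 <= W o by exact: expR_ge1Dx.
  have i0 : 0 < s0^-1 by rewrite invr_gt0.
  have h1 : cabs (X o) ^+ 2 = s0^-1 * (s0 * cabs (X o) ^+ 2).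
    by rewrite mulKf// gt_eqF.
  have x0 := cabs_ge0 (X o); have y0 := sqr_ge0 (cabs (X o)).
  have h2 : cabs (X o) <= 1 + cabs (X o) ^+ 2 by nra.
  apply: le_trans h2 _; rewrite mulrDl mul1r; apply: lerD; first exact: W_ge1.
  by rewrite h1 ler_pM2l//; apply: le_trans h; rewrite lerDr.
have iRe (h : R[i] -> R) : continuous h -> (forall z, `|h z| <= cabs z) ->
    P.-integrable setT (EFin \o (fun o => h (X o))).
  move=> ch hle; apply: (@le_integrable _ _ _ _ _ _ _ (EFin \o (fun o => (1 + s0^-1) * W o))) => //.
  - by apply/measurable_EFinP; apply: (measurableT_comp (continuous_measurableC ch)).
  - move=> o _ /=; rewrite lee_fin (le_trans (hle _))// (le_trans (absW o))//.
    exact: ler_norm.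
  - rewrite (_ : _ \o _ = (fun o => (1 + s0^-1)%:E * (EFin \o W) o)%E); last first.
      by apply/funext => o /=; rewrite EFinM.
    exact: integrableZl.
have iX := iRe _ continuous_ReC (@cabs_ge_Re R).
have iY := iRe _ continuous_ImC (@cabs_ge_Im R).
have EY c : (\int[P]_o (complex.Re (c * (X o : R[i])))%:E = 0)%E.
  have [E1 E2] := X_centred.
  under eq_integral do rewrite Re_cmul EFinB !EFinM.
  rewrite integralB//; [|exact: integrableZl|exact: integrableZl].
  rewrite !integralZl//; move: E1 E2; rewrite !unlock => -> ->.
  by rewrite !mule0 sube0.
have iY' c : P.-integrable setT (EFin \o (fun o => complex.Re (c * (X o : R[i])))).
  rewrite (_ : _ \o _ = (fun o => (complex.Re c)%:E * (complex.Re (X o))%:E -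
                                  (complex.Im c)%:E * (complex.Im (X o))%:E)%E).
    by apply: integrableB => //; apply: integrableZl.
  by apply/funext => o /=; rewrite Re_cmul EFinB !EFinM.
exists (2 * (M0 - 1) / s0 + (4 * s0)^-1).
  apply: ltr_wpDl; last by rewrite invr_gt0 mulr_gt0.
  by apply: divr_ge0; rewrite ?(ltW s0_gt0)// mulr_ge0// subr_ge0.
move=> c; have c0 := sqr_ge0 (cabs c).
have Yle o : complex.Re (c * (X o : R[i])) <= cabs c * cabs (X o).
  by rewrite -cabsM; apply: le_trans (ler_norm _) (cabs_ge_Re _).
have Yabs o : `|complex.Re (c * (X o : R[i]))| <= cabs c * cabs (X o).
  by rewrite -cabsM cabs_ge_Re.
have [small|large] := lerP (2 * cabs c ^+ 2) s0.
  pose th := 2 * cabs c ^+ 2 / s0.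
  have th0 : 0 <= th by apply: divr_ge0; [rewrite mulr_ge0|exact: ltW].
  have th1 : th <= 1 by rewrite ler_pdivrMr// mul1r.
  have pt o : expR (complex.Re (c * (X o : R[i]))) <=
      complex.Re (c * (X o : R[i])) + (1 - th + th * W o).
    apply: le_trans (expR_le_sqr _) _; rewrite lerD2l.
    apply: (@le_trans _ _ (expR (th * (s0 * cabs (X o) ^+ 2)))).
      rewrite ler_expR; have -> : th * (s0 * cabs (X o) ^+ 2) =
          2 * (cabs c * cabs (X o)) ^+ 2 by rewrite /th exprMn; field; rewrite gt_eqF.
      rewrite ler_pM2l// -real_normK ?num_real// lerXn2r ?nnegrE ?mulr_ge0 ?cabs_ge0//.
    exact: expR_convex0.
  have iZ : P.-integrable setT (fun o => (1 - th + th * W o)%:E).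
    rewrite (_ : (fun o => _) = (fun o => (1 - th)%:E + th%:E * (EFin \o W) o)%E).
      apply: integrableD => //; last exact: integrableZl.
      exact: finite_measure_integrable_cst.
    by apply/funext => o /=; rewrite EFinD EFinM.
  apply: (@le_trans _ _ (\int[P]_o ((complex.Re (c * (X o : R[i])))%:E + (1 - th + th * W o)%:E))%E).
    apply: ge0_le_integral => //.
    - exact/measurable_EFinP.
    - rewrite (_ : (fun o => _) = EFin \o (fun o => complex.Re (c * (X o : R[i])) + (1 - th + th * W o))).
        apply/measurable_EFinP; apply: measurable_funD => //.
        by apply: measurable_funD => //; exact: measurable_funM.
      by apply/funext => o; rewrite /= EFinD.
    - by move=> o _; rewrite -EFinD lee_fin.
  rewrite integralD//; last exact: iY'.
  rewrite EY add0e; under eq_integral do rewrite EFinD EFinM.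
  rewrite ge0_integralD//; last 3 first.
  - by move=> o _; rewrite lee_fin subr_ge0.
  - by move=> o _; rewrite -EFinM lee_fin mulr_ge0.
  - under eq_fun do rewrite -EFinM; apply/measurable_EFinP; exact: measurable_funM.
  rewrite ge0_integralZl_EFin//; last 2 first.
  - by move=> o _; rewrite lee_fin.
  - exact/measurable_EFinP.
  rewrite EW integral_cst_probability -EFinM -EFinD lee_fin.
  have -> : 1 - th + th * M0 = 1 + th * (M0 - 1) by ring.
  apply: le_trans (expR_ge1Dx _) _; rewrite ler_expR mulrDl.
  have -> : 2 * (M0 - 1) / s0 * cabs c ^+ 2 = th * (M0 - 1) by rewrite /th; ring.
  by rewrite lerDl mulr_ge0// invr_ge0 mulr_ge0// ltW.
have pt o : expR (complex.Re (c * (X o : R[i]))) <= expR ((4 * s0)^-1 * cabs c ^+ 2) * W o.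
  rewrite -expRD ler_expR; apply: le_trans (Yle o) _.
  have s40 : 0 < 4 * s0 by rewrite mulr_gt0.
  rewrite -(ler_pM2l s40) mulrDr mulVKf ?gt_eqF//.
  have := sqr_ge0 (cabs c - 2 * s0 * cabs (X o)); lra.
apply: (@le_trans _ _ (\int[P]_o ((expR ((4 * s0)^-1 * cabs c ^+ 2))%:E * (W o)%:E))%E).
  apply: ge0_le_integral => //.
  - exact/measurable_EFinP.
  - by under eq_fun do rewrite -EFinM; apply/measurable_EFinP; exact: measurable_funM.
  - by move=> o _; rewrite -EFinM lee_fin.
rewrite ge0_integralZl_EFin ?expR_ge0//; last 2 first.
- by move=> o _; rewrite lee_fin.
- exact/measurable_EFinP.
rewrite EW -EFinM lee_fin.
have -> : (2 * (M0 - 1) / s0 + (4 * s0)^-1) * cabs c ^+ 2 =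
  (4 * s0)^-1 * cabs c ^+ 2 + 2 * (M0 - 1) / s0 * cabs c ^+ 2 by ring.
rewrite expRD ler_wpM2l ?expR_ge0//.
apply: (@le_trans _ _ (expR (M0 - 1))).
  by apply: le_trans (expR_ge1Dx _); rewrite addrC subrK.
rewrite ler_expR; have -> : 2 * (M0 - 1) / s0 * cabs c ^+ 2 =
  (M0 - 1) * (2 * cabs c ^+ 2 / s0) by ring.
by rewrite ler_peMr ?subr_ge0// ler_pdivlMr// mul1r ltW.
Qed.

End SubgaussianSums.

(** * Subgaussian deviations of weighted sums *)

Section Deviations.
Context (R : realType) d (Omega : measurableType d) (P : probability Omega R).
Variables (X : {RV P >-> borelC R}) (X_ : nat -> {RV P >-> borelC R}).
Hypothesis X_iid : iid_copies X X_.
Variables (B : R) (B_gt0 : 0 < B).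
Hypothesis X_mgf : forall c : R[i],
  (\int[P]_o (expR (complex.Re (c * (X o : R[i]))))%:E <= (expR (B * cabs c ^+ 2))%:E)%E.

Lemma iid_integral n (f : borelC R -> R) : measurable_fun setT f ->
  (forall y, 0 <= f y) ->
  (\int[P]_o (f (X_ n o))%:E = \int[P]_o (f (X o))%:E)%E.
Proof.
move=> mf f0.
have mf' : measurable_fun setT (EFin \o f) by apply/measurable_EFinP.
have f0' y : (0 <= (EFin \o f) y)%E by rewrite /= lee_fin.
have h1 := ge0_integral_distribution (X_ n) mf' f0'.
have h2 := ge0_integral_distribution X mf' f0'.
transitivity (\int[distribution P (X_ n)]_y (EFin \o f) y)%E; first by rewrite h1.
transitivity (\int[distribution P X]_y (EFin \o f) y)%E; last by rewrite h2.
by apply: eq_measure_integral => A mA _; case: X_iid => _ /(_ n A mA).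
Qed.

Let Rsum (c : nat -> R[i]) N (o : Omega) : R :=
  \sum_(n < N) complex.Re (c n * (X_ n o : R[i])).

Let mRsum c N : measurable_fun setT (Rsum c N).
Proof.
apply: measurable_sum => n; apply: (measurableT_comp (measurable_Re_cmul (c n))).
exact: measurable_funPT.
Qed.

Let Dev (c : nat -> R[i]) N (x : R) := [set o | x <= Rsum c N o].

Let mDev c N x : measurable (Dev c N x).
Proof.
have -> : Dev c N x = setT `&` Rsum c N @^-1` `[x, +oo[%classic.
  by rewrite setTI; apply/seteqP; split => o /=; rewrite in_itv /= andbT.
exact: mRsum.
Qed.

Lemma one_sided_deviation (c : nat -> R[i]) N (sigma t : R) : 0 < sigma -> 0 <= t ->
  \sum_(n < N) cabs (c n) ^+ 2 <= sigma ^+ 2 ->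
  (P (Dev c N (t * sigma)) <= (expR (- (t ^+ 2 / (4 * B))))%:E)%E.
Proof.
(* Chernoff's bound: this lam minimises B lam^2 sigma^2 - lam t sigma, with minimum - t^2 / (4
   B). *)
move=> s0 t0 cs; pose lam := t / (2 * B * sigma).
have lam0 : 0 <= lam by rewrite divr_ge0// !mulr_ge0// ltW.
pose f n (y : borelC R) := expR (complex.Re (lam%:C%C * c n * (y : R[i]))).
have mf n : measurable_fun setT (f n).
  apply: (measurableT_comp (@measurable_expR R)); exact: measurable_Re_cmul.
have f0 n y : 0 <= f n y by exact: expR_ge0.
have Ef n : (\int[P]_o (f n (X_ n o))%:E <= (expR (B * (lam * cabs (c n)) ^+ 2))%:E)%E.
  rewrite iid_integral//; apply: le_trans (X_mgf _) _.
  by rewrite cabsM cabs_real (ger0_norm lam0).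
have fE n : (\int[P]_o (f n (X_ n o))%:E = (fine (\int[P]_o (f n (X_ n o))%:E))%:E)%E.
  rewrite fineK// ge0_fin_numE; last by apply: integral_ge0 => o _; rewrite lee_fin.
  exact: le_lt_trans (Ef n) (ltry _).
have [ind _] := X_iid.
have := ge0_integral_prod_indep ind mf f0 fE N.
have -> : (\int[P]_o (\prod_(n < N) f n (X_ n o))%:E =
    \int[P]_o (expR (lam * Rsum c N o))%:E)%E.
  apply: eq_integral => o _; rewrite /f.
  rewrite -expR_sum.
  rewrite /Rsum mulr_sumr; congr (expR _)%:E; apply: eq_bigr => n _.
  by rewrite -mulrA Re_cmul /= mul0r subr0.
move=> Eprod.
have mg : measurable_fun setT (fun o => expR (lam * Rsum c N o)).
  by apply: (measurableT_comp (@measurable_expR R)); apply: measurable_funM.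
have De o : Dev c N (t * sigma) o -> expR (lam * (t * sigma)) <= expR (lam * Rsum c N o).
  by move=> Do; rewrite ler_expR ler_wpM2l.
have := ge0_markov P (mDev c N (t * sigma)) mg (fun o => expR_ge0 _)
  (expR_ge0 (lam * (t * sigma))) De.
have le1 : \prod_(n < N) fine (\int[P]_o (f n (X_ n o))%:E) <= expR (B * lam ^+ 2 * sigma ^+ 2).
  apply: (@le_trans _ _ (\prod_(n < N) expR (B * (lam * cabs (c n)) ^+ 2))).
    apply: ler_prod => n _; apply/andP; split.
      by rewrite fine_ge0// integral_ge0// => o _; rewrite lee_fin.
    by rewrite -lee_fin -fE; exact: Ef.
  rewrite -expR_sum ler_expR.
  under eq_bigr do rewrite exprMn mulrA.
  by rewrite -mulr_sumr ler_wpM2l// mulr_ge0 ?sqr_ge0// ltW.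
have [x Px] : exists x, P (Dev c N (t * sigma)) = x%:E.
  by exists (fine (P (Dev c N (t * sigma)))); rewrite fineK// fin_num_measure.
rewrite Eprod Px -EFinM !lee_fin => /le_trans/(_ le1) h.
have -> : - (t ^+ 2 / (4 * B)) = B * lam ^+ 2 * sigma ^+ 2 - lam * (t * sigma).
  by rewrite /lam; field; rewrite !gt_eqF.
by rewrite expRD expRN ler_pdivlMr ?expR_gt0// mulrC.
Qed.

(** Rotating the coefficients by 1, -1, i and -i turns the one-sided bound into bounds for the real
    and imaginary parts on both sides; hence the factors 4 and 2. *)
Lemma deviation_event (c : nat -> R[i]) N (sigma t : R) : 0 < sigma -> 0 <= t ->
  \sum_(n < N) cabs (c n) ^+ 2 <= sigma ^+ 2 ->
  exists E, [/\ measurable E, (P E <= (4 * expR (- (t ^+ 2 / (4 * B))))%:E)%E &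
    forall o, ~ E o -> cabs (\sum_(n < N) c n * (X_ n o : R[i])) <= 2 * t * sigma].
Proof.
move=> s0 t0 cs.
pose D (u : R[i]) := Dev (fun n => u * c n) N (t * sigma).
have PD u : cabs u = 1 -> (P (D u) <= (expR (- (t ^+ 2 / (4 * B))))%:E)%E.
  move=> u1; apply: one_sided_deviation => //.
  by under eq_bigr do rewrite cabsM u1 mul1r.
have mD u : measurable (D u) by exact: mDev.
exists ((D 1 `|` D (-1)) `|` (D 'i%C `|` D (- 'i%C))); split.
- by do !apply: measurableU.
- have i1 : cabs 'i%C = 1 :> R by rewrite /= expr0n expr1n add0r sqrtr1.
  have -> : 4 * expR (- (t ^+ 2 / (4 * B))) = (expR (- (t ^+ 2 / (4 * B))) +
    expR (- (t ^+ 2 / (4 * B)))) + (expR (- (t ^+ 2 / (4 * B))) +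
    expR (- (t ^+ 2 / (4 * B)))) by ring.
  rewrite !EFinD; have U2 A B' : measurable A -> measurable B' ->
      (P (A `|` B') <= P A + P B')%E.
    by move=> mA mB; apply: measureU2.
  apply: le_trans (U2 _ _ _ _) _; [exact: measurableU|exact: measurableU|].
  apply: leeD; (apply: le_trans (U2 _ _ _ _) _; [exact: mD|exact: mD|]; apply: leeD; apply: PD);
    by rewrite ?cabsN ?cabs1.
move=> o nE; set Z := \sum_(n < N) _.
have nD u : ~ D u o -> complex.Re (u * Z) <= t * sigma.
  move=> /negP; rewrite -ltNge => /ltW; apply: le_trans.
  have -> : u * Z = \sum_(n < N) u * c n * (X_ n o : R[i]).
    by rewrite /Z mulr_sumr; apply: eq_bigr => n _; rewrite mulrA.
  by rewrite (Re_sum _ (fun n => u * c n * (X_ n o : R[i]))).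
have h1 := nD 1 (fun h => nE (or_introl (or_introl h))).
have h2 := nD (-1) (fun h => nE (or_introl (or_intror h))).
have h3 := nD 'i%C (fun h => nE (or_intror (or_introl h))).
have h4 := nD (- 'i%C) (fun h => nE (or_intror (or_intror h))).
apply: le_trans (cabs_le_ReIm _) _.
clear nD; clearbody Z; case: Z h1 h2 h3 h4 => x y; rewrite !Re_cmul /= => h1 h2 h3 h4.
have -> : 2 * t * sigma = t * sigma + t * sigma by ring.
by apply: lerD; rewrite ler_norml; apply/andP; split; lra.
Qed.

End Deviations.

(** * Random polynomials bounded on the disc through a grid *)

Section GridBounds.
Variable R : realType.

(** Rounding goes toward 0, not to the nearest point: the grid point then has no larger modulus than
    z, so the quadratic sum at its radius is dominated by the one at |z|. *)
Lemma round_toward0 (x : R) (m : nat) : (0 < m)%N -> `|x| <= 1 ->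
  exists k, [/\ (k < (2 * m).+1)%N, `|(k%:R - m%:R) / m%:R| <= `|x| &
    `|x - (k%:R - m%:R) / m%:R| <= m%:R^-1].
Proof.
move=> m0 x1; have mR : 0 < m%:R :> R by rewrite ltr0n.
have y0 : 0 <= `|x| * m%:R by rewrite mulr_ge0.
pose t := Num.truncn (`|x| * m%:R).
have /andP[t1 t2] : t%:R <= `|x| * m%:R < t.+1%:R by exact: truncn_itv.
have tm : (t <= m)%N.
  by rewrite -(ler_nat R); apply: le_trans t1 _; rewrite ler_piMl// ltW.
have tx : t%:R / m%:R <= `|x| by rewrite ler_pdivrMr.
have xt : `|x| - t%:R / m%:R <= m%:R^-1.
  have mN0 : m%:R != 0 :> R by rewrite gt_eqF.
  rewrite lerBlDr (_ : m%:R^-1 + _ = t.+1%:R / m%:R); last by rewrite -natr1; field.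
  by rewrite ler_pdivlMr// ltW.
have tm0 : 0 <= t%:R / m%:R :> R by rewrite divr_ge0.
have [x0|x0] := lerP 0 x.
  exists (m + t)%N; rewrite natrD addrAC subrr add0r; split; first lia.
    by rewrite ger0_norm.
  by move: tx xt; rewrite (ger0_norm x0) => tx xt; rewrite ger0_norm// subr_ge0.
exists (m - t)%N; rewrite natrB// addrAC subrr add0r mulNr; split; first lia.
  by rewrite normrN ger0_norm.
move: tx xt; rewrite (ltr0_norm x0) => tx xt; rewrite opprK ler_norml; lra.
Qed.

Definition grid_pt (m k l : nat) : R[i] :=
  (((k%:R - m%:R) / m%:R) +i* ((l%:R - m%:R) / m%:R))%C.

Lemma grid_round (z : R[i]) (m : nat) : (0 < m)%N -> cabs z < 1 ->
  exists k l, [/\ (k < (2 * m).+1)%N, (l < (2 * m).+1)%N,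
    cabs (grid_pt m k l) <= cabs z & cabs (z - grid_pt m k l) <= 2 / m%:R].
Proof.
move=> m0 z1.
have [k [km k1 k2]] := round_toward0 m0 (le_trans (cabs_ge_Re z) (ltW z1)).
have [l [lm l1 l2]] := round_toward0 m0 (le_trans (cabs_ge_Im z) (ltW z1)).
exists k, l; split => //.
  case: z {z1 k2 l2} k1 l1 => x y /= k1 l1.
  change (Num.sqrt (((k%:R - m%:R) / m%:R) ^+ 2 + ((l%:R - m%:R) / m%:R) ^+ 2)
    <= Num.sqrt (x ^+ 2 + y ^+ 2)); apply: ler_wsqrtr.
  have sq (u v : R) : `|u| <= `|v| -> u ^+ 2 <= v ^+ 2.
    by move=> uv; rewrite -real_normK ?num_real// -(real_normK (num_real v)) lerXn2r ?nnegrE.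
  by apply: lerD; exact: sq.
apply: le_trans (cabs_le_ReIm _) _; rewrite mulr_natl mulr2n.
by case: z {z1 k1 l1} k2 l2 => x y /= k2 l2; exact: lerD.
Qed.

(** The bound n |z|^(n-1) |z - v|, multiplied by |z| so that the power matches the term |a_n|
    |z|^n. *)
Lemma cabs_exp_sub (z v : R[i]) n : cabs v <= cabs z ->
  cabs (z ^+ n - v ^+ n) * cabs z <= n%:R * cabs z ^+ n * cabs (z - v).
Proof.
move=> vz; elim: n => [|n IH]; first by rewrite !expr0 subrr cabs0 !mul0r.
have -> : z ^+ n.+1 - v ^+ n.+1 = z * (z ^+ n - v ^+ n) + (z - v) * v ^+ n.
  by rewrite !exprS; ring.
have z0 := cabs_ge0 z.
apply: le_trans (ler_wpM2r z0 (cabsD _ _)) _.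
rewrite !cabsM cabsX mulrDl -natr1 !exprS.
have h1 : cabs v ^+ n <= cabs z ^+ n by rewrite lerXn2r ?nnegrE ?cabs_ge0.
have h2 := ler_wpM2l z0 IH; have d0 := cabs_ge0 (z - v).
have h3 : cabs (z - v) * cabs v ^+ n * cabs z <= cabs (z - v) * cabs z ^+ n * cabs z.
  by rewrite ler_wpM2r// ler_wpM2l.
lra.
Qed.

Definition l2_partial (a : nat -> R[i]) N (r : R) : R :=
  Num.sqrt (\sum_(n < N) cabs (a n) ^+ 2 * r ^+ (2 * n)).

Lemma l2_partial_sqr a N r : l2_partial a N r ^+ 2 =
  \sum_(n < N) cabs (a n) ^+ 2 * r ^+ (2 * n).
Proof.
by rewrite sqr_sqrtr// sumr_ge0// => n _; rewrite mulr_ge0 ?sqr_ge0// exprM exprn_ge0 ?sqr_ge0.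
Qed.

Lemma l2_partial_le a N r s : 0 <= r -> r <= s -> l2_partial a N r <= l2_partial a N s.
Proof.
move=> r0 rs; rewrite ler_wsqrtr// ler_sum// => n _.
by rewrite ler_wpM2l ?sqr_ge0// lerXn2r// nnegrE ?(le_trans r0).
Qed.

Lemma term_le_l2_partial a N r n : 0 <= r -> (n < N)%N ->
  cabs (a n) * r ^+ n <= l2_partial a N r.
Proof.
move=> r0 nN; rewrite -[leLHS]ger0_norm ?mulr_ge0 ?cabs_ge0 ?exprn_ge0//.
rewrite -sqrtr_sqr ler_wsqrtr// (bigD1 (Ordinal nN))//= exprMn -exprM mulnC lerDl.
by rewrite sumr_ge0// => i _; rewrite mulr_ge0 ?sqr_ge0// exprM exprn_ge0 ?sqr_ge0.
Qed.

(** Each of the N terms of the difference is at most 2 L N |z - v| times |a_n| |z|^n, which is below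
    the quadratic sum; the factor 2 bounds 1 / |z|. *)
Lemma random_poly_dist (x a : nat -> R[i]) N (L : R) (z v : R[i]) :
  (forall n, (n < N)%N -> cabs (x n) <= L) -> 0 <= L -> cabs v <= cabs z -> 1 / 2 <= cabs z ->
  cabs (\sum_(n < N) a n * z ^+ n * x n) <=
  cabs (\sum_(n < N) a n * v ^+ n * x n) +
    N%:R * (L * (2 * N%:R * cabs (z - v))) * l2_partial a N (cabs z).
Proof.
move=> xL L0 vz z2; apply: le_trans (cabs_le_triangle _ (\sum_(n < N) a n * v ^+ n * x n)) _.
rewrite lerD2l -sumrB; apply: le_trans (cabs_sum _ (fun n => a n * z ^+ n * x n - a n * v ^+ n * x n)) _.
have z0 := cabs_ge0 z; have d0 := cabs_ge0 (z - v).
have S0 : 0 <= l2_partial a N (cabs z) by exact: sqrtr_ge0.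
apply: (@le_trans _ _ (\sum_(n < N) L * (2 * N%:R * cabs (z - v)) * l2_partial a N (cabs z))).
  apply: ler_sum => n _; rewrite -mulrBl -mulrBr !cabsM.
  have h := cabs_exp_sub n vz.
  have a0 := cabs_ge0 (a n); have e0 := cabs_ge0 (z ^+ n - v ^+ n).
  have h1 : cabs (z ^+ n - v ^+ n) <= 2 * n%:R * cabs z ^+ n * cabs (z - v) by nra.
  have nN : n%:R <= N%:R :> R by rewrite ler_nat ltnW.
  have h2 := term_le_l2_partial a z0 (ltn_ord n).
  have t0 : 0 <= cabs (a n) * cabs z ^+ n by rewrite mulr_ge0// exprn_ge0.
  have h3 : cabs (a n) * cabs (z ^+ n - v ^+ n) <=
      2 * N%:R * cabs (z - v) * l2_partial a N (cabs z).
    apply: le_trans (ler_wpM2l a0 h1) _.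
    have -> : cabs (a n) * (2 * n%:R * cabs z ^+ n * cabs (z - v)) =
      (2 * n%:R * cabs (z - v)) * (cabs (a n) * cabs z ^+ n) by ring.
    apply: ler_pM => //; first by rewrite !mulr_ge0.
    by rewrite ler_wpM2r// ler_wpM2l.
  have -> : L * (2 * N%:R * cabs (z - v)) * l2_partial a N (cabs z) =
     (2 * N%:R * cabs (z - v) * l2_partial a N (cabs z)) * L by ring.
  by apply: ler_pM; rewrite ?mulr_ge0 ?cabs_ge0// xL.
rewrite sumr_const card_ord -mulr_natl.
by rewrite le_eqVlt; apply/orP; left; apply/eqP; ring.
Qed.

Context d (Omega : measurableType d) (P : probability Omega R).
Variables (X_ : nat -> {RV P >-> borelC R}) (B : R) (B_gt0 : 0 < B).
Hypothesis X_deviation : forall (c : nat -> R[i]) N (sigma t : R), 0 < sigma -> 0 <= t ->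
  \sum_(n < N) cabs (c n) ^+ 2 <= sigma ^+ 2 ->
  exists E, [/\ measurable E, (P E <= (4 * expR (- (t ^+ 2 / (4 * B))))%:E)%E &
    forall o, ~ E o -> cabs (\sum_(n < N) c n * (X_ n o : R[i])) <= 2 * t * sigma].
Hypothesis X_growth : {ae P, forall o, exists m0, forall m, (m0 <= m)%N ->
  cabs (X_ m o) <= Num.sqrt m%:R}.
Variable a : nat -> R[i].
Hypothesis a0 : a 0%N = 1.

(* With this threshold the deviation probability at level j is 4 / 512^j,
   which beats the number (2 * 16^j + 1)^2 of grid points. *)
Definition grid_threshold (j : nat) : R := Num.sqrt (4 * B * ln 512 * j%:R).

Lemma l2_partial_ge1 N r : (0 < N)%N -> 1 <= l2_partial a N r.
Proof.
move=> N0; rewrite -[leLHS]sqrtr1 ler_wsqrtr// (bigD1 (Ordinal N0))//=.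
rewrite a0 cabs1 expr1n muln0 expr0 mulr1 lerDl.
by rewrite sumr_ge0// => i _; rewrite mulr_ge0 ?sqr_ge0// exprM exprn_ge0 ?sqr_ge0.
Qed.

Lemma grid_bound_ae : {ae P, forall o, exists J, forall j, (J <= j)%N ->
  forall k l, (k < (2 * 16 ^ j).+1)%N -> (l < (2 * 16 ^ j).+1)%N ->
  let v := grid_pt (16 ^ j) k l in
  cabs (\sum_(n < 2 ^ j) a n * v ^+ n * (X_ n o : R[i])) <=
    2 * grid_threshold j * l2_partial a (2 ^ j) (cabs v)}.
Proof.
pose M j := (2 * 16 ^ j).+1.
(* A pair (k, l) of grid indices is coded as k * M j + l and decoded by quotient and remainder. *)
have /choice[E hE] (ji : nat * nat) : exists E,
    let v := grid_pt (16 ^ ji.1) (ji.2 %/ M ji.1) (ji.2 %% M ji.1) in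
    [/\ measurable E, (P E <= (4 * (512^-1) ^+ ji.1)%:E)%E &
    forall o, ~ E o -> cabs (\sum_(n < 2 ^ ji.1) a n * v ^+ n * (X_ n o : R[i])) <=
      2 * grid_threshold ji.1 * l2_partial a (2 ^ ji.1) (cabs v)].
  case: ji => j i /=; set v := grid_pt _ _ _.
  have s0 : 0 < l2_partial a (2 ^ j) (cabs v).
    by apply: lt_le_trans ltr01 _; apply: l2_partial_ge1; rewrite expn_gt0.
  have [|E [mE PE hE]] := @X_deviation (fun n => a n * v ^+ n) (2 ^ j) _
      (grid_threshold j) s0 (sqrtr_ge0 _).
    rewrite l2_partial_sqr ler_sum// => n _.
    by rewrite cabsM cabsX exprMn -exprM mulnC.
  exists E; split => //; apply: le_trans PE _.
  rewrite lee_fin ler_pM2l// /grid_threshold sqr_sqrtr; last first.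
    by rewrite !mulr_ge0 ?ln_ge0 ?ler1n// ltW.
  have -> : - (4 * B * ln 512 * j%:R / (4 * B)) = j%:R * (- ln 512).
    by field; rewrite gt_eqF.
  have p512 : (512 : R) \is Num.pos by rewrite posrE ltr0n.
  by rewrite expRM_natl expRN (lnK p512).
pose F j := \big[setU/set0]_(i < M j * M j) E (j, nat_of_ord i).
have mF j : measurable (F j).
  by apply: bigsetU_measurable => i _; have [] := hE (j, nat_of_ord i).
(* Union bound: at most (3 * 16^j)^2 points with probability 4 * 512^-j each, and 256 / 512 =
   1/2. *)
have PF j : (P (F j) <= (36 * (1 / 2) ^+ j)%:E)%E.
  have mE i : (i < M j * M j)%N -> measurable (E (j, i)) by have [] := hE (j, i).
  apply: le_trans (@Boole_inequality _ _ _ P (fun i => E (j, i)) (M j * M j) mE) _.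
  apply: (@le_trans _ _ (\sum_(i < M j * M j) (4 * (512^-1) ^+ j)%:E)%E).
    by apply: lee_sum => i _; have [] := hE (j, nat_of_ord i).
  rewrite sumEFin lee_fin sumr_const card_ord -[leLHS]mulr_natl.
  have M3 : (M j)%:R <= 3 * 16 ^+ j :> R.
    rewrite -natrX -natrM ler_nat /M; have : (0 < 16 ^ j)%N by rewrite expn_gt0.
    lia.
  have -> : 36 * (1 / 2) ^+ j = (3 * 16 ^+ j * (3 * 16 ^+ j)) * (4 * (512^-1) ^+ j) :> R.
    have -> : 1 / 2 = 16 * 16 * 512^-1 :> R by field.
    by rewrite !exprMn; ring.
  have q0 : 0 <= 4 * (512^-1) ^+ j :> R.
    by apply: mulr_ge0; [exact: ler0n|apply: exprn_ge0; rewrite invr_ge0 ler0n].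
  rewrite natrM; apply: ler_wpM2r; first exact: q0.
  by apply: ler_pM; [exact: ler0n|exact: ler0n|exact: M3|exact: M3].
have h36 : 0 <= 36 :> R by [].
have h12 : 0 <= 1 / 2 :> R by lra.
have h12' : 1 / 2 < 1 :> R by lra.
apply: filterS (borel_cantelli_geometric mF h36 h12 h12' PF) => o [J hJ].
exists J => j Jj k l kM lM; have := hJ j Jj; rewrite /F => nF.
have iM : (k * M j + l < M j * M j)%N.
  have : (k.+1 * M j <= M j * M j)%N by rewrite leq_mul2r kM orbT.
  by rewrite mulSn; move: lM; rewrite -/(M j); lia.
have [_ _ /(_ o)] := hE (j, k * M j + l)%N => /=.
rewrite divnMDl// modnMDl divn_small// modn_small// addn0; apply.
move=> Eo; apply: nF; rewrite -(bigcup_mkord _ (fun i => E (j, i))).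
by exists (k * M j + l)%N.
Qed.

(** With N = 2^j large, all variables of index below N are at most N, and a grid point lies within 2
    / N^4; the transfer from the grid then costs the factor 4 / N <= 8. *)
Lemma random_poly_bound_ae : {ae P, forall o, exists J, forall j, (J <= j)%N ->
  forall z : R[i], 1 / 2 <= cabs z -> cabs z < 1 ->
  cabs (\sum_(n < 2 ^ j) a n * z ^+ n * (X_ n o : R[i])) <=
    (2 * grid_threshold j + 8) * l2_partial a (2 ^ j) (cabs z)}.
Proof.
apply: filterS2 grid_bound_ae X_growth => o [J hJ] [m0 hm0].
pose L := Num.bound (\sum_(i < m0) cabs (X_ i o)).
exists (maxn J L) => j; rewrite geq_max => /andP[/hJ grid Lj] z z2 z1.
have m16 : (0 < 16 ^ j)%N by rewrite expn_gt0.
have [k [l [kM lM vz zv]]] := grid_round m16 z1.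
set v := grid_pt _ _ _ in vz zv.
pose N := (2 ^ j)%:R : R.
have N1 : 1 <= N by rewrite ler1n expn_gt0.
have jN : (j < 2 ^ j)%N by exact: ltn_expl.
have xN n : (n < 2 ^ j)%N -> cabs (X_ n o) <= N.
  move=> nN; have [mn|nm] := leqP m0 n.
    apply: le_trans (hm0 n mn) _.
    rewrite -[N]ger0_norm ?(le_trans ler01)// -sqrtr_sqr ler_wsqrtr//.
    have : n%:R <= N by rewrite ler_nat ltnW.
    by nra.
  apply: (@le_trans _ _ (\sum_(i < m0) cabs (X_ i o))).
    rewrite (bigD1 (Ordinal nm))//= lerDl sumr_ge0// => i _; exact: cabs_ge0.
  apply: le_trans (ltW (archi_boundP _)) _.
    by rewrite sumr_ge0// => i _; exact: cabs_ge0.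
  by rewrite ler_nat; apply: leq_trans Lj _; exact: ltnW.
have N0 : 0 <= N by apply: le_trans N1.
apply: le_trans (random_poly_dist a xN N0 vz z2) _.
rewrite [leRHS]mulrDl; apply: lerD.
  apply: le_trans (grid k l kM lM) _; rewrite ler_wpM2l ?mulr_ge0 ?sqrtr_ge0//.
  by apply: l2_partial_le => //; exact: cabs_ge0.
rewrite ler_wpM2r ?sqrtr_ge0//.
apply: (@le_trans _ _ (N * (N * (2 * N * (2 / (16 ^ j)%:R))))).
  by rewrite !ler_wpM2l// mulr_ge0.
have -> : (16 ^ j)%:R = N * N * N * N :> R.
  by rewrite /N -!natrM -!expnMn.
have Np : 0 < N by apply: lt_le_trans N1.
have -> : N * (N * (2 * N * (2 / (N * N * N * N)))) = 4 / N by field; rewrite gt_eqF.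
by rewrite ler_pdivrMr//; lra.
Qed.

End GridBounds.

(** * The maximal term and the exceptional set *)

Section MaxTerm.
Variables (R : realType) (a : nat -> R[i]).
Hypothesis a0 : a 0%N = 1.
Hypothesis a_bounded : coef_bounded a.

Lemma has_sup_max_term (r : R) : 0 <= r -> r < 1 ->
  has_sup [set cabs (a n) * r ^+ n | n in [set: nat]].
Proof.
move=> r0 r1; split; first by exists (cabs (a 0%N) * r ^+ 0), 0%N.
by have [B _ hB] := a_bounded r0 r1; exists B => _ [n _ <-].
Qed.

Lemma term_le_max_term (r : R) n : 0 <= r -> r < 1 ->
  cabs (a n) * r ^+ n <= max_term a r.
Proof.
by move=> r0 r1; apply: ub_le_sup; [have [] := has_sup_max_term r0 r1|exists n].
Qed.

Lemma max_term_ge1 (r : R) : 0 <= r -> r < 1 -> 1 <= max_term a r.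
Proof.
by move=> r0 r1; have := term_le_max_term 0 r0 r1; rewrite a0 cabs1 mul1r expr0.
Qed.

Lemma max_term_le (r s : R) : 0 <= r -> r <= s -> s < 1 -> max_term a r <= max_term a s.
Proof.
move=> r0 rs s1; apply: ge_sup.
  by have [] := has_sup_max_term r0 (le_lt_trans rs s1).
move=> _ [n _ <-]; apply: le_trans (term_le_max_term n (le_trans r0 rs) s1).
by rewrite ler_wpM2l ?cabs_ge0// lerXn2r ?nnegrE// (le_trans r0).
Qed.

Definition log_max_term (r : R) := ln (max_term a r / (1 - r)).

Local Notation u := log_max_term.

Lemma max_term_div_gt0 (r : R) : 0 <= r -> r < 1 -> 0 < max_term a r / (1 - r).
Proof.
move=> r0 r1; rewrite divr_gt0 ?subr_gt0//.
exact: lt_le_trans ltr01 (max_term_ge1 r0 r1).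
Qed.

Lemma expR_log_max_term (r : R) : 0 <= r -> r < 1 ->
  max_term a r = (1 - r) * expR (u r).
Proof.
move=> r0 r1; rewrite lnK ?posrE ?max_term_div_gt0// mulrC divfK// gt_eqF//.
by rewrite subr_gt0.
Qed.

Lemma log_max_term_le (r s : R) : 0 <= r -> r <= s -> s < 1 -> u r <= u s.
Proof.
move=> r0 rs s1; have r1 := le_lt_trans rs s1; have s0 := le_trans r0 rs.
rewrite ler_ln ?posrE ?max_term_div_gt0//.
have p1 : 0 < 1 - r by rewrite subr_gt0.
have p2 : 0 < 1 - s by rewrite subr_gt0.
apply: ler_pM; rewrite ?invr_ge0 ?(ltW p1)//.
- exact: le_trans ler01 (max_term_ge1 r0 r1).
- exact: max_term_le.
- by rewrite lef_pV2 ?posrE//; lra.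
Qed.

(** Since mu_f >= 1, u(r) is at least - ln (1 - r); in particular u is unbounded and every level is
    reached. *)
Lemma log_max_term_ge (r x : R) : 0 <= r -> r < 1 -> 1 - r <= expR (- x) -> x <= u r.
Proof.
move=> r0 r1 rx; have p1 : 0 < 1 - r by rewrite subr_gt0.
rewrite -[x]expRK ler_ln ?posrE ?expR_gt0 ?max_term_div_gt0//.
rewrite ler_pdivlMr//; apply: le_trans (max_term_ge1 r0 r1).
apply: le_trans (ler_wpM2l (expR_ge0 x) rx) _.
by rewrite expRxMexpNx_1.
Qed.

Definition level_set (x : R) := [set r : R | 0 <= r < 1 /\ x <= u r].

(** Generalised inverse of the nondecreasing function [log_max_term]. *)
Definition level (x : R) := inf (level_set x).

Lemma level_set_neq0 (x : R) : 0 <= x -> level_set x !=set0.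
Proof.
move=> x0; have e1 : expR (- x) <= 1 by rewrite -expR0 ler_expR oppr_le0.
have e0 := expR_gt0 (- x).
exists (1 - expR (- x)); split.
  by rewrite subr_ge0 e1 /=; lra.
by apply: log_max_term_ge; lra.
Qed.

Lemma has_lbound_level_set x : has_lbound (level_set x).
Proof. by exists 0 => r [/andP[]]. Qed.

Lemma level_lt1 x : 0 <= x -> level x < 1.
Proof.
move=> /level_set_neq0[r hr]; have [/andP[_ r1] _] := hr.
apply: le_lt_trans r1; apply: ge_inf hr; exact: has_lbound_level_set.
Qed.

Lemma lt_level (x r : R) : 0 <= r -> r < 1 -> r < level x -> u r < x.
Proof.
move=> r0 r1 rl; rewrite ltNge; apply/negP => xu; move: rl; rewrite ltNge.
move=> /negP; apply; apply: ge_inf; first exact: has_lbound_level_set.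
by split => //; rewrite r0.
Qed.

Lemma le_level (x r : R) : 0 <= x -> 0 <= r -> r < 1 -> u r < x -> r <= level x.
Proof.
move=> x0 r0 r1 ux; apply: lb_le_inf; first exact: level_set_neq0.
move=> s [/andP[s0 s1] xs]; rewrite leNgt; apply/negP => sr.
by have := log_max_term_le s0 (ltW sr) r1; lra.
Qed.

(** When 2^(k+1) <= u(r) < 2^(k+2), 1 / u(r) <= eta k: a step (1 - r) eta k covers the step (1 - r)
    / u(r). *)
Let eta (k : nat) : R := 2 ^- k.+1.
Let s (k : nat) := level (2 ^+ k.+2).

Let eta_gt0 k : 0 < eta k. Proof. by rewrite invr_gt0 exprn_gt0. Qed.

Let eta_le k : eta k <= 1 / 2.
Proof.
rewrite /eta div1r lef_pV2 ?posrE ?exprn_gt0// exprS ler_peMr//.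
by rewrite exprn_ege1// ler1n.
Qed.

Let s_lt1 k : s k < 1. Proof. by apply: level_lt1; rewrite exprn_ge0. Qed.

(** The radii r <= s k from which the step (1 - r) eta k ends at s k or beyond: r + (1 - r) eta k >=
    s k is the same as (1 - r) (1 - eta k) <= 1 - s k. *)
Let I k : set R := `[Num.max 0 (1 - (1 - s k) / (1 - eta k)), s k]%classic.

(* Off this set, log_max_term does not double when r moves by (1 - r) / u r. *)
Definition exceptional_set : set R := \bigcup_k I k.

Lemma exceptional_setPn (r : R) k : 0 <= r -> r < 1 -> ~ exceptional_set r ->
  u r < 2 ^+ k.+2 -> u (r + (1 - r) * 2 ^- k.+1) < 2 ^+ k.+2 /\
  r + (1 - r) * 2 ^- k.+1 < 1.
Proof.
move=> r0 r1 rE ur; have e0 := eta_gt0 k; have e1 := eta_le k.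
have rs : r <= s k by apply: le_level => //; rewrite exprn_ge0.
have h : (1 - s k) / (1 - eta k) < 1 - r.
  rewrite ltNge; apply/negP => h; apply: rE; exists k => //.
  rewrite /I /= in_itv /= rs andbT ge_max r0 /=; lra.
move: h; rewrite ltr_pdivrMr; last lra.
rewrite -/(eta k) => h.
have h2 : r + (1 - r) * eta k < s k by nra.
have h3 : r + (1 - r) * eta k < 1 by apply: lt_trans h2 (s_lt1 k).
split => //; apply: lt_level => //; nra.
Qed.

(** On I k the integrand is at most 1 / (1 - s k), and the length of I k is at most (1 - s k) eta k
    / (1 - eta k); the product is at most 2 eta k = 2^-k. *)
Lemma exceptional_set_finite : finite_log_measure exceptional_set.
Proof.
have mI k : measurable (I k) by exact: measurable_itv.
have mE : measurable exceptional_set by apply: bigcup_measurable.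
have E1 r : exceptional_set r -> 0 <= r < 1.
  move=> [k _]; rewrite /I /= in_itv /= ge_max -andbA => /and3P[-> _ rs] /=.
  exact: le_lt_trans rs (s_lt1 k).
split => //.
pose c k := (1 - s k)^-1.
have c0 k : 0 <= c k by rewrite invr_ge0 subr_ge0 ltW.
pose F k (r : R) : R := c k * \1_(I k) r.
have mF k : measurable_fun exceptional_set (F k).
  by apply: measurable_funM => //; exact: measurable_indic.
have F0 k r : 0 <= F k r by rewrite mulr_ge0.
apply: (@le_lt_trans _ _ (\int[lebesgue_measure]_(r in exceptional_set)
    (\sum_(0 <= k <oo) (F k r)%:E))%E).
  apply: ge0_le_integral => //.
  - by move=> r /E1/andP[_ r1]; rewrite lee_fin invr_ge0 subr_ge0 ltW.
  - apply/measurable_EFinP.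
    (* On the set, (1 - r)^-1 equals this composition, whose measurability is immediate. *)
    apply: (@eq_measurable_fun _ _ _ _ _ (fun r : R => expR (- ln (1 - r)))).
      by move=> r; rewrite inE => /E1/andP[_ r1]; rewrite expRN lnK// posrE subr_gt0.
    apply: measurableT_comp => //; apply: measurableT_comp => //.
    by apply: (measurableT_comp (@measurable_ln R)); apply: measurable_funB.
  - apply: ge0_emeasurable_sum; first by move=> k r _ _; rewrite lee_fin.
    by move=> k _; apply/measurable_EFinP; exact: mF.
  move=> r Er; have [k _ Ik] := Er.
  apply: (@le_trans _ _ (F k r)%:E).
    rewrite lee_fin /F indicE mem_set// mulr1 /c lef_pV2 ?posrE ?subr_gt0//.
      by move: Ik; rewrite /I /= in_itv /= => /andP[_]; lra.
    by have /andP[] := E1 r Er.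
  apply: (@le_trans _ _ (\sum_(0 <= i < k.+1) (F i r)%:E)%E).
    rewrite big_nat_recr//=; apply: leeDr.
    by apply: sume_ge0 => i _; rewrite lee_fin.
  by apply: nneseries_lim_ge => i _ _; rewrite lee_fin.
rewrite integral_nneseries//; last 2 first.
- by move=> k; apply/measurable_EFinP; exact: mF.
- by move=> k r _; rewrite lee_fin.
apply: le_lt_trans (ltry (1 / (1 - 1 / 2))).
apply: geometric_nneseries_le; [by []|lra|lra| |].
  by move=> k; apply: integral_ge0 => r _; rewrite lee_fin.
move=> k; rewrite /F; under eq_integral do rewrite EFinM.
rewrite ge0_integralZl_EFin//; last first.
  by apply/measurable_EFinP; apply: measurable_indic; exact: mI.
rewrite integral_indic//; last exact: mI.
apply: (@le_trans _ _ ((c k)%:E * lebesgue_measure (I k))%E).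
  apply: lee_wpmul2l; first by rewrite lee_fin.
  by apply: le_measure; rewrite ?inE//; [exact: (measurableI _ _ (mI k) mE)|exact: mI].
have sk1 : 0 < 1 - s k by rewrite subr_gt0.
have e0 := eta_gt0 k; have e1 := eta_le k; have e2 : 0 < 1 - eta k by lra.
rewrite mul1r.
have etaE : eta k = 2^-1 * 2^-1 ^+ k by rewrite -exprS exprVn.
have hk : 0 <= 2^-1 ^+ k :> R by rewrite exprn_ge0.
rewrite /I lebesgue_measure_itv /= lte_fin; case: ifP => _; last first.
  by rewrite mule0 lee_fin mul1r.
rewrite -EFinB -EFinM lee_fin !mul1r /c mulrC ler_pdivrMr//.
set t := Num.max _ _; have ht : 1 - (1 - s k) / (1 - eta k) <= t by rewrite le_max lexx orbT.
apply: (@le_trans _ _ ((1 - s k) / (1 - eta k) - (1 - s k))).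
  lra.
have -> : (1 - s k) / (1 - eta k) - (1 - s k) = (1 - s k) * (eta k / (1 - eta k)).
  by field; rewrite gt_eqF.
rewrite mulrC ler_wpM2r ?(ltW sk1)// ler_pdivrMr//.
rewrite etaE in e1 *; move: (2^-1 ^+ k) hk e1 => h h0 h1; nra.
Qed.

(** Let rho be the end of the step. Then |a_n| rho^n <= mu_f(rho) <= exp u(rho) <= exp (2 u(r)),
    because u(rho) < 2^(k+2) <= 2 u(r). The step is at least eps = (1 - r) / u(r), whence r / rho <=
    exp (- eps). *)
Lemma max_term_stability (r : R) : 1 / 2 <= r -> r < 1 -> ~ exceptional_set r ->
  2 <= u r -> forall n, cabs (a n) * r ^+ n <= expR (2 * u r - n%:R * ((1 - r) / u r)).
Proof.
move=> r2 r1 rE ur2 n; have r0 : 0 <= r by lra.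
have [k /andP[k1 k2]] : exists k, 2 ^+ k.+1 <= u r < 2 ^+ k.+2.
  have ex : exists k : nat, u r < 2 ^+ k.
    exists (Num.bound (u r)); have u0 : 0 <= u r by lra.
    apply: lt_trans (archi_boundP u0) _.
    by rewrite -natrX ltr_nat ltn_expl.
  case: (ex_minnP ex) => m um mmin.
  case: m um mmin => [|[|m]] um mmin; [rewrite expr0 in um; lra|rewrite expr1 in um; lra|].
  exists m; rewrite um andbT leNgt; apply/negP => /mmin; by rewrite ltnn.
have [] := exceptional_setPn r0 r1 rE k2; set rho := r + _ => urho rho1.
have p2 : 0 < 2 ^+ k.+1 :> R by rewrite exprn_gt0.
have step : (1 - r) / u r <= rho - r.
  rewrite /rho addrAC subrr add0r ler_wpM2l ?subr_ge0 ?(ltW r1)//.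
  by rewrite lef_pV2 ?posrE//; lra.
have e0 : 0 <= (1 - r) / u r by apply: divr_ge0; lra.
have rho0 : 0 < rho by lra.
have h1 : cabs (a n) * rho ^+ n <= expR (2 * u r).
  apply: le_trans (term_le_max_term n (ltW rho0) rho1) _.
  rewrite expR_log_max_term ?(ltW rho0)//.
  apply: (@le_trans _ _ (1 * expR (u rho))).
    by rewrite ler_wpM2r ?expR_ge0//; lra.
  by rewrite mul1r ler_expR; rewrite exprS in k2 urho; rewrite exprS in k1 urho *; lra.
(* exp (- eps) >= 1 - eps, and rho (1 - eps) >= rho - eps >= r because rho < 1. *)
have h2 : r <= rho * expR (- ((1 - r) / u r)).
  have := expR_ge1Dx (- ((1 - r) / u r)); nra.
rewrite expRD; apply: le_trans (ler_wpM2r (expR_ge0 _) h1).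
rewrite -mulrN expRM_natl -mulrA -exprMn ler_wpM2l ?cabs_ge0//.
by rewrite lerXn2r ?nnegrE// mulr_ge0 ?expR_ge0// ltW.
Qed.

End MaxTerm.

(** * The growth rate for one realisation *)

Section RandomSeriesRate.
Variable R : realType.

Lemma inv_prod_sum_le1 N M : \sum_(N <= n < M) (n.+1%:R * n.+2%:R)^-1 <= 1 :> R.
Proof.
have [NM|MN] := leqP N M; last by rewrite big_geq ?ler01// ltnW.
rewrite (@telescope_sumr_eq _ N M (fun k => - k.+1%:R^-1) _ NM) => [|k _].
  rewrite opprK addrC lerBlDr.
  have h1 : N.+1%:R^-1 <= 1 :> R by rewrite invf_le1 ?ltr0n// ler1n.
  have h2 : 0 <= M.+1%:R^-1 :> R by rewrite invr_ge0.
  by apply: le_trans h1 _; rewrite lerDl.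
have k1 : k.+1%:R != 0 :> R by rewrite pnatr_eq0.
have k2 : k.+2%:R != 0 :> R by rewrite pnatr_eq0.
have E : k.+2%:R = k.+1%:R + 1 :> R by rewrite natr1.
rewrite opprK E in k2 *; move: (k.+1%:R : R) k1 k2 => y y0 y1.
by field; rewrite y0 y1.
Qed.

(** Put s = sqrt n. Then s eps >= 8, so n eps >= 8 s, while 2 u <= 2 / eps <= s; the exponential is
    at most exp (- 7 s) <= (1 + s)^-7. The exponent 7 = 2 + 2 + 3 pays for (n + 1)^2 (n + 2). On the
    left, n + 1 will bound |X_n|; the right side telescopes. *)
Lemma tail_term_le (eps u : R) n : 0 < eps -> eps <= 1 -> u <= eps^-1 ->
  64 / eps ^+ 2 <= n%:R ->
  n.+1%:R * expR (2 * u - n%:R * eps) <= (n.+1%:R * n.+2%:R)^-1.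
Proof.
move=> e0 e1 ue hn; set s := Num.sqrt (n%:R : R).
have s2 : s ^+ 2 = n%:R by rewrite sqr_sqrtr.
have s0 : 0 <= s by exact: sqrtr_ge0.
have i1 : 1 <= eps^-1 by rewrite invf_ge1.
have s8 : 8 * eps^-1 <= s.
  rewrite -[leLHS]ger0_norm; last by lra.
  rewrite -sqrtr_sqr ler_wsqrtr// exprMn exprVn; apply: le_trans hn.
  by rewrite le_eqVlt; apply/orP; left; apply/eqP; ring.
have se : 8 <= s * eps by rewrite -ler_pdivrMr.
have ex : expR (2 * u - n%:R * eps) <= ((1 + s) ^+ 7)^-1.
  apply: (@le_trans _ _ (expR (- (7%:R * s)))).
    rewrite ler_expR -s2 expr2; nra.
  rewrite expRN expRM_natl lef_pV2 ?posrE ?exprn_gt0 ?expR_gt0//; last by lra.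
  by apply: lerXn2r; rewrite ?nnegrE ?expR_ge0 ?expR_ge1Dx//; lra.
have p7 : 0 < (1 + s) ^+ 7 by rewrite exprn_gt0//; lra.
have n1 : 0 < n.+1%:R :> R by rewrite ltr0n.
have n2 : 0 < n.+2%:R :> R by rewrite ltr0n.
apply: le_trans (ler_wpM2l (ltW n1) ex) _.
rewrite ler_pdivrMr// mulrC ler_pdivlMr ?mulr_gt0//.
have E1 : n.+1%:R = s ^+ 2 + 1 by rewrite s2 natr1.
have E2 : n.+2%:R = s ^+ 2 + 2 by rewrite s2 -addn2 natrD.
rewrite E1 E2.
have h1 : s ^+ 2 + 1 <= (1 + s) ^+ 2 by rewrite sqrrD; nra.
have h2 : s ^+ 2 + 2 <= (1 + s) ^+ 3 by rewrite !exprS expr0; nra.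
have -> : (1 + s) ^+ 7 = (1 + s) ^+ 2 * ((1 + s) ^+ 2 * (1 + s) ^+ 3).
  by rewrite -!exprD.
have p1 : 0 <= s ^+ 2 + 1 by rewrite addr_ge0 ?sqr_ge0.
have p2 : 0 <= s ^+ 2 + 2 by rewrite addr_ge0 ?sqr_ge0.
apply: ler_pM; [exact: p1|by apply: mulr_ge0|exact: h1|].
by apply: ler_pM; [exact: p1|exact: p2|exact: h1|exact: h2].
Qed.

Lemma ln2_ge_half : 1 / 2 <= ln 2 :> R.
Proof.
rewrite -[leLHS]expRK ler_ln ?posrE ?expR_gt0//.
have := expR_ge1Dx (- (1 / 2) : R); rewrite expRN => h.
have e0 := expR_gt0 (1 / 2 : R).
have : (1 + - (1 / 2)) * expR (1 / 2) <= 1 :> R by rewrite -ler_pdivlMr// [leRHS]div1r.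
lra.
Qed.

Variables (a : nat -> R[i]).
Hypothesis a0 : a 0%N = 1.
Hypothesis a_bounded : coef_bounded a.

Lemma l2_partial_le_mean N (r : R) : 0 <= r -> r < 1 ->
  l2_partial a N r <= l2_mean a r.
Proof.
move=> r0 r1; rewrite ler_wsqrtr//.
have t0 n : 0 <= cabs (a n) ^+ 2 * r ^+ (2 * n).
  by rewrite mulr_ge0 ?sqr_ge0// exprn_ge0.
have [M M0 hM] := coef_bounded_abs_sum a_bounded r0 r1.
have nd : nondecreasing_seq (series (fun n => cabs (a n) ^+ 2 * r ^+ (2 * n))).
  by apply/nondecreasing_seqP => n; rewrite /series /= big_nat_recr//= lerDl.
have cv : cvgn (series (fun n => cabs (a n) ^+ 2 * r ^+ (2 * n))).
  apply: nondecreasing_is_cvgn => //; exists (M ^+ 2) => _ [n _ <-].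
  rewrite /series /= big_mkord.
  apply: (@le_trans _ _ (\sum_(i < n) M * (cabs (a i) * r ^+ i))).
    apply: ler_sum => i _; rewrite mulnC exprM -exprMn expr2 ler_wpM2r//.
      by rewrite mulr_ge0 ?cabs_ge0 ?exprn_ge0.
    apply: le_trans (hM i.+1); rewrite big_ord_recr /= lerDr.
    by apply: sumr_ge0 => k _; rewrite mulr_ge0 ?cabs_ge0 ?exprn_ge0.
  by rewrite -mulr_sumr expr2 ler_wpM2l.
by have := nondecreasing_cvgn_le nd cv N; rewrite /series /= big_mkord.
Qed.

(** With eps = (1 - r) / u(r), j is the least index such that 2^j >= 64 / eps^2. The terms from 2^j
    on sum to at most 1, hence to at most S_f(r) as a 0 = 1. The partial sum costs sqrt j, and
    minimality gives j <= 11 ln (1 / eps). *)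
Lemma random_series_max_modulus (x : nat -> R[i]) (g : HD R) (A : R) m0 J : 0 <= A ->
  (forall m, (m0 <= m)%N -> cabs (x m) <= Num.sqrt m%:R) ->
  (forall j, (J <= j)%N -> forall z : R[i], 1 / 2 <= cabs z -> cabs z < 1 ->
     cabs (\sum_(n < 2 ^ j) a n * z ^+ n * x n) <=
     (2 * Num.sqrt (A * j%:R) + 8) * l2_partial a (2 ^ j) (cabs z)) ->
  power_series_of g (fun n => x n * a n) ->
  exists r0 : R, 0 < r0 < 1 /\ forall r : R, r0 <= r < 1 -> ~ exceptional_set a r ->
    max_modulus g r <= (2 * Num.sqrt (11 * A) + 9) *
      Num.sqrt (ln ((1 - r)^-1 * ln (max_term a r / (1 - r)))) * l2_mean a r.
Proof.
move=> A0 hx hP /power_series_ofP hg.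
have e4 := expR_gt0 (- (4 : R)).
have p0 : 0 < 2 ^- (J + m0) :> R by rewrite invr_gt0 exprn_gt0.
(* 1/2 is the range of the grid bound, 1 - exp (- 4) ensures u(r) >= 4, and 1 - 2^-(J + m0) forces j
   >= J + m0. *)
exists (Num.max (1 / 2) (Num.max (1 - expR (- 4)) (1 - 2 ^- (J + m0)))).
split; first by rewrite !gt_max !lt_max; apply/andP; split; lra.
move=> r /andP[]; rewrite !ge_max => /and3P[r2 rexp rJ] r1 rE.
have r0 : 0 < r by lra.
have q0 : 0 < 1 - r by lra.
have u4 : 4 <= log_max_term a r.
  by apply: (log_max_term_ge a0 a_bounded (ltW r0) r1); lra.
set u := log_max_term a r in u4; rewrite -/(log_max_term a r) -/u.
have u0 : 0 < u by lra.
pose eps := (1 - r) / u.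
have eps0 : 0 < eps by rewrite divr_gt0.
have epsV : eps^-1 = (1 - r)^-1 * u by rewrite invfM invrK.
have iq : 1 <= (1 - r)^-1 by rewrite invf_ge1//; lra.
have eps1 : eps <= 1 by rewrite ler_pdivrMr//; lra.
have ueps : u <= eps^-1 by rewrite epsV ler_peMl// ltW.
have eps64 : 0 < 64 / eps ^+ 2 by rewrite divr_gt0// exprn_gt0.
have ieps : 1 <= eps^-1 by rewrite invf_ge1.
have [j hj jmin] : exists2 j, 64 / eps ^+ 2 <= (2 ^ j)%:R &
    forall i, 64 / eps ^+ 2 <= (2 ^ i)%:R -> (j <= i)%N.
  have ex : exists j : nat, 64 / eps ^+ 2 <= (2 ^ j)%:R.
    exists (Num.bound (64 / eps ^+ 2)).
    apply/ltW/(lt_trans (archi_boundP (ltW eps64))); rewrite ltr_nat; exact: ltn_expl.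
  by case: (ex_minnP ex) => j h1 h2; exists j.
have E64 : 64 / eps ^+ 2 = 64 * (eps^-1 * eps^-1) by rewrite -exprVn expr2.
have jJ : (J + m0 <= j)%N.
  rewrite leqNgt; apply/negP => jlt.
  have : (2 ^ j)%:R <= 2 ^+ (J + m0) :> R by rewrite -natrX ler_nat leq_exp2l// ltnW.
  have : 2 ^+ (J + m0) <= (1 - r)^-1.
    by rewrite -[leLHS]invrK lef_pV2 ?posrE//; lra.
  move: hj; rewrite E64 epsV; nra.
pose L := ln ((1 - r)^-1 * u).
have L1 : 1 <= L.
  rewrite -[leLHS]expRK ler_ln ?posrE ?expR_gt0//; last by rewrite mulr_gt0// invr_gt0.
  have : expR 4 <= (1 - r)^-1.
    by rewrite -[leLHS]invrK -expRN lef_pV2 ?posrE//; lra.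
  have : expR 1 <= expR 4 :> R by rewrite ler_expR; lra.
  have := expR_gt0 (4 : R); nra.
(* For j = i + 1, minimality gives 2^i < 2^6 eps^-2, that is (i - 6) ln 2 < 2 L. As ln 2 >= 1/2, j
   <= 7 + 4 L <= 11 L, using L >= 1. *)
have jL : j%:R <= 11 * L.
  case: j hj jmin jJ => [|i] hj jmin jJ; first by lra.
  have : (2 ^ i)%:R < 64 / eps ^+ 2.
    by rewrite ltNge; apply/negP => /jmin; rewrite ltnn.
  have -> : 64 / eps ^+ 2 = 2 ^+ 6 * (eps^-1) ^+ 2.
    by rewrite exprVn; congr (_ * _); rewrite -natrX.
  rewrite natrX -ltr_ln ?posrE ?mulr_gt0 ?exprn_gt0 ?invr_gt0//.
  rewrite lnM ?posrE ?exprn_gt0 ?invr_gt0// !lnXn ?invr_gt0// epsV -/L.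
  rewrite -!(mulr_natl (ln 2)) -(mulr_natl L) => h.
  have l2 := ln2_ge_half; rewrite -natr1.
  have i0 : 0 <= i%:R :> R by [].
  have [i6|i6] := lerP (i%:R : R) 6; nra.
have N0 : (0 < 2 ^ j)%N by rewrite expn_gt0.
have mN : (m0 <= 2 ^ j)%N.
  by apply: leq_trans (ltnW (ltn_expl j (isT : (1 < 2)%N))); apply: leq_trans jJ; rewrite leq_addl.
have S1 := l2_partial_ge1 a0 r N0; have SS := l2_partial_le_mean (2 ^ j) (ltW r0) r1.
have bound z : cabs (val z) = r -> cabs (g z) <=
    (2 * Num.sqrt (A * j%:R) + 8) * l2_partial a (2 ^ j) r + 1.
  move=> zr; apply: le_trans (cabs_le_triangle _ (\sum_(i < 2 ^ j) x i * a i * val z ^+ i)) _.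
  apply: lerD.
    have := hP j (leq_trans (leq_addr _ _) jJ) (val z); rewrite zr => /(_ r2 r1).
    apply: le_trans; rewrite le_eqVlt; apply/orP; left; apply/eqP.
    by congr cabs; apply: eq_bigr => i _; rewrite [RHS]mulrC mulrA.
  apply: abs_csum_tail (hg z) _ => M; apply: le_trans (inv_prod_sum_le1 (2 ^ j) M).
  rewrite big_nat_cond [leRHS]big_nat_cond; apply: ler_sum => i.
  move=> /andP[/andP[Ni _] _].
  have hi : 64 / eps ^+ 2 <= i%:R by apply: le_trans hj _; rewrite ler_nat.
  apply: le_trans (tail_term_le eps0 eps1 ueps hi).
  rewrite !cabsM cabsX zr -mulrA.
  apply: ler_pM; rewrite ?cabs_ge0 ?mulr_ge0 ?exprn_ge0 ?cabs_ge0 ?(ltW r0)//.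
    apply: le_trans (hx i (leq_trans mN Ni)) _.
    rewrite -[leRHS]ger0_norm// -sqrtr_sqr ler_wsqrtr// -natrX ler_nat.
    by apply: leq_trans (leqnSn i) _; rewrite expnS leq_pmulr.
  apply: (max_term_stability a0 a_bounded r2 r1 rE); rewrite -/u; lra.
have sL : 1 <= Num.sqrt L by rewrite -[leLHS]sqrtr1 ler_wsqrtr.
have sAj : Num.sqrt (A * j%:R) <= Num.sqrt (11 * A) * Num.sqrt L.
  rewrite -sqrtrM; last by rewrite mulr_ge0.
  by rewrite ler_wsqrtr// [11 * A]mulrC -mulrA ler_wpM2l.
apply: ge_sup.
  have cr : cabs (r%:C%C : R[i]) = r by rewrite cabs_real ger0_norm// ltW.
  have r1' : cabs (r%:C%C : R[i]) < 1 by rewrite cr.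
  by exists (cabs (g (disc_pt r1'))), (disc_pt r1').
move=> _ [z /= zr <-]; apply: le_trans (bound z zr) _.
have A11 : 0 <= Num.sqrt (11 * A) by exact: sqrtr_ge0.
set S := l2_mean a r in SS *; set S' := l2_partial a _ r in S1 SS *.
rewrite -/L; set q := Num.sqrt L in sL sAj *.
apply: (@le_trans _ _ ((2 * (Num.sqrt (11 * A) * q) + 8) * S + 1)).
  rewrite lerD2r; apply: ler_pM; [|by apply: le_trans S1|by rewrite lerD2r ler_wpM2l|exact: SS].
  by rewrite addr_ge0// mulr_ge0// sqrtr_ge0.
have S0 : 1 <= S by lra.
nra.
Qed.

End RandomSeriesRate.

(** * Assembly of the almost sure statements *)

Theorem theorem6p3 (R : realType) (d : measure_display)
    (Omega : measurableType d) (P : probability Omega R)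
    (w : nat -> R[i]) (Bw : {linear HD R -> HD R})
    (X : {RV P >-> borelC R}) (X_ : nat -> {RV P >-> borelC R})
    (hw : forall n, (1 <= n)%N -> w n != 0)
    (hBw : weighted_shift w Bw) (Bw_cont : continuous Bw)
    (Bw_chaotic : chaotic Bw)
    (X_centred : centred X) (X_subgaussian : subgaussian X)
    (X_full : full_support X) (X_iid : iid_copies X X_) :
  let a : nat -> R[i] := fun n => (\prod_(1 <= k < n.+1) w k)^-1 in
  let c : Omega -> nat -> R[i] := fun o n => (X_ n o : R[i]) * a n in
  {ae P, forall o, exists g : HD R,
     power_series_of g (c o) /\ frequently_hypercyclic R Bw g} /\
  exists f : HD R, power_series_of f a /\
  exists (E : set R) (C : R), finite_log_measure E /\ 0 < C /\
    {ae P, forall o, exists g : HD R, power_series_of g (c o) /\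
       exists r0 : R, 0 < r0 < 1 /\
         forall r : R, r0 <= r < 1 -> ~ E r ->
           max_modulus g r <=
             C * Num.sqrt (ln ((1 - r)^-1 * ln (max_term a r / (1 - r))))
               * l2_mean a r}.
Proof.
move=> a c.
have [K [tau [K0 tau0 X_tail]]] := X_subgaussian.
have a_bounded : coef_bounded a := chaotic_coef_bounded hw hBw Bw_chaotic.
have a0 : a 0%N = 1 := shift_coef0 w.
have growth := iid_sqrt_growth_ae X_iid K0 tau0 X_tail.
split; first exact: (frequently_hypercyclic_ae X_iid K0 tau0 X_tail X_full hw hBw).
have [f hf] := HD_of_coefs a_bounded; exists f; split => //.
have [B B0 X_mgf] := subgaussian_mgf K0 tau0 X_tail X_centred.
have A0 : 0 <= 4 * B * ln 512.
  by rewrite !mulr_ge0 ?ln_ge0 ?ler1n// ltW.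
(* [grid_threshold j] is sqrt (A j) with A = 4 B ln 512; the numbers 11 and 9 come from
   [random_series_max_modulus]. *)
exists (exceptional_set a), (2 * Num.sqrt (11 * (4 * B * ln 512)) + 9).
split; first exact: exceptional_set_finite.
split; first by rewrite ltr_wpDl// mulr_ge0// sqrtr_ge0.
apply: filterS3 (random_coef_bounded_ae X_iid K0 tau0 X_tail a_bounded) growth
  (random_poly_bound_ae B0 (deviation_event X_iid B0 X_mgf) growth a0).
move=> o co [m0 hm0] [J hJ]; have [g hg] := HD_of_coefs co.
exists g; split => //.
exact: (random_series_max_modulus a0 a_bounded A0 hm0 hJ hg).
Qed.
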